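(* Let $p$ be an odd prime and let $G$ be a GGS-group acting on the $p$-regular rooted tree $T$. Then every maximal subgroup of $G$ is of finite index in $G$. Furthermore, if $G$ is a branch group, then every maximal subgroup of $G$ is normal and of index $p$ in $G$.
   Context: Let $p$ be an odd prime, $X=\{1,2,\ldots,p\}$, and let $T$ be the $p$-regular rooted tree, whose vertices are identified with the free monoid $X^*$ (root $=\varnothing$, each $v\in X^*$ joined to $vx$ for $x\in X$). The group $\mathrm{Aut}\,T$ acts on $T$ on the right. For $f\in\mathrm{Aut}\,T$ and $u\in X^*$, the section $f_u\in \mathrm{Aut}\,T$ is defined by $(uv)^f=u^f v^{f_u}$ for all $v\in X^*$. For $f$ fixing all vertices of level $1$, write $\psi(f)=(f_1,\ldots,f_p)$ for the tuple of its first-level sections. GGS-groups: let $a\in\mathrm{Aut}\,T$ be the rooted automorphism permuting the first letter of each word by the $p$-cycle $(1\,2\,\cdots\,p)$ and leaving the remaining letters unchanged. Given a non-zero vector $\mathbf e=(e_1,\ldots,e_{p-1})\in\mathbb F_p^{\,p-1}$, let $b\in \mathrm{Aut}\,T$ be the automorphism fixing all first-level vertices defined recursively by $\psi(b)=(a^{e_1},\ldots,a^{e_{p-1}},b)$. The group $G=G_{\mathbf e}=\langle a,b\rangle\le \mathrm{Aut}\,T$ is the GGS-group with defining vector $\mathbf e$. Branch groups: for $G\le\mathrm{Aut}\,T$ and a vertex $u$, the rigid vertex stabiliser $\mathrm{rist}_G(u)$ consists of all elements of $G$ fixing every vertex that does not have $u$ as a prefix, and $\mathrm{Rist}_G(n)=\prod_{|u|=n}\mathrm{rist}_G(u)$.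 A group $G\le \mathrm{Aut}\,T$ acting transitively on every level of $T$ is a branch group if $\mathrm{Rist}_G(n)$ has finite index in $G$ for every $n\in\mathbb N$. *)

(* Defs.v *)
From HB Require Import structures.
From mathcomp Require Import all_boot all_algebra.
From mathcomp Require Import boolp classical_sets functions cardinality.

Set Implicit Arguments.
Unset Strict Implicit.
Unset Printing Implicit Defensive.

Local Open Scope classical_set_scope.
Local Open Scope card_scope.
Local Open Scope group_scope.

(* Vertices of the p-regular rooted tree: words over 'I_p, where i : 'I_p
   stands for the letter i + 1 of {1, ..., p}; the root is [::]. *)
Notation word p := (seq 'I_p).

Definition is_child p (u v : word p) : bool := [exists x, v == rcons u x].

Definition adjacent p (u v : word p) : bool := is_child u v || is_child v u.

Record tree_aut (p : nat) := TreeAut {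
  aut_fun :> word p -> word p;
  aut_inv : word p -> word p;
  aut_funK : cancel aut_fun aut_inv;
  aut_invK : cancel aut_inv aut_fun;
  aut_root : aut_fun [::] = [::];
  aut_adj : forall u v, adjacent (aut_fun u) (aut_fun v) = adjacent u v }.

Lemma tree_autP p (f g : tree_aut p) : f =1 g -> f = g.
Proof.
case: f g => [f fi fK fiK f0 fa] [g gi gK giK g0 ga] /= /funext fg.
subst g; have fgi : fi = gi by apply/funext => v; rewrite -{1}(giK v) fK.
by subst gi; congr TreeAut; exact: Prop_irrelevance.
Qed.

Section TreeAutGroup.
Variable p : nat.
Implicit Types f g : tree_aut p.

Definition tree_aut_one : tree_aut p :=
  @TreeAut p id id (fun=> erefl) (fun=> erefl) erefl (fun _ _ => erefl).

Definition tree_aut_inv f : tree_aut p.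
Proof.
apply: (@TreeAut p (aut_inv f) f (aut_invK f) (aut_funK f)).
- by rewrite -{1}(aut_root f) aut_funK.
- by move=> u v; rewrite -(aut_adj f) !aut_invK.
Defined.

(* Right action: u^(f * g) = (u^f)^g. *)
Definition tree_aut_mul f g : tree_aut p.
Proof.
apply: (@TreeAut p (fun u => g (f u)) (fun u => aut_inv f (aut_inv g u))).
- by move=> u; rewrite !aut_funK.
- by move=> u; rewrite !aut_invK.
- by rewrite !aut_root.
- by move=> u v; rewrite !aut_adj.
Defined.

Fact tree_aut_mulA : associative tree_aut_mul.
Proof. by move=> f g h; apply: tree_autP. Qed.

Fact tree_aut_mul1 : left_id tree_aut_one tree_aut_mul.
Proof. by move=> f; apply: tree_autP. Qed.

Fact tree_aut_mulr1 : right_id tree_aut_one tree_aut_mul.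
Proof. by move=> f; apply: tree_autP. Qed.

Fact tree_aut_mulV : left_inverse tree_aut_one tree_aut_inv tree_aut_mul.
Proof. by move=> f; apply: tree_autP => u /=; rewrite aut_invK. Qed.

Fact tree_aut_mulrV : right_inverse tree_aut_one tree_aut_inv tree_aut_mul.
Proof. by move=> f; apply: tree_autP => u /=; rewrite aut_funK. Qed.

HB.instance Definition _ := gen_eqMixin (tree_aut p).
HB.instance Definition _ := gen_choiceMixin (tree_aut p).
HB.instance Definition _ := isGroup.Build (tree_aut p)
  tree_aut_mulA tree_aut_mul1 tree_aut_mulr1 tree_aut_mulV tree_aut_mulrV.

Lemma tree_autM f g u : (f * g) u = g (f u).
Proof. by []. Qed.

End TreeAutGroup.

Section Adjacency.
Variable p : nat.
Implicit Types u v : word p.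

Lemma adjacentC u v : adjacent u v = adjacent v u.
Proof. exact: orbC. Qed.

Lemma adjacent_nil v : adjacent [::] v = (size v == 1)%N.
Proof.
rewrite /adjacent /is_child.
have -> : [exists x, [::] == rcons v x] = false.
  by apply/existsP => -[x]; case: v.
rewrite orbF; apply/existsP/idP => [[x /eqP ->] //|].
by case: v => [|x []] // _; exists x.
Qed.

Lemma adjacent_cons x y u v :
  adjacent (x :: u) (y :: v) = (x == y) && adjacent u v.
Proof.
have H (x' y' : 'I_p) u' v' :
    is_child (x' :: u') (y' :: v') = (x' == y') && is_child u' v'.
  apply/existsP/andP => [[z] | [/eqP-> /existsP[z /eqP->]]]; last by exists z.
  by rewrite /= eqseq_cons eq_sym => /andP[-> h]; split=> //; apply/existsP; exists z.
by rewrite /adjacent !H (eq_sym y) -andb_orr.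
Qed.

End Adjacency.

Section Generators.
Variable p : nat.

Definition rooted_fun (s : 'I_p -> 'I_p) (w : word p) : word p :=
  if w is x :: v then s x :: v else [::].

Definition gen_a : tree_aut p.
Proof.
apply: (@TreeAut p (rooted_fun (@ordS p)) (rooted_fun (@ord_pred p))).
- by case=> //= x v; rewrite ordSK.
- by case=> //= x v; rewrite ord_predK.
- by [].
- move=> [|x u] [|y v] //=; rewrite ?adjacent_nil // 1?adjacentC ?adjacent_nil //.
    by rewrite adjacentC adjacent_nil.
  by rewrite adjacentC !adjacent_cons (inj_eq (can_inj (@ordSK p))).
Defined.

Variable e : 'rV['F_p]_p.-1.

(* The section of b at the letter x is a ^ e_x for the first p - 1 letters,
   and b itself at the last one. *)
Fixpoint directed_fun (w : word p) : word p :=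
  match w with
  | [::] => [::]
  | x :: v => x :: (if (insub (x : nat) : option 'I_p.-1) is Some i
                    then (gen_a ^+ nat_of_ord (e ord0 i)) v
                    else directed_fun v)
  end.

Fixpoint directed_inv (w : word p) : word p :=
  match w with
  | [::] => [::]
  | x :: v => x :: (if (insub (x : nat) : option 'I_p.-1) is Some i
                    then (gen_a ^- nat_of_ord (e ord0 i)) v
                    else directed_inv v)
  end.

Lemma tree_aut_eq_nil (f : tree_aut p) v : (f v == [::]) = (v == [::]).
Proof. by rewrite -{1}(aut_root f) (inj_eq (can_inj (aut_funK f))). Qed.

Definition gen_b : tree_aut p.
Proof.
apply: (@TreeAut p directed_fun directed_inv).
- elim=> //= x v IHv; case: insub => [i|]; last by rewrite IHv.
  by congr cons; apply: aut_funK.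
- elim=> //= x v IHv; case: insub => [i|]; last by rewrite IHv.
  by congr cons; apply: aut_invK.
- by [].
- have nil1 v : adjacent [::] (directed_fun v) = adjacent [::] v.
    rewrite !adjacent_nil; case: v => //= x v; rewrite !eqSS !size_eq0.
    by case: insub => [i|]; [exact: tree_aut_eq_nil | case: v].
  elim=> [|x u IHu] [|y v]; rewrite ?nil1 //.
    by rewrite adjacentC [RHS]adjacentC; exact: nil1.
  rewrite /= !adjacent_cons; case: eqP => //= <-.
  by case: insub => [i|]; [exact: aut_adj | exact: IHu].
Defined.

End Generators.

Definition is_section p (f : tree_aut p) (u : word p) (g : tree_aut p) : Prop :=
  forall v, f (u ++ v) = f u ++ g v.

Lemma gen_b_level1 p (e : 'rV['F_p]_p.-1) (x : 'I_p) : gen_b e [:: x] = [:: x].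
Proof.
by rewrite /=; case: insub => [i|] //; congr cons; apply/eqP; rewrite tree_aut_eq_nil.
Qed.

Lemma gen_b_section p (e : 'rV['F_p]_p.-1) (x : 'I_p) (i : 'I_p.-1) :
  x = i :> nat ->
  is_section (gen_b e) [:: x] (gen_a p ^+ nat_of_ord (e ord0 i)).
Proof. by move=> xi v; rewrite gen_b_level1 /= xi valK. Qed.

Lemma gen_b_section_last p (e : 'rV['F_p]_p.-1) (x : 'I_p) :
  x = p.-1 :> nat -> is_section (gen_b e) [:: x] (gen_b e).
Proof. by move=> xp v; rewrite gen_b_level1 /= xp insubF ?ltnn. Qed.

Section Subgroups.
Variable gT : groupType.
Implicit Types (H G M : set gT).

Definition is_subgroup H : Prop :=
  [/\ H 1, forall x y, H x -> H y -> H (x * y) & forall x, H x -> H x^-1].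

Definition generated (A : set gT) : set gT := smallest is_subgroup A.

Definition right_cosets H G : set (set gT) := [set [set h * g | h in H] | g in G].

Definition finite_index H G : Prop := finite_set (right_cosets H G).

Definition has_index H G (n : nat) : Prop := right_cosets H G #= `I_n.

Definition normal_subgroup H G : Prop :=
  [/\ is_subgroup H, H `<=` G & forall x g, H x -> G g -> H (x ^ g)].

Definition maximal_subgroup M G : Prop :=
  [/\ is_subgroup M, M `<` G &
      forall K, is_subgroup K -> M `<=` K -> K `<=` G -> K = M \/ K = G].

End Subgroups.

Section Branch.
Variable p : nat.
Implicit Types (G : set (tree_aut p)).

Definition level_transitive G : Prop :=
  forall u v : word p, size u = size v -> exists2 g, G g & g u = v.

Definition rist G (u : word p) : set (tree_aut p) :=
  [set g | G g /\ forall v, ~~ prefix u v -> g v = v].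

(* The factors commute pairwise, so their order is immaterial. *)
Definition Rist G (n : nat) : set (tree_aut p) :=
  [set \prod_(u : n.-tuple 'I_p) h u
     | h in [set h : n.-tuple 'I_p -> tree_aut p |
               forall u : n.-tuple 'I_p, rist G u (h u)]].

Definition is_branch G : Prop :=
  level_transitive G /\ forall n, finite_index (Rist G n) G.

End Branch.

Definition GGS p (e : 'rV['F_p]_p.-1) : set (tree_aut p) :=
  generated [set gen_a p; gen_b e].

(* Main.v *)
(* Call a subgroup M of G prodense if M N = G for every nontrivial normal subgroup N.  The only
   prodense subgroup is G.  Prodensity passes to the groups of sections of M at a vertex; if all of
   these are G, an element of M stabilising the first level with minimal support there forces
   M = G.  Otherwise one may keep passing to proper section groups, and comparing the syllable
   lengths of an element and of the sections of its p-th power one reaches a proper prodense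
   subgroup containing both generators.

   If e is not constant, every nontrivial normal subgroup contains the product of the copies of
   gamma_4(G) over some level, and modulo that product G is a finite p-group.  Hence M G' = G implies
   that M is prodense, and every maximal subgroup contains G', where G / G' has exponent p.

   If e is constant equal to c, let K be the normal closure of t = b a^-c.  Every nontrivial normal
   subgroup contains the product of the copies of [K', K] over some level, modulo which G is virtually
   nilpotent of class 2; in such finitely generated groups maximal subgroups have finite index, so
   that a maximal subgroup of infinite index would be prodense.  Here G is not branch: a crossed
   homomorphism from G to the complex numbers, extending t^n |-> n, prevents (t^n, 1, ..., 1) with
   n > 0 from lying in G, whereas (t, t^-1, 1, ..., 1) is in G. *)
Require Import Defs.
From mathcomp Require Import all_boot all_algebra finfield algC cyclotomic.
From mathcomp Require Import zify ring.
From mathcomp Require Import boolp classical_sets functions cardinality.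

Set Implicit Arguments.
Unset Strict Implicit.
Unset Printing Implicit Defensive.

Import GRing.Theory Num.Theory.
Local Open Scope classical_set_scope.
Local Open Scope group_scope.

(** The relations of [G] are not known, so nothing is counted on elements: a word is a list of
    powers of conjugates of [b] followed by a power of [a], sections are computed on words, and the
    section at [j] keeps exactly the syllables at [j]. Hence the lengths of the sections add up to
    that of the word, and a section fails to be shorter only if all syllables stand at one letter;
    up to a power of [a], such a word is a power of a single conjugate of [b]. If a word moves the
    letters, the sections of its [p]-th power keep its length, and their exponents of [a] and [b]
    are proportional to those of [a^sigma b], with [sigma] the sum of the entries of [e]. For
    [sigma = 0] these sections fix the first level and can be shortened again. For [sigma != 0] a
    second element, independent of the odometer [a^sigma b] modulo [G'], has to be carried along and
    multiplied into the stabiliser, and the bookkeeping must keep this multiplication from undoing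
    the gain in length. That some section stays independent rests on the group algebra of the cyclic
    group of order [p] over ['F_p] being local. Oddness of [p] enters mainly through [j != - j] for
    [j != 0]. *)

Ltac grpnorm := rewrite /commg /conjg
  ?(invgM, invgK, invg1, mulg1, mul1g, mulgA, mulgK, mulgVK, mulVg, mulgV).

(** * Elementary group theory for subsets of a group *)

Section CommutatorIdentities.
Variable gT : groupType.
Implicit Types x y z : gT.

Lemma comm_mull x y z : [~ x * y, z] = [~ x, z] ^ y * [~ y, z].
Proof. by grpnorm. Qed.
Lemma comm_mulr x y z : [~ x, y * z] = [~ x, z] * [~ x, y] ^ z.
Proof. by grpnorm. Qed.
Lemma comm_invl x z : [~ x^-1, z] = [~ x, z]^-1 ^ x^-1.
Proof. by grpnorm. Qed.
Lemma comm_invr x z : [~ x, z^-1] = [~ x, z]^-1 ^ z^-1.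
Proof. by grpnorm. Qed.

End CommutatorIdentities.

Section GroupSets.
Variable gT : groupType.
Implicit Types (H G M N A B X Y : set gT) (x y g h : gT).

Lemma subg1 H : is_subgroup H -> H 1. Proof. by case. Qed.
Lemma subgM H x y : is_subgroup H -> H x -> H y -> H (x * y).
Proof. by case=> _ + _; apply. Qed.
Lemma subgV H x : is_subgroup H -> H x -> H x^-1.
Proof. by case=> _ _; apply. Qed.
Lemma subgVr H x : is_subgroup H -> H x^-1 -> H x.
Proof. by move=> sH /(subgV sH); rewrite invgK. Qed.
Lemma subgX H x n : is_subgroup H -> H x -> H (x ^+ n).
Proof.
move=> sH Hx; elim: n => [|n IH]; first exact: subg1.
by rewrite expgS; apply: subgM.
Qed.
Lemma subgJ H x y : is_subgroup H -> H x -> H y -> H (x ^ y).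
Proof. by move=> sH Hx Hy; apply: subgM => //; [exact: subgV | exact: subgM]. Qed.
Lemma subgR H x y : is_subgroup H -> H x -> H y -> H [~ x, y].
Proof. by move=> sH Hx Hy; apply: subgM => //; [exact: subgV | exact: subgJ]. Qed.
Lemma subgMr H x y : is_subgroup H -> H x -> H (x * y) -> H y.
Proof. by move=> sH Hx /(subgM sH (subgV sH Hx)); rewrite mulKg. Qed.
Lemma subgMl H x y : is_subgroup H -> H y -> H (x * y) -> H x.
Proof. by move=> sH Hy Hxy; have := subgM sH Hxy (subgV sH Hy); rewrite mulgK. Qed.

Lemma generated_subgroup A : is_subgroup (generated A).
Proof.
split=> [H [sH _]|x y gx gy H [sH AH]|x gx H [sH AH]].
- exact: subg1.
- by apply: subgM => //; [exact: gx | exact: gy].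
- by apply: subgV => //; exact: gx.
Qed.

Lemma mem_generated A x : A x -> generated A x.
Proof. by move=> Ax H [_ AH]; exact: AH. Qed.

Lemma generated_sub A H : is_subgroup H -> A `<=` H -> generated A `<=` H.
Proof. by move=> sH AH x gx; exact: gx (conj sH AH). Qed.

Lemma generatedJ A g : (forall x, A x -> generated A (x ^ g)) ->
  forall x, generated A x -> generated A (x ^ g).
Proof.
move=> AJ x; apply: (generated_sub (H := [set x | generated A (x ^ g)])) => //=.
have sA := generated_subgroup A; split=> [|y z /= Ay Az|y /= Ay] /=.
- by rewrite conj1g; exact: subg1 sA.
- by rewrite conjMg; exact: subgM sA Ay Az.
- by rewrite conjVg; exact: subgV sA Ay.
Qed.

Definition commutator_subgroup A B : set gT :=
  generated [set z | exists x y, [/\ A x, B y & z = [~ x, y]]].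

Lemma mem_commutator A B x y : A x -> B y -> commutator_subgroup A B [~ x, y].
Proof. by move=> Ax By; apply: mem_generated; exists x, y. Qed.

Lemma commutator_sub A B H : is_subgroup H ->
  (forall x y, A x -> B y -> H [~ x, y]) -> commutator_subgroup A B `<=` H.
Proof. by move=> sH h; apply: generated_sub => // _ [x [y [? ? ->]]]; exact: h. Qed.

Lemma commutator_subgroupP A B : is_subgroup (commutator_subgroup A B).
Proof. exact: generated_subgroup. Qed.

Lemma commutatorJ A B g : (forall x, A x -> A (x ^ g)) ->
  (forall x, B x -> B (x ^ g)) ->
  forall x, commutator_subgroup A B x -> commutator_subgroup A B (x ^ g).
Proof.
move=> AJ BJ; apply: generatedJ => _ [x [y [Ax By ->]]].
by rewrite conjRg; apply: mem_commutator; [exact: AJ | exact: BJ].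
Qed.

Lemma normal_subg N G : normal_subgroup N G -> is_subgroup N.
Proof. by case. Qed.
Lemma normal_sub N G : normal_subgroup N G -> N `<=` G.
Proof. by case. Qed.
Lemma normalJ N G x g : normal_subgroup N G -> N x -> G g -> N (x ^ g).
Proof. by case=> _ _; apply. Qed.
Lemma normalR N G x g : normal_subgroup N G -> N x -> G g -> N [~ x, g].
Proof.
move=> nN Nx Gg; rewrite commgEl; apply: subgM (normal_subg nN) _ _.
  exact: subgV (normal_subg nN) Nx.
exact: normalJ nN Nx Gg.
Qed.

Lemma normal_refl G : is_subgroup G -> normal_subgroup G G.
Proof. by move=> sG; split=> // x g; exact: subgJ. Qed.

Lemma commutator_normal A B G : is_subgroup G -> normal_subgroup A G ->
  normal_subgroup B G -> normal_subgroup (commutator_subgroup A B) G.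
Proof.
move=> sG nA nB; split; first exact: commutator_subgroupP.
  apply: commutator_sub => // x y Ax By; apply: subgR => //.
    exact: (normal_sub nA).
  exact: (normal_sub nB).
move=> x g cx Gg; apply: commutatorJ cx => y Xy.
  exact: normalJ nA Xy Gg.
exact: normalJ nB Xy Gg.
Qed.

Lemma normalI A B G : normal_subgroup A G -> normal_subgroup B G ->
  normal_subgroup (A `&` B) G.
Proof.
move=> nA nB; have [sA sB] := (normal_subg nA, normal_subg nB); split.
- split; first by split; exact: subg1.
  + by move=> x y [? ?] [? ?]; split; exact: subgM.
  + by move=> x [? ?]; split; exact: subgV.
- by move=> x [/(normal_sub nA)].
- by move=> x g [Ax Bx] Gg; split; [exact: normalJ nA _ Gg | exact: normalJ nB _ Gg].
Qed.

Definition gprod M N : set gT := [set z | exists m n, [/\ M m, N n & z = m * n]].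

Lemma gprodl M N : N 1 -> M `<=` gprod M N.
Proof. by move=> N1 m Mm; exists m, 1; rewrite mulg1. Qed.
Lemma gprodr M N : M 1 -> N `<=` gprod M N.
Proof. by move=> M1 n Nn; exists 1, n; rewrite mul1g. Qed.

Lemma gprod_subgroup M N G : is_subgroup M -> M `<=` G -> normal_subgroup N G ->
  is_subgroup (gprod M N).
Proof.
move=> sM MG nN; have sN := normal_subg nN; split.
- by exists 1, 1; rewrite mulg1; split=> //; exact: subg1.
- move=> _ _ [m [n [Mm Nn ->]]] [m' [n' [Mm' Nn' ->]]].
  exists (m * m'), (n ^ m' * n'); split; first exact: subgM.
    by apply: subgM => //; apply: normalJ nN Nn _; exact: MG.
  by grpnorm.
- move=> _ [m [n [Mm Nn ->]]]; exists m^-1, (n^-1 ^ m^-1); split.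
  + exact: subgV.
  + by apply: normalJ nN _ _; [exact: subgV | apply: MG; exact: subgV].
  + by grpnorm.
Qed.

Lemma gprod_sub M N G : is_subgroup G -> M `<=` G -> N `<=` G -> gprod M N `<=` G.
Proof. by move=> sG MG NG _ [m [n [/MG ? /NG ? ->]]]; exact: subgM. Qed.

(** Conjugation by [N] preserves [M] by the first commutator condition, so modulo [M] only
    commutators of elements of [N] survive in [[G, G]], and the last condition removes these. *)
Lemma central_supplement M N G : is_subgroup M -> is_subgroup G ->
  G `<=` gprod M N ->
  (forall x m, N x -> M m -> M [~ x, m]) -> (forall x y, N x -> N y -> M [~ x, y]) ->
  commutator_subgroup G G `<=` M.
Proof.
move=> sM sG GMN cNM cNN; apply: commutator_sub => // g h.
move=> /GMN [m [x [Mm Nx ->]]] /GMN [l [y [Ml Ny ->]]].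
have MJ u z : N z -> M u -> M (u ^ z).
  move=> Nz Mu; have -> : u ^ z = u * [~ z, u]^-1 by grpnorm.
  by apply: subgM => //; apply: subgV => //; exact: cNM.
have -> : [~ m * x, l * y] = [~ m, y] ^ x * [~ x, y] * ([~ m, l] ^ x * [~ x, l]) ^ y.
  by grpnorm.
apply: subgM => //; first apply: subgM => //.
- by apply: (MJ _ _ Nx); apply: subgM => //; [exact: subgV | exact: MJ].
- exact: cNN.
apply: (MJ _ _ Ny); apply: subgM => //; last exact: cNM.
by apply: (MJ _ _ Nx); exact: subgR.
Qed.

End GroupSets.

(** * Sections of tree automorphisms *)

Section TreeAut.
Variable p : nat.
Implicit Types (f g h : tree_aut p) (x y z : 'I_p) (u v w : word p).

Definition act f x : 'I_p := head x (f [:: x]).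

Lemma aut_neq_nil f x v : f (x :: v) <> [::].
Proof. by move/eqP; rewrite tree_aut_eq_nil. Qed.

(** An automorphism is only known to preserve adjacency. Neighbouring non-empty words share their
    first letter, and [x :: v] is reached from [[:: x]] by appending letters. *)
Lemma aut_cons f x v : f (x :: v) = act f x :: behead (f (x :: v)).
Proof.
suff hd : head x (f (x :: v)) = act f x.
  by rewrite -hd; case: (f (x :: v)) (@aut_neq_nil f x v).
elim/last_ind: v => // v z <-.
have : adjacent (f (x :: rcons v z)) (f (x :: v)).
  by rewrite aut_adj adjacentC /adjacent /is_child; apply/orP; left; apply/existsP; exists z.
case: (f (x :: rcons v z)) (@aut_neq_nil f x (rcons v z)) => // y1 t1 _.
case: (f (x :: v)) (@aut_neq_nil f x v) => // y2 t2 _.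
by rewrite adjacent_cons => /andP[/eqP-> _].
Qed.

Lemma aut_letter f x : f [:: x] = [:: act f x].
Proof.
have : adjacent (f [::]) (f [:: x]) by rewrite aut_adj adjacent_nil.
by rewrite aut_root adjacent_nil /act; case: (f [:: x]) => [|y []].
Qed.

Lemma actK f x : act f^-1 (act f x) = x.
Proof.
have : f^-1 (f [:: x]) = [:: x] by exact: aut_funK.
by rewrite !aut_letter => -[].
Qed.

Definition sec f x : tree_aut p.
Proof.
apply: (@TreeAut p (fun v => behead (f (x :: v)))
          (fun v => behead (aut_inv f (act f x :: v)))).
- by move=> v; rewrite -aut_cons aut_funK.
- move=> v; have := aut_cons f^-1 (act f x) v; rewrite actK => E.
  have E' : aut_inv f (act f x :: v) = x :: behead (aut_inv f (act f x :: v)).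
    exact: E.
  by rewrite -E' aut_invK.
- by rewrite aut_letter.
- move=> u v; have := aut_adj f (x :: u) (x :: v).
  by rewrite (aut_cons f x u) (aut_cons f x v) !adjacent_cons !eqxx.
Defined.

Arguments sec : simpl never.

Lemma autE f x v : f (x :: v) = act f x :: sec f x v.
Proof. exact: aut_cons. Qed.

Lemma aut_ext f g : (forall x, act f x = act g x) ->
  (forall x, sec f x = sec g x) -> f = g.
Proof.
move=> fg sfg; apply: tree_autP => -[|x v]; first by rewrite !aut_root.
by rewrite !autE fg sfg.
Qed.

Lemma act1 x : act 1 x = x. Proof. by []. Qed.
Lemma sec1 x : sec 1 x = 1. Proof. exact: tree_autP. Qed.

Lemma actM f g x : act (f * g) x = act g (act f x).
Proof. by rewrite {1}/act tree_autM aut_letter aut_letter. Qed.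

Lemma secM f g x : sec (f * g) x = sec f x * sec g (act f x).
Proof. by apply: tree_autP => v; rewrite tree_autM /= autE. Qed.

Lemma actVK f x : act f (act f^-1 x) = x.
Proof. by rewrite -actM mulVg act1. Qed.

Lemma secV f x : sec f^-1 x = (sec f (act f^-1 x))^-1.
Proof.
apply: (mulIg (sec f (act f^-1 x))); rewrite -secM mulVg sec1.
by rewrite mulVg.
Qed.

Lemma act_inj f : injective (act f).
Proof. exact: can_inj (actK f). Qed.

Definition St1 : set (tree_aut p) := [set f | forall x, act f x = x].

Lemma St1_subgroup : is_subgroup St1.
Proof.
split=> [x|f g f1 g1 x|f f1 x] //; first by rewrite actM f1 g1.
by rewrite -{1}(f1 x) actK.
Qed.

Lemma St1J f g : St1 f -> St1 (f ^ g).
Proof. by move=> f1 x; rewrite /conjg !actM f1 actVK. Qed.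

Lemma sec_St1M f g x : St1 f -> sec (f * g) x = sec f x * sec g x.
Proof. by move=> f1; rewrite secM f1. Qed.

Lemma sec_St1V f x : St1 f -> sec f^-1 x = (sec f x)^-1.
Proof. by move=> f1; rewrite secV (subgV St1_subgroup f1). Qed.

Lemma sec_St1J f g x : St1 f -> sec (f ^ g) (act g x) = sec f x ^ sec g x.
Proof. by move=> f1; rewrite /conjg !secM secV actK f1. Qed.

Lemma sec_St1JS f g x : St1 f -> St1 g -> sec (f ^ g) x = sec f x ^ sec g x.
Proof. by move=> f1 g1; rewrite -{1}(g1 x) sec_St1J. Qed.

Lemma sec_St1R f g x : St1 f -> St1 g -> sec [~ f, g] x = [~ sec f x, sec g x].
Proof.
move=> f1 g1; rewrite /commg sec_St1M; last exact: subgV St1_subgroup f1.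
by rewrite sec_St1V // sec_St1JS.
Qed.

Lemma St1X f n : St1 f -> St1 (f ^+ n).
Proof. exact: subgX St1_subgroup. Qed.

Lemma sec_St1X f n x : St1 f -> sec (f ^+ n) x = sec f x ^+ n.
Proof.
move=> f1; elim: n => [|n IH]; first by rewrite sec1.
by rewrite !expgS sec_St1M // IH.
Qed.

Definition emb x g : tree_aut p.
Proof.
pose F (g : tree_aut p) (w : word p) :=
  if w is y :: v then y :: (if y == x then g v else v) else [::].
apply: (@TreeAut p (F g) (F g^-1)).
- by case=> //= y v; congr cons; case: eqP => // _; exact: aut_funK.
- by case=> //= y v; congr cons; case: eqP => // _; exact: aut_invK.
- by [].
- move=> [|y u] [|z v] //=; rewrite ?adjacent_nil //=.
  + by rewrite !eqSS !size_eq0; case: (z == x); rewrite ?tree_aut_eq_nil.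
  + rewrite !(adjacentC _ [::]) !adjacent_nil /= !eqSS !size_eq0.
    by case: (y == x); rewrite ?tree_aut_eq_nil.
  + rewrite !adjacent_cons; case: (eqVneq y z) => //= <-.
    by case: (y == x); rewrite ?aut_adj.
Defined.

Lemma act_emb x g y : act (emb x g) y = y.
Proof. by []. Qed.
Lemma emb_St1 x g : St1 (emb x g). Proof. exact: act_emb. Qed.
Lemma sec_emb x g y : sec (emb x g) y = if y == x then g else 1.
Proof. by apply: tree_autP => v /=; case: eqP. Qed.
Lemma sec_emb_same x g : sec (emb x g) x = g.
Proof. by rewrite sec_emb eqxx. Qed.

Arguments emb : simpl never.

Lemma emb_eq x g f : St1 f -> sec f x = g -> (forall y, y != x -> sec f y = 1) ->
  f = emb x g.
Proof.
move=> f1 fx fy; apply: aut_ext => y; first by rewrite f1.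
by rewrite sec_emb; case: (eqVneq y x) => [->|/fy].
Qed.

Lemma embM x g h : emb x (g * h) = emb x g * emb x h.
Proof.
apply: aut_ext => y; first by rewrite actM !act_emb.
by rewrite sec_St1M ?sec_emb; [case: eqP; rewrite ?mulg1 | exact: emb_St1].
Qed.
Lemma emb1 x : emb x 1 = 1.
Proof. by apply: aut_ext => y; rewrite ?act_emb // sec_emb sec1; case: eqP. Qed.
Lemma embV x g : emb x g^-1 = (emb x g)^-1.
Proof. by apply/eqP; rewrite -mulg_eq1 -embM mulVg emb1. Qed.
Lemma emb_inj x : injective (emb x).
Proof. by move=> g h /(congr1 (sec^~ x)); rewrite !sec_emb_same. Qed.

Lemma embJ x g h : emb x g ^ h = emb (act h x) (g ^ sec h x).
Proof.
apply: emb_eq; first exact/St1J/emb_St1.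
  by rewrite sec_St1J ?sec_emb_same //; exact: emb_St1.
move=> y; rewrite -(actVK h y) (inj_eq (@act_inj h)) => /negPf yx.
by rewrite sec_St1J ?sec_emb ?yx ?conj1g //; exact: emb_St1.
Qed.

Lemma emb_prod H f : is_subgroup H -> St1 f ->
  (forall x, H (emb x (sec f x))) -> H f.
Proof.
move=> sH f1 Hf.
(* Partial products of the [emb x (sec f x)] over a list of letters; the list of all letters gives
   [f]. *)
suff: forall s : seq 'I_p, exists2 g, H g & [/\ St1 g,
    forall x, x \in s -> sec g x = sec f x & forall x, x \notin s -> sec g x = 1].
  move=> /(_ (enum 'I_p))[g Hg [g1 gf _]].
  suff -> : f = g by [].
  by apply: aut_ext => x; rewrite ?f1 ?g1 // gf // mem_enum.
elim=> [|x s [g Hg [g1 gf gs]]].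
  exists 1; first exact: subg1.
  by split=> // x; rewrite sec1.
have [xs|xs] := boolP (x \in s).
  exists g => //; split=> // y; rewrite inE; first by case/orP=> [/eqP->|ys]; rewrite gf.
  by rewrite negb_or => /andP[_ /gs].
exists (g * emb x (sec f x)); first exact: subgM.
split=> [|y|y]; first by apply: subgM St1_subgroup g1 _; exact: emb_St1.
  rewrite inE sec_St1M // sec_emb; case: (eqVneq y x) => [->|_] /=.
    by rewrite gs // mul1g.
  by move=> /gf ->; rewrite mulg1.
rewrite inE negb_or sec_St1M // sec_emb => /andP[/negPf-> /gs ->].
by rewrite mulg1.
Qed.

(** The preimage of [X x ... x X] under [psi] in the whole automorphism group; it need not lie in
    [G]. *)
Definition prodS (X : set (tree_aut p)) : set (tree_aut p) :=
  [set f | St1 f /\ forall x, X (sec f x)].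

Lemma prodS_subgroup X : is_subgroup X -> is_subgroup (prodS X).
Proof.
move=> sX; split.
- by split=> // x; rewrite sec1; exact: subg1.
- move=> f g [f1 fX] [g1 gX]; split; first exact: subgM St1_subgroup f1 g1.
  by move=> x; rewrite sec_St1M //; exact: subgM.
- move=> f [f1 fX]; split; first exact: subgV St1_subgroup f1.
  by move=> x; rewrite sec_St1V //; exact: subgV.
Qed.

Lemma prodS_emb X x g : is_subgroup X -> X g -> prodS X (emb x g).
Proof.
move=> sX Xg; split; first exact: emb_St1.
by move=> y; rewrite sec_emb; case: eqP => // _; exact: subg1.
Qed.

Lemma prodSJ X f g : (forall k x, X k -> X (k ^ sec g x)) -> prodS X f -> prodS X (f ^ g).
Proof.
move=> XJ [f1 fX]; split; first exact: St1J.
by move=> x; rewrite -(actVK g x) sec_St1J //; exact: XJ.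
Qed.

Fixpoint secw f u : tree_aut p := if u is x :: v then secw (sec f x) v else f.
Fixpoint embw u g : tree_aut p := if u is x :: v then emb x (embw v g) else g.

Lemma aut_cat f u v : f (u ++ v) = f u ++ secw f u v.
Proof.
elim: u f => [|x u IH] f; first by rewrite aut_root.
by rewrite !cat_cons !autE IH.
Qed.

Lemma size_aut f u : size (f u) = size u.
Proof.
elim: u f => [|x u IH] f; first by rewrite aut_root.
by rewrite autE; exact: (congr1 succn (IH (sec f x))).
Qed.

Lemma embwM u g h : embw u (g * h) = embw u g * embw u h.
Proof. by elim: u => //= x u ->; rewrite embM. Qed.
Lemma embwV u g : embw u g^-1 = (embw u g)^-1.
Proof. by elim: u => //= x u ->; rewrite embV. Qed.
Lemma embw1 u : embw u 1 = 1.
Proof. by elim: u => //= x u ->; rewrite emb1. Qed.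
Lemma embwJ u g h : embw u g ^ h = embw (h u) (g ^ secw h u).
Proof.
elim: u h => [|x u IH] h /=; first by rewrite aut_root.
by rewrite embJ IH autE.
Qed.
Lemma embwR u g h : embw u [~ g, h] = [~ embw u g, embw u h].
Proof. by rewrite /commg /conjg !embwM !embwV. Qed.
Lemma embw_inj u : injective (embw u).
Proof. by elim: u => [|x u IH] g h //= /emb_inj /IH. Qed.
Lemma embw_rcons u x g : embw (rcons u x) g = embw u (emb x g).
Proof. by elim: u => //= y u ->. Qed.

Lemma emb_comm x y g h : x != y -> commute (emb x g) (emb y h).
Proof.
move=> xy; apply: aut_ext => z; rewrite ?actM ?act_emb //.
rewrite !sec_St1M ?sec_emb; try exact: emb_St1.
by case: (eqVneq z x) => [->|]; rewrite ?(negPf xy) ?mulg1 ?mul1g.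
Qed.

Lemma embw_comm u v g h : size u = size v -> u != v ->
  commute (embw u g) (embw v h).
Proof.
elim: u v => [|x u IH] [|y v] //= [sz]; rewrite eqseq_cons.
have [-> /= uv|xy _] := eqVneq x y; last exact: emb_comm.
by rewrite /commute -!embM (IH v).
Qed.

Lemma embw_disjoint u v g h : size u = size v -> u != v ->
  embw u g = embw v h -> g = 1.
Proof.
elim: u v => [|x u IH] [|y v] //= [sz]; rewrite eqseq_cons.
have [-> /= uv /emb_inj|xy _ E] := eqVneq x y; first exact: IH.
apply: (@embw_inj u); rewrite embw1 -(sec_emb_same x (embw u g)) E.
by rewrite sec_emb (negPf xy).
Qed.

End TreeAut.

(** * Words in the generators *)

Section GGSwords.
Variables (p : nat) (e : 'rV['F_p]_p.-1) (p_prime : prime p).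
Local Notation F := 'F_p.
Local Notation a := (gen_a p).
Local Notation b := (gen_b e).
Local Notation G := (GGS e).

Lemma Fp_val (i : F) : (i < p)%N.
Proof. by rewrite -[X in (_ < X)%N](Fp_cast p_prime); case: i. Qed.

Lemma Fp_natE (i : F) : (val i)%:R%R = i.
Proof. by apply: val_inj; rewrite /= (val_Fp_nat p_prime) modn_small ?Fp_val. Qed.

Lemma Fp_ordE (i : F) : (nat_of_ord i)%:R%R = i.
Proof. exact: Fp_natE. Qed.

Lemma Fp_val_nat n : val (n%:R%R : F) = (n %% p)%N.
Proof. exact: val_Fp_nat. Qed.

Lemma Fp_add (i j : F) : val (i + j)%R = ((i + j) %% p)%N.
Proof. exact: (congr1 (modn _) (Fp_cast p_prime)). Qed.

(* Indexing the letters by 'F_p makes [a] act as [+1]; [la 0] is the last letter, at which [b] has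
   section [b]. *)
Definition la (i : F) : 'I_p := cast_ord (Fp_cast p_prime) (i - 1)%R.

Lemma la_inj : injective la.
Proof. by move=> i j /cast_ord_inj /addIr. Qed.

Lemma la_surj x : exists i, x = la i.
Proof.
exists (cast_ord (esym (Fp_cast p_prime)) x + 1)%R.
by rewrite /la addrK; apply: val_inj.
Qed.

Lemma card_F : #|{: F}| = p.
Proof. by rewrite card_ord Fp_cast. Qed.

Definition pw (g : tree_aut p) (s : F) : tree_aut p := g ^+ val s.

Section Pw.
Variable g : tree_aut p.
Hypothesis gp : g ^+ p = 1.

Lemma expg_modp n : g ^+ (n %% p) = g ^+ n.
Proof. by rewrite {2}(divn_eq n p) expgnDr mulnC expgnA gp expg1n mul1g. Qed.

Lemma pwD s t : pw g (s + t)%R = pw g s * pw g t.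
Proof. by rewrite /pw Fp_add expg_modp expgnDr. Qed.

Lemma pw0 : pw g 0%R = 1. Proof. by []. Qed.

Lemma pwN s : pw g (- s)%R = (pw g s)^-1.
Proof. by apply/eqP; rewrite -mulg_eq1 -pwD addNr. Qed.

Lemma pw1 : pw g 1%R = g. Proof. by rewrite /pw /= expg1. Qed.

Lemma pw_nat n : pw g n%:R%R = g ^+ n.
Proof. by rewrite /pw /= (val_Fp_nat p_prime) expg_modp. Qed.

Lemma pwM s t : pw g (s * t)%R = pw g s ^+ val t.
Proof. by rewrite -[in LHS](Fp_natE s) -[in LHS](Fp_natE t) -natrM pw_nat expgnA. Qed.
End Pw.

Lemma sec_a x : sec a x = 1.
Proof. exact: tree_autP. Qed.

Lemma act_a i : act a (la i) = la (i + 1)%R.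
Proof.
apply: val_inj; change (((val (i - 1)%R).+1 %% p)%N = val (i + 1 - 1)%R).
by rewrite addrAC [RHS]Fp_add -addn1.
Qed.

Lemma act_aX n i : act (a ^+ n) (la i) = la (i + n%:R)%R.
Proof.
elim: n i => [|n IH] i; first by rewrite addr0.
by rewrite expgS actM act_a IH -addrA mulrS.
Qed.

Lemma sec_aX n x : sec (a ^+ n) x = 1.
Proof.
elim: n x => [|n IH] x; first by rewrite sec1.
by rewrite expgS secM sec_a IH mulg1.
Qed.

Lemma a_exp : a ^+ p = 1.
Proof.
apply: aut_ext => x; last by rewrite sec_aX sec1.
have [i ->] := la_surj x; rewrite act_aX act1.
by rewrite (pcharf0 (pchar_Fp p_prime)) addr0.
Qed.

Local Notation A := (pw a).

Lemma act_A s i : act (A s) (la i) = la (i + s)%R.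
Proof. by rewrite act_aX Fp_natE. Qed.
Lemma sec_A s x : sec (A s) x = 1. Proof. exact: sec_aX. Qed.

(* [b] has section [a ^ ee i] at [la i], except at [la 0], where the junk value is [0]. *)
Definition ee (i : F) : F :=
  if (insub (val (i - 1)%R) : option 'I_p.-1) is Some j then e ord0 j else 0%R.

Lemma val_Fp_N1 : val (- 1 : F)%R = p.-1.
Proof.
rewrite -[RHS](congr1 predn (Fp_cast p_prime)) /=.
by rewrite modn_small // subn1.
Qed.

Lemma ee0 : ee 0%R = 0%R.
Proof. by rewrite /ee insubF // sub0r val_Fp_N1 ltnn. Qed.

Lemma act_b x : act b x = x.
Proof. by rewrite /act gen_b_level1. Qed.

Lemma b_St1 : St1 b. Proof. exact: act_b. Qed.

Lemma bE x v : b (x :: v) = x :: (if (insub (x : nat) : option 'I_p.-1) is Some i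
                    then (gen_a p ^+ nat_of_ord (e ord0 i)) v else b v).
Proof. by []. Qed.

Lemma val_la0 : la 0%R = p.-1 :> nat.
Proof. by rewrite -val_Fp_N1 -[(- 1)%R]sub0r. Qed.

Lemma sec_b0 : sec b (la 0%R) = b.
Proof.
apply: tree_autP => v; have /(congr1 behead) := autE b (la 0%R) v.
by rewrite bE insubF // val_la0 ltnn.
Qed.

Lemma la_small i : i != 0%R -> (la i < p.-1)%N.
Proof.
move=> i0; have := ltn_ord (la i); rewrite -{2}(prednK (prime_gt0 p_prime)) ltnS.
rewrite leq_eqVlt -val_la0 => /orP[/eqP/val_inj/la_inj/eqP|//].
by rewrite (negPf i0).
Qed.

Lemma sec_bn i : i != 0%R -> sec b (la i) = A (ee i).
Proof.
move=> i0; apply: tree_autP => v; have /(congr1 behead) := autE b (la i) v.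
by rewrite bE /ee (insubT (fun n => n < p.-1)%N (la_small i0)).
Qed.

Lemma b_exp : b ^+ p = 1.
Proof.
apply: tree_autP; elim=> [|x v IH]; first by rewrite !aut_root.
rewrite autE (St1X p b_St1) sec_St1X; last exact: b_St1.
have [i ->] := la_surj x; have [->|i0] := eqVneq i 0%R; first by rewrite sec_b0 IH.
by rewrite sec_bn // /pw expgnAC a_exp expg1n.
Qed.

Definition B (i k : F) := pw b k ^ A i.

Lemma B_St1 i k : St1 (B i k).
Proof. exact/St1J/St1X/b_St1. Qed.

Lemma sec_B i k j :
  sec (B i k) (la j) = if i == j then pw b k else A (k * ee (j - i))%R.
Proof.
rewrite -{1}(subrK i j) -act_A sec_St1J; last exact/St1X/b_St1.
rewrite sec_A conjg1 sec_St1X; last exact: b_St1.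
rewrite eq_sym -subr_eq0; case: eqP => [->|/eqP ji]; first by rewrite sec_b0.
by rewrite sec_bn // [(k * _)%R]mulrC pwM //; exact: a_exp.
Qed.

Lemma BD i k l : B i (k + l)%R = B i k * B i l.
Proof. by rewrite /B pwD ?conjMg //; exact: b_exp. Qed.
Lemma BN i k : B i (- k)%R = (B i k)^-1.
Proof. by rewrite /B pwN ?conjVg //; exact: b_exp. Qed.
Lemma B0 i : B i 0%R = 1. Proof. exact: conj1g. Qed.
Lemma BA i k s : B i k ^ A s = B (i + s)%R k.
Proof. by rewrite /B -conjgM -pwD //; exact: a_exp. Qed.

Lemma B00 k : B 0%R k = pw b k. Proof. exact: conjg1. Qed.
Lemma BE i k : B i k = pw b k ^ A i. Proof. by []. Qed.
#[local] Opaque B.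

Lemma G_subgroup : is_subgroup G. Proof. exact: generated_subgroup. Qed.
Lemma Ga : G a. Proof. by apply: mem_generated; left. Qed.
Lemma Gb : G b. Proof. by apply: mem_generated; right. Qed.
Lemma GA s : G (A s). Proof. by apply: (subgX _ G_subgroup); exact: Ga. Qed.
Lemma GB i k : G (B i k).
Proof.
rewrite BE; apply: (subgJ G_subgroup); last exact: GA.
by apply: (subgX _ G_subgroup); exact: Gb.
Qed.

Lemma G_min (M : set (tree_aut p)) : is_subgroup M -> M a -> M b -> G `<=` M.
Proof. by move=> sM Ma Mb; apply: generated_sub => // g [->|->]. Qed.

Definition syl := (F * F)%type.
(** A word [(l, s)] stands for the product of the [B i k] listed in [l], followed by [A s]. Words
    are not reduced and no normal form is used. *)
Definition wrd := (seq syl * F)%type.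

Fixpoint evl (l : seq syl) : tree_aut p :=
  if l is (i, k) :: l' then B i k * evl l' else 1.
Definition ev (w : wrd) := evl w.1 * A w.2.

Definition shiftl (c : F) (l : seq syl) : seq syl := [seq ((ik.1 + c)%R, ik.2) | ik <- l].
(** Moving [A s] to the right past [B i k] turns the latter into [B (i - s) k], hence the shift by
    [- w.2]. *)
Definition wmul (w w' : wrd) : wrd := (w.1 ++ shiftl (- w.2)%R w'.1, (w.2 + w'.2)%R).
Definition winv (w : wrd) : wrd :=
  (shiftl w.2 (rev [seq (ik.1, (- ik.2)%R) | ik <- w.1]), (- w.2)%R).

Lemma evl_cat l l' : evl (l ++ l') = evl l * evl l'.
Proof. by elim: l => [|[i k] l IH] /=; rewrite ?mul1g // IH mulgA. Qed.

Lemma evl_shift c l : evl (shiftl c l) = evl l ^ A c.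
Proof. by elim: l => [|[i k] l IH] /=; rewrite ?conj1g // IH conjMg BA. Qed.

Lemma evl_inv l : evl (rev [seq (ik.1, (- ik.2)%R) | ik <- l]) = (evl l)^-1.
Proof.
elim: l => [|[i k] l IH]; first by rewrite invg1.
by rewrite map_cons rev_cons -cats1 evl_cat IH /= mulg1 BN [RHS]invgM.
Qed.

Lemma evl_St1 l : St1 (evl l).
Proof.
elim: l => [|[i k] l IH]; first exact: subg1 (St1_subgroup p).
by apply: (subgM (St1_subgroup p)) => //; exact: B_St1.
Qed.

Lemma ev_a s : ev ([::], s) = A s. Proof. exact: mul1g. Qed.

Lemma ev_mul w w' : ev (wmul w w') = ev w * ev w'.
Proof.
rewrite /ev /= evl_cat evl_shift pwD ?pwN; try exact: a_exp.
by grpnorm.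
Qed.

Lemma ev_inv w : ev (winv w) = (ev w)^-1.
Proof.
rewrite /ev /= evl_shift evl_inv pwN; last exact: a_exp.
by grpnorm.
Qed.

Lemma act_ev w j : act (ev w) (la j) = la (j + w.2)%R.
Proof. by rewrite actM evl_St1 act_A. Qed.

Definition len (w : wrd) := size w.1.
Definition nu (w : wrd) (j : F) : F := (\sum_(ik <- w.1 | ik.1 == j) ik.2)%R.
Definition cn (w : wrd) (j : F) : nat := count (fun ik : syl => ik.1 == j) w.1.
Definition tot (w : wrd) : F := (\sum_(ik <- w.1) ik.2)%R.

Lemma nu_mul w w' j : nu (wmul w w') j = (nu w j + nu w' (j + w.2))%R.
Proof.
rewrite /nu big_cat big_map /=; congr (_ + _)%R; apply: eq_bigl => ik.
by rewrite subr_eq.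
Qed.
Lemma cn_mul w w' j : cn (wmul w w') j = (cn w j + cn w' (j + w.2)%R)%N.
Proof.
rewrite /cn count_cat count_map; congr (_ + _)%N; apply: eq_count => ik /=.
by rewrite subr_eq.
Qed.
Lemma tot_mul w w' : tot (wmul w w') = (tot w + tot w')%R.
Proof. by rewrite /tot big_cat big_map. Qed.
Lemma len_mul w w' : len (wmul w w') = (len w + len w')%N.
Proof. by rewrite /len size_cat size_map. Qed.
Lemma tot_inv w : tot (winv w) = (- tot w)%R.
Proof. by rewrite /tot big_map big_rev big_map sumrN. Qed.
Lemma len_inv w : len (winv w) = len w.
Proof. by rewrite /len size_map size_rev size_map. Qed.

Lemma tot_nu w : tot w = (\sum_j nu w j)%R.
Proof.
rewrite /tot /nu (exchange_big_dep xpredT) //=; apply: eq_bigr => ik _.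
by rewrite (big_pred1 ik.1) // => j; rewrite /= eq_sym.
Qed.
Lemma len_cn w : len w = (\sum_j cn w j)%N.
Proof.
rewrite /len /cn; elim: w.1 => [|ik l IH]; first by rewrite /= big1.
rewrite [size _]/= IH -add1n.
under [RHS]eq_bigr => j _ do rewrite /=.
rewrite big_split /=; congr (_ + _)%N.
by rewrite (bigD1 ik.1) //= eqxx big1 // => j; rewrite eq_sym => /negPf->.
Qed.

(** At [j] the syllable [B i k] contributes [b^k] if [i = j], and otherwise a power of [a], which
    [wmul] moves to the right end. Only syllables at [j] survive, the source of every length
    reduction. *)
Fixpoint secl (l : seq syl) (j : F) : wrd :=
  if l is (i, k) :: l' then
    if i == j then ((0%R, k) :: (secl l' j).1, (secl l' j).2)
    else wmul ([::], (k * ee (j - i))%R) (secl l' j)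
  else ([::], 0%R).
Definition wsec (w : wrd) j := secl w.1 j.

Lemma ev_wsec w j : ev (wsec w j) = sec (ev w) (la j).
Proof.
rewrite /ev sec_St1M ?sec_A ?mulg1; last exact: evl_St1.
rewrite /wsec; elim: w.1 => [|[i k] l IH]; first by rewrite /= sec1 /ev mulg1.
rewrite [evl (_ :: _)]/= sec_St1M; last exact: B_St1.
rewrite sec_B -IH /=; case: eqP => // _; last by rewrite -/(ev _) ev_mul ev_a.
by rewrite /ev /= mulgA B00.
Qed.

Lemma wsec_s w j : (wsec w j).2 = (\sum_i nu w i * ee (j - i))%R.
Proof.
have -> : (\sum_i nu w i * ee (j - i))%R = (\sum_(ik <- w.1) ik.2 * ee (j - ik.1))%R.
  under eq_bigr => i _ do rewrite /nu big_distrl /=.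
  rewrite (exchange_big_dep xpredT) //=; apply: eq_bigr => ik _.
  by rewrite (big_pred1 ik.1) // => i; rewrite /= eq_sym.
rewrite /wsec; elim: w.1 => [|[i k] l IH]; first by rewrite big_nil.
rewrite big_cons /=; case: eqP => [->|_] /=; last by rewrite IH.
(* For [i = j] the syllable adds nothing to the exponent of [a]; the convention [ee 0 = 0] accounts
   for it. *)
by rewrite subrr ee0 mulr0 add0r.
Qed.

Lemma tot_wsec w j : tot (wsec w j) = nu w j.
Proof.
rewrite /wsec /nu; elim: w.1 => [|[i k] l IH]; first by rewrite /tot !big_nil.
rewrite big_cons /=; case: eqP => _ /=; first by rewrite /tot big_cons -IH.
by rewrite tot_mul IH /tot big_nil add0r.
Qed.

Lemma len_wsec w j : len (wsec w j) = cn w j.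
Proof.
rewrite /wsec /cn; elim: w.1 => [|[i k] l IH] //=; case: eqP => _ /=; first by rewrite -IH.
by rewrite len_mul IH.
Qed.

(** The exceptional case of length reduction: the section at [j] has length [cn w j], less than
    [len w] unless all syllables sit at [j]. *)
Lemma concentrated w j : (len w <= cn w j)%N -> evl w.1 = B j (tot w).
Proof.
rewrite /len /cn /tot; elim: w.1 => [|[i k] l IH] /=; first by rewrite big_nil B0.
rewrite big_cons BD /=; case: eqP => [->|_] /=.
  by rewrite add1n ltnS => /IH ->.
by rewrite add0n => h; have := leq_trans h (count_size _ _); rewrite ltnn.
Qed.

Lemma G_ev w : G (ev w).
Proof.
apply: (subgM G_subgroup); last exact: GA.
elim: w.1 => [|[i k] l IH]; first exact: subg1 G_subgroup.
by apply: (subgM G_subgroup) => //; exact: GB.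
Qed.

Lemma ev_B i k : ev ([:: (i, k)], 0%R) = B i k.
Proof. by rewrite /ev /= !mulg1. Qed.

Lemma G_word g : G g -> exists w, g = ev w.
Proof.
move=> /(@G_min [set g | exists w, g = ev w]); apply.
- split=> [|_ _ [w ->] [w' ->]|_ [w ->]].
  + by exists ([::], 0%R); rewrite ev_a.
  + by exists (wmul w w'); rewrite ev_mul.
  + by exists (winv w); rewrite ev_inv.
- by exists ([::], 1%R); rewrite ev_a pw1.
- by exists ([:: (0%R, 1%R)], 0%R); rewrite ev_B B00 pw1.
Qed.

Lemma G_sec g x : G g -> G (sec g x).
Proof.
have [j ->] := la_surj x; move=> /G_word [w ->].
by rewrite -ev_wsec; exact: G_ev.
Qed.

Lemma G_act g : G g -> exists s, forall j, act g (la j) = la (j + s)%R.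
Proof. by move=> /G_word[w ->]; exists w.2 => j; exact: act_ev. Qed.

End GGSwords.
#[global] Opaque B.

(** * Difference operators on the cyclic group of order p *)

Section CyclicDifferences.
Local Open Scope ring_scope.
Variables (p : nat) (p_prime : prime p).
Local Notation F := 'F_p.

Definition dif (f : F -> F) (j : F) : F := f (j + 1) - f j.

Lemma dif_iter_poly n (f : F -> F) j : (n <= p)%N ->
  iter n dif f j = \sum_(i < p.+1) (('X - 1) ^+ n : {poly F})`_i * f (j + i%:R).
Proof.
elim: n j => [|n IH] j np.
  rewrite expr0 big_ord_recl coef1 /= mul1r addr0 big1 ?addr0 // => i _.
  by rewrite coef1 mul0r.
rewrite iterS /dif -!/dif !IH 1?ltnW // exprSr.
set q := ('X - 1) ^+ n; have qp : q`_p = 0.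
  by rewrite nth_default // /q -polyC1 size_exp_XsubC.
rewrite [X in X - _]big_ord_recr /= qp mul0r addr0.
under [X in _ = X]eq_bigr => i _ do rewrite mulrBr mulr1 coefB coefMX mulrBl.
rewrite sumrB [X in _ = X - _]big_ord_recl /= mul0r add0r; congr (_ - _).
by apply: eq_bigr => i _; rewrite /bump /= add1n mulrS addrA.
Qed.

(** [dif] is the action of [X - 1] when [X] acts as translation by [1]. By Frobenius
    [(X - 1)^p = X^p - 1], and translation by [p] is the identity. *)
Lemma dif_iter_p (f : F -> F) j : iter p dif f j = 0.
Proof.
rewrite dif_iter_poly //.
have pP : p \in [pchar {poly F}] by rewrite pchar_poly; exact: pchar_Fp.
have := pFrobenius_autB_comm pP (commr1 'X).
rewrite !pFrobenius_autE expr1n => ->.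
have p0 := prime_gt0 p_prime.
rewrite big_ord_recr /= (bigD1 (Ordinal p0)) //= big1 ?addr0 => [|i i0].
  rewrite !coefB !coef1 !coefXn eqxx (gtn_eqF p0) (ltn_eqF p0).
  by rewrite sub0r subr0 mulN1r mul1r (pcharf0 (pchar_Fp p_prime)) addr0 addNr.
have {}i0 : nat_of_ord i != 0%N by [].
by rewrite coefB coefXn coef1 (negPf i0) (ltn_eqF (ltn_ord i)) subrr mul0r.
Qed.

(* The group algebra of the cyclic group of order p over F_p is local, so that an
   element with nonzero augmentation is invertible. *)
Lemma convolution_unit (nu g : F -> F) : \sum_i nu i != 0 ->
  (forall j, \sum_i nu i * g (j - i) = 0) -> forall j, g j = 0.
Proof.
move=> nu0 conv.
have dconv n j : \sum_i nu i * iter n dif g (j - i) = 0.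
  elim: n j => [|n IH] j; first exact: conv.
  under eq_bigr => i _ do rewrite iterS /dif mulrBr addrAC.
  by rewrite sumrB !IH subrr.
(* Once the differences of order [k + 1] vanish, those of order [k] are constant, and convolving a
   constant with [nu] multiplies it by the nonzero sum of [nu]. *)
suff H n : (n <= p)%N -> forall j, iter (p - n) dif g j = 0.
  by move=> j; have := H p (leqnn p) j; rewrite subnn.
elim: n => [|n IH] np j; first by rewrite subn0 dif_iter_p.
have c i : iter (p - n.+1) dif g (i + 1) = iter (p - n.+1) dif g i.
  by apply/eqP; rewrite -subr_eq0; have := IH (ltnW np) i; rewrite -(subnSK np) iterS /dif => ->.
have c0 i : iter (p - n.+1) dif g i = iter (p - n.+1) dif g 0.
  rewrite -[in LHS](Fp_natE p_prime i); elim: (val i) => // m {}IH.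
  by rewrite mulrS addrC c.
have := dconv (p - n.+1)%N j; under eq_bigr => i _ do rewrite c0.
by rewrite -mulr_suml => /eqP; rewrite mulf_eq0 (negPf nu0) c0 => /eqP.
Qed.

End CyclicDifferences.

(** * Section groups and conjugates of a subgroup *)

Section SectionGroups.
Variable p : nat.
Implicit Types (M : set (tree_aut p)) (x y : 'I_p) (f g h : tree_aut p).

Lemma act_fixJ f g x : act f x = x -> act (f ^ g) (act g x) = act g x.
Proof. by move=> fx; rewrite /conjg !actM actK fx. Qed.

Lemma sec_fixJ f g x : act f x = x -> sec (f ^ g) (act g x) = sec f x ^ sec g x.
Proof. by move=> fx; rewrite /conjg !secM secV actK fx. Qed.

Definition secgrp M x : set (tree_aut p) :=
  [set h | exists g, [/\ M g, act g x = x & sec g x = h]].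

Lemma secgrp_subgroup M x : is_subgroup M -> is_subgroup (secgrp M x).
Proof.
move=> sM; split.
- by exists 1; split; [exact: subg1 | | exact: sec1].
- move=> _ _ [g [Mg gx <-]] [h [Mh hx <-]]; exists (g * h).
  by split; [exact: subgM | rewrite actM gx hx | rewrite secM gx].
- move=> _ [g [Mg gx <-]]; exists g^-1.
  have gx' : act g^-1 x = x by rewrite -{1}gx actK.
  by split; [exact: subgV | | rewrite secV gx'].
Qed.

Definition conjs M g : set (tree_aut p) := [set x | M (x ^ g^-1)].

Lemma conjs_subgroup M g : is_subgroup M -> is_subgroup (conjs M g).
Proof.
move=> sM; rewrite /conjs; split=> [|x y /= Mx My|x /= Mx] /=.
- by rewrite conj1g; exact: subg1.
- by rewrite conjMg; exact: subgM.
- by rewrite conjVg; exact: subgV.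
Qed.

Lemma conjsJ M f g : M f -> conjs M g (f ^ g).
Proof. by rewrite /conjs /= conjgK. Qed.
End SectionGroups.

Lemma least_nat (Q : nat -> Prop) n : Q n -> exists2 m, Q m & forall k, Q k -> (m <= k)%N.
Proof.
elim/ltn_ind: n => n IH Qn.
have [[m Qm mn]|h] := pselect (exists2 m, Q m & (m < n)%N); first exact: IH Qm.
by exists n => // k Qk; rewrite leqNgt; apply/negP => kn; apply: h; exists k.
Qed.

(** * Powers of words and their sections *)

Section Words.
Variables (p : nat) (e : 'rV['F_p]_p.-1) (p_prime : prime p).
Local Notation F := 'F_p.
Local Notation wrd := (wrd p).
Local Notation ee := (ee e).
Implicit Types (u v w x y z g : wrd).

Lemma shiftl0 l : shiftl (p := p) 0%R l = l.
Proof. by apply: map_id_in => -[i k] _; rewrite /= addr0. Qed.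
Lemma shiftl_shiftl c d l : shiftl (p := p) c (shiftl d l) = shiftl (d + c)%R l.
Proof. by rewrite /shiftl -map_comp; apply: eq_map => ik /=; rewrite addrA. Qed.

Lemma shiftl_cat c l l' : shiftl (p := p) c (l ++ l') = shiftl c l ++ shiftl c l'.
Proof. exact: map_cat. Qed.

(** An identity of words, not just of their values: [no_odometer] regroups products and then
    measures lengths. *)
Lemma wmulA x y z : wmul x (wmul y z) = wmul (wmul x y) z.
Proof.
by rewrite /wmul /= shiftl_cat shiftl_shiftl catA opprD addrA [(- x.2 + _)%R]addrC.
Qed.

Definition wone : wrd := ([::], 0%R).
Lemma wmul1 x : wmul x wone = x.
Proof. by case: x => l s; rewrite /wmul /= cats0 addr0. Qed.
Lemma wmul1w x : wmul wone x = x.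
Proof. by case: x => l s; rewrite /wmul /= oppr0 add0r shiftl0. Qed.

Fixpoint wexp w n : wrd := if n is n'.+1 then wmul w (wexp w n') else wone.

Lemma wexpD w m n : wexp w (m + n) = wmul (wexp w m) (wexp w n).
Proof. by elim: m => [|m IH] /=; rewrite ?wmul1w // IH wmulA. Qed.

Lemma ev_wexp w n : ev e (wexp w n) = ev e w ^+ n.
Proof. by elim: n => [|n IH] /=; rewrite ?ev_a // ev_mul // IH expgS. Qed.

Lemma wexp2 w n : (wexp w n).2 = (w.2 *+ n)%R.
Proof. by elim: n => [|n IH] //=; rewrite IH mulrS. Qed.
Lemma nu_wexp w n j : nu (wexp w n) j = (\sum_(r < n) nu w (j + w.2 *+ r))%R.
Proof.
elim: n j => [|n IH] j /=; first by rewrite big_ord0 /nu big_nil.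
rewrite nu_mul IH big_ord_recl addr0; congr (_ + _)%R; apply: eq_bigr => r _.
by rewrite /= /bump /= add1n mulrS addrA.
Qed.
Lemma cn_wexp w n j : cn (wexp w n) j = (\sum_(r < n) cn w (j + w.2 *+ r)%R)%N.
Proof.
elim: n j => [|n IH] j /=; first by rewrite big_ord0.
rewrite cn_mul IH big_ord_recl addr0; congr (_ + _)%N; apply: eq_bigr => r _.
by rewrite /= /bump /= add1n mulrS addrA.
Qed.
Lemma tot_wexp w n : tot (wexp w n) = (tot w *+ n)%R.
Proof.
elim: n => [|n IH] /=; first by rewrite /tot big_nil.
by rewrite tot_mul IH mulrS.
Qed.

Lemma big_orbit (R : Type) (idx : R) (op : Monoid.com_law idx) (f : F -> R) (j s : F) :
  s != 0%R -> \big[op/idx]_(r < p) f (j + s *+ r)%R = \big[op/idx]_i f i.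
Proof.
move=> s0.
pose h (r : 'I_p) : F := (j + s *+ r)%R.
pose h' (i : F) : 'I_p := Ordinal (Fp_val p_prime ((i - j) / s)%R).
have hK : cancel h' h.
  move=> i; rewrite (_ : h (h' i) = (j + s *+ nat_of_ord ((i - j) / s))%R) //.
  by rewrite -mulr_natr (Fp_ordE p_prime) mulrC divfK // addrC subrK.
have h'K : cancel h h'.
  move=> r; apply: val_inj; rewrite (_ : val (h' (h r)) = val ((h r - j) / s)%R) //.
  have -> : ((h r - j) / s = (r : nat)%:R)%R.
    by rewrite /h addrC addKr -[(s *+ r)%R]mulr_natr [LHS]mulrC mulKf.
  by apply: (etrans (val_Fp_nat p_prime _)); rewrite modn_small.
by rewrite [RHS](reindex h) //; exists h' => i _; [exact: h'K | exact: hK].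
Qed.

Lemma secl_cat l l' j : secl e (l ++ l') j = wmul (secl e l j) (secl e l' j).
Proof.
elim: l => [|[i k] l IH] /=; first by rewrite wmul1w.
by rewrite IH; case: eqP => _; rewrite ?wmulA.
Qed.
Lemma secl_shift c l j : secl e (shiftl c l) j = secl e l (j - c)%R.
Proof.
elim: l => [|[i k] l IH] //=; rewrite IH.
have -> : (i + c == j)%R = (i == j - c)%R by rewrite [RHS]eq_sym subr_eq eq_sym.
by have -> : (j - (i + c) = j - c - i)%R by rewrite opprD addrA addrAC.
Qed.
Lemma wsec_mul w w' j : wsec e (wmul w w') j = wmul (wsec e w j) (wsec e w' (j + w.2)%R).
Proof. by rewrite /wsec /= secl_cat secl_shift opprK. Qed.

Definition sigma : F := (\sum_i ee i)%R.

Lemma sum_ee j : (\sum_i ee (j - i) = sigma)%R.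
Proof.
rewrite /sigma [RHS](reindex (fun i => j - i)%R) //.
by exists (fun i => j - i)%R => i _; rewrite opprB addrC subrK.
Qed.

Section Power.
Variables (w : wrd) (j : F).
Hypothesis w2 : w.2 != 0%R.
(** The [p] factors of [w^p] are shifted by the multiples of [w.2 != 0], so each syllable of [w]
    comes to stand at [j] exactly once. *)
Lemma len_pow : len (wsec e (wexp w p) j) = len w.
Proof. by rewrite len_wsec cn_wexp (big_orbit _ _ j w2) -len_cn. Qed.
Lemma nu_pow i : nu (wexp w p) i = tot w.
Proof. by rewrite nu_wexp (big_orbit _ _ i w2) -tot_nu. Qed.
Lemma tot_pow : tot (wsec e (wexp w p) j) = tot w.
Proof. by rewrite tot_wsec nu_pow. Qed.
Lemma s_pow : (wsec e (wexp w p) j).2 = (sigma * tot w)%R.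
Proof.
rewrite wsec_s //; under eq_bigr => i _ do rewrite nu_pow.
by rewrite -mulr_sumr sum_ee mulrC.
Qed.
End Power.

(** A linear form on the pairs of exponent sums whose kernel is spanned by the pair of [a^sigma b].
    By [s_pow] and [tot_pow] it vanishes on the sections of [w^p] when [w.2 != 0]. *)
Definition wt w : F := (w.2 - sigma * tot w)%R.
Lemma wt_mul w w' : wt (wmul w w') = (wt w + wt w')%R.
Proof. by rewrite /wt tot_mul /= mulrDr opprD addrACA. Qed.
Lemma wt_inv w : wt (winv w) = (- wt w)%R.
Proof. by rewrite /wt tot_inv /= mulrN opprB opprK addrC. Qed.
Lemma wt_exp w n : wt (wexp w n) = (wt w *+ n)%R.
Proof.
elim: n => [|n IH]; first by rewrite /wt /= /tot big_nil mulr0 subrr.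
by rewrite /= wt_mul IH mulrS.
Qed.

(** The weights of the sections are the convolution of [nu z] with [ee - sigma delta_0]. This
    function is nonzero at [0], so by [convolution_unit] some weight is nonzero; its values sum to
    [0], so the weights do too, and a single one cannot be nonzero. Two letters are wanted because
    two sections of a non-empty word cannot both keep its full length. *)
Lemma two_good z : sigma != 0%R -> z.2 = 0%R -> wt z != 0%R ->
  exists j1 j2, [/\ j1 != j2, wt (wsec e z j1) != 0%R & wt (wsec e z j2) != 0%R].
Proof.
move=> sig0 z2 wz.
have tz : tot z != 0%R.
  by move: wz; rewrite /wt z2 sub0r oppr_eq0 mulf_eq0 (negPf sig0).
have wtE j : wt (wsec e z j) = (\sum_i nu z i * (ee (j - i) - sigma * (j - i == 0)%:R))%R.
  rewrite /wt wsec_s // tot_wsec; under [RHS]eq_bigr => i _ do rewrite mulrBr.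
  rewrite sumrB; congr (_ - _)%R.
  rewrite (bigD1 j) //= subrr eqxx mulr1 mulrC big1 ?addr0 // => i ij.
  by rewrite subr_eq0 eq_sym (negPf ij) !mulr0.
have [j1 wj1] : exists j1, wt (wsec e z j1) != 0%R.
  apply/existsP; rewrite -negb_forall; apply/negP => /forallP h.
  pose g (i : F) : F := (ee i - sigma * (i == 0)%:R)%R.
  rewrite tot_nu in tz.
  have := convolution_unit p_prime (g := g) tz.
  move=> H; have /H /(_ 0%R) /eqP: forall j, (\sum_i nu z i * g (j - i) = 0)%R.
    by move=> j; rewrite -wtE; exact/eqP.
  by rewrite /g ee0 //= mulr1 sub0r oppr_eq0 (negPf sig0).
suff [j2 j21 wj2] : exists2 j2, j2 != j1 & wt (wsec e z j2) != 0%R.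
  by exists j1, j2; rewrite eq_sym j21.
apply: contrapT => h.
have : (\sum_j wt (wsec e z j) = 0)%R.
  under eq_bigr => j _ do rewrite /wt wsec_s // tot_wsec.
  rewrite sumrB exchange_big /= -mulr_sumr -tot_nu tot_nu mulr_sumr -sumrB big1 // => i _.
  rewrite -mulr_sumr (_ : (\sum_j ee (j - i) = sigma)%R) 1?mulrC ?subrr //.
  rewrite /sigma [RHS](reindex (fun k => k - i)%R) //.
  by exists (fun k => k + i)%R => k _; rewrite ?addrK ?subrK.
rewrite (bigD1 j1) //= big1 => [|j2 j21]; last first.
  by apply/eqP; apply: contrapT => /negP wj2; apply: h; exists j2.
by rewrite addr0 => /eqP; rewrite (negPf wj1).
Qed.

End Words.

(** * Length reduction in families of subgroups closed under sections *)

Section LengthReduction.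
Variables (p : nat) (e : 'rV['F_p]_p.-1) (p_prime : prime p) (p_odd : odd p).
Local Notation F := 'F_p.
Local Notation wrd := (wrd p).
Local Notation a := (gen_a p).
Local Notation b := (gen_b e).
Local Notation A := (pw a).
Local Notation B := (B e).
Local Notation G := (GGS e).
Local Notation ee := (ee e).
Local Notation ev := (ev e).
Local Notation la := (la p_prime).
Local Notation wsec := (wsec e).
Local Notation wt := (wt e).
Local Notation sigma := (sigma e).
Hypothesis ee_neq0 : exists i, ee i != 0%R.

(** To be instantiated by the prodense subgroups that do not contain [G]. *)
Variable P : set (tree_aut p) -> Prop.
Hypothesis P_subgroup : forall M, P M -> is_subgroup M.
Hypothesis P_secgrp : forall M x, P M -> P (secgrp M x).
Hypothesis P_conjs : forall M g, P M -> G g -> P (conjs M g).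
Hypothesis P_full : forall M (s n : F), P M ->
  exists w, [/\ M (ev w), w.2 = s & tot w = n].
Hypothesis P_gen : forall M, P M -> M a -> M b -> False.

Lemma pw_gen (g : tree_aut p) (s : F) M : g ^+ p = 1 -> is_subgroup M -> s != 0%R ->
  M (pw g s) -> M g.
Proof.
move=> gp sM s0 Mg; have -> : g = pw g s ^+ val (s^-1)%R.
  by rewrite -pwM // divff // pw1.
exact: subgX.
Qed.

Lemma pwJ (g h : tree_aut p) (s : F) : pw g s ^ h = pw (g ^ h) s.
Proof. exact: conjXg. Qed.

Lemma two_neq0 : (2%:R : F)%R != 0%R.
Proof.
apply/eqP => /(congr1 val); rewrite (Fp_val_nat p_prime).
by rewrite modn_small // odd_prime_gt2.
Qed.

Lemma sec_evl_commute l : (forall ik, ik \in l -> ik.1 != 0%R -> ee (- ik.1)%R = 0%R) ->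
  commute b (sec (evl e l) (la 0%R)).
Proof.
elim: l => [|[i k] l IH] H; first by rewrite sec1; exact: commute1.
rewrite [evl _ _]/= sec_St1M; last exact: B_St1.
apply: commuteM; last first.
  by apply: IH => ik ikl; apply: H; rewrite inE ikl orbT.
rewrite sec_B; have [_|i0] := eqVneq i 0%R; first exact: commuteX.
by rewrite sub0r (H (i, k)) ?mem_head // mulr0; exact: commute1.
Qed.

(** The sections of [b ^ w] at [la 0] and at [la j] with [ee j != 0] yield conjugates of [b] and of
    [a]. Conjugating the latter back to [a] reproduces the situation with conjugator [w_0 w_j^-1] of
    length [cn w 0 + cn w j], which is shorter unless all syllables lie at [0] or [j]. *)
Lemma no_a_conj_b n M w : P M -> M a -> M (b ^ ev w) -> (len w <= n)%N -> False.
Proof.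
elim/ltn_ind: n M w => n IH M [l s] PM Ma Mb ln.
have sM := P_subgroup PM.
have {}Mb : M (b ^ evl e l).
  have -> : b ^ evl e l = (b ^ ev (l, s)) ^ A (- s)%R.
    by rewrite -conjgM /ev pwN ?mulgK //; exact: a_exp.
  by apply: subgJ => //; exact: subgX.
pose w : wrd := (l, 0%R).
have evw : ev w = evl e l by rewrite /ev mulg1.
pose M' := secgrp M (la 0%R).
have sM' : is_subgroup M' := secgrp_subgroup _ sM.
have M'sec g j : M g -> St1 g -> M' (sec g (la j)).
  move=> Mg g1; exists (g ^ A (- j)%R); have E : la 0%R = act (A (- j)%R) (la j).
    by rewrite act_A addrN.
  split; first by apply: subgJ => //; exact: subgX.
    exact: St1J.
  by rewrite E sec_St1J // sec_A conjg1.
have bl1 : St1 (b ^ evl e l) by apply: St1J; exact: b_St1.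
have M'0 : M' (b ^ ev (wsec w 0%R)).
  have := M'sec _ 0%R Mb bl1; rewrite sec_St1JS; [|exact: b_St1|exact: evl_St1].
  by rewrite (sec_b0 e p_prime) -evw ev_wsec.
have M'j j : ee j != 0%R -> M' (a ^ ev (wsec w j)).
  move=> ej; have j0 : j != 0%R by apply: contraNneq ej => ->; rewrite ee0.
  have := M'sec _ j Mb bl1; rewrite sec_St1JS; [|exact: b_St1|exact: evl_St1].
  rewrite sec_bn // -evw -(ev_wsec e p_prime) pwJ; apply: pw_gen => //.
  by rewrite -conjXg a_exp // conj1g.
pose M'' j := conjs M' (ev (wsec w j))^-1.
have PM'' j : P (M'' j).
  apply: P_conjs; first exact: P_secgrp.
  by apply: subgV (G_subgroup e) _; exact: G_ev.
have M''a j : ee j != 0%R -> M'' j a.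
  by move=> ej; rewrite /M'' -[a](conjgK (ev (wsec w j))); apply: conjsJ; exact: M'j.
have step j : ee j != 0%R -> (len w <= cn w 0%R + cn w j)%N.
  move=> ej; rewrite leqNgt; apply/negP => lt.
  have lt' : (cn w 0%R + cn w j < n)%N := leq_trans lt ln.
  apply: (IH _ lt' (M'' j) (wmul (wsec w 0%R) (winv (wsec w j)))) => //; first exact: M''a.
    by rewrite (ev_mul e p_prime) (ev_inv e p_prime) conjgM; apply: conjsJ.
  by rewrite len_mul len_inv !len_wsec.
have lenw := len_cn w.
have [d ed] := ee_neq0; have d0 : d != 0%R by apply: contraNneq ed => ->; rewrite ee0.
(* Two such letters force all syllables to [0], and [ev w] is a power of [b]. If [d] is the only
   one, then [ee (- d) = 0] as [p] is odd, no syllable lies at [- d], and [w_0] commutes with [b];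
   the conjugator [w_d^-1] is left. *)
have [[d' dd' ed']|uniq] := pselect (exists2 d', d' != d & ee d' != 0%R).
  have d'0 : d' != 0%R by apply: contraNneq ed' => ->; rewrite ee0.
  have cc : (cn w 0%R + cn w d + cn w d' <= len w)%N.
    rewrite lenw (bigD1 0%R) //= (bigD1 d) //= (bigD1 d') ?d'0 //= !addnA.
    exact: leq_addr.
  have c0 : (len w <= cn w 0%R)%N by have := step d ed; have := step d' ed'; lia.
  have := Mb; rewrite -evw /ev (concentrated e p_prime c0) mulg1 B00.
  rewrite (_ : b ^ pw b _ = b); first exact: P_gen.
  by apply/conjg_fixP; rewrite commgXg.
have edN : ee (- d)%R = 0%R.
  apply: contrapT => h; apply: uniq; exists (- d)%R; last exact/eqP.
  by rewrite eq_sym -subr_eq0 opprK -mulr2n -mulr_natr mulf_neq0 // two_neq0.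
have cNd : cn w (- d)%R = 0%N.
  have : (cn w 0%R + cn w d + cn w (- d)%R <= len w)%N.
    rewrite lenw (bigD1 0%R) //= (bigD1 d) //= (bigD1 (- d)%R) /= ?oppr_eq0 ?d0 //=.
      by rewrite !addnA; exact: leq_addr.
    by rewrite eq_sym -subr_eq0 opprK -mulr2n -mulr_natr mulf_neq0 // two_neq0.
  by have := step d ed; lia.
have b0 : b ^ ev (wsec w 0%R) = b.
  rewrite (ev_wsec e p_prime) evw; apply/conjg_fixP/commgP; apply: sec_evl_commute => -[i k] ikl i0 /=.
  apply: contrapT => /eqP ei; apply: uniq; exists (- i)%R => //.
  apply: contra_eq_neq cNd => id; rewrite -lt0n -has_count; apply/hasP.
  by exists (i, k) => //=; rewrite -id opprK.
have M''b : M'' d (b ^ ev (winv (wsec w d))).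
  by rewrite (ev_inv e p_prime); apply: conjsJ; rewrite -b0.
have [lt|ge] := ltnP (cn w d) (len w).
  have lt' : (cn w d < n)%N := leq_trans lt ln.
  apply: (IH _ lt' (M'' d) (winv (wsec w d)) (PM'' d) (M''a d ed) M''b).
  by rewrite len_inv len_wsec.
apply: (P_gen (PM'' d)); first exact: M''a.
move: M''b; rewrite (ev_inv e p_prime) (ev_wsec e p_prime) evw -[l]/(w.1) (concentrated e p_prime ge).
rewrite sec_B eqxx (_ : b ^ _ = b) //.
by apply/conjg_fixP/commgP/commuteV; exact: commuteX.
Qed.

(** [M] has an element acting on the first level like [a]. Conjugating [b] by a power of it brings a
    conjugate of [a^(ee d)] to [la 0], where [b] itself has section [b]; this is the situation of
    [no_a_conj_b]. *)
Lemma no_b M : P M -> M b -> False.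
Proof.
move=> PM Mb; have sM := P_subgroup PM.
have [w [Mw w2 _]] := P_full 1%R 0%R PM.
have [d ed] := ee_neq0; have d0 : d != 0%R by apply: contraNneq ed => ->; rewrite ee0.
pose g := (ev w ^+ val d)^-1.
have gd : act g (la d) = la 0%R.
  apply: (@act_inj _ g^-1); rewrite actK invgK -(ev_wexp e p_prime) (act_ev e p_prime) wexp2 add0r w2.
  by rewrite Fp_ordE.
pose M' := secgrp M (la 0%R).
have PM' : P M' by exact: P_secgrp.
have M'b : M' b by exists b; split; [exact: Mb | exact: act_b | exact: sec_b0].
have Gh : G (sec g (la d)).
  apply: G_sec => //; apply: subgV (G_subgroup e) _; apply: subgX (G_subgroup e) _; exact: G_ev.
have M'a : M' (a ^ sec g (la d)).
  apply: (@pw_gen _ (ee d)) => //; first by rewrite -conjXg a_exp // conj1g.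
    exact: P_subgroup.
  exists (b ^ g); split.
  - by apply: subgJ => //; apply: subgV => //; exact: subgX.
  - by apply: St1J; exact: b_St1.
  - by rewrite -gd sec_St1J; [rewrite (sec_bn e p_prime d0) pwJ | exact: b_St1].
have [v gv] := G_word p_prime (subgV (G_subgroup e) Gh).
apply: (@no_a_conj_b (len v) (conjs M' (sec g (la d))^-1) v) => //.
- by apply: P_conjs => //; exact: subgV (G_subgroup e) Gh.
- by rewrite -[a](conjgK (sec g (la d))); exact: conjsJ.
- by rewrite -gv; exact: conjsJ.
Qed.

Lemma no_B M j n : P M -> n != 0%R -> M (B j n) -> False.
Proof.
move=> PM n0 MB; have PM' : P (conjs M (A (- j)%R)) by apply: P_conjs => //; exact: GA.
apply: (no_b PM'); apply: (pw_gen _ (P_subgroup PM') n0); first exact: b_exp.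
rewrite (_ : pw b n = B j n ^ A (- j)%R); first exact: conjsJ.
by rewrite (BA e p_prime) addrN B00.
Qed.

Lemma secgrp_wsec M w j : M (ev w) -> w.2 = 0%R -> secgrp M (la j) (ev (wsec w j)).
Proof.
move=> Mw w2; exists (ev w); split=> //; last by rewrite ev_wsec.
by rewrite (act_ev e p_prime) w2 addr0.
Qed.

Section Minimal.
Variable mu : nat.
Hypothesis mu_min : forall M w, P M -> M (ev w) -> tot w != 0%R -> (mu <= len w)%N.

(** Some section has nonzero exponent sum of [b], so its length is at least [mu]: no syllable was
    lost, and [w] is concentrated at one letter. *)
Lemma no_short_b M w : P M -> M (ev w) -> w.2 = 0%R -> tot w != 0%R ->
  (len w <= mu)%N -> False.
Proof.
move=> PM Mw w2 tw lw.
have [j nj] : exists j, nu w j != 0%R.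
  apply/existsP; rewrite -negb_forall; apply: contra tw => /forallP h.
  by rewrite tot_nu big1 // => j _; exact/eqP.
have : (mu <= len (wsec w j))%N.
  apply: mu_min (secgrp_wsec j Mw w2) _; first exact: P_secgrp.
  by rewrite tot_wsec.
rewrite len_wsec => /(leq_trans lw) /(concentrated e p_prime) E.
by apply: (no_B PM tw (j := j)); rewrite -E; move: Mw; rewrite /ev w2 mulg1.
Qed.

Lemma no_short_a M w r : P M -> M (ev w) -> w.2 = (sigma * tot w)%R -> tot w != 0%R ->
  (len w <= mu)%N -> M (A r) -> r != 0%R -> False.
Proof.
move=> PM Mw w2 tw lw Mr r0; have sM := P_subgroup PM.
have Ma : M a by apply: pw_gen Mr => //; exact: a_exp.
apply: (@no_short_b M (wmul w ([::], - w.2)%R)) => //.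
- by rewrite (ev_mul e p_prime) ev_a; apply: subgM => //; exact: subgX.
- by rewrite /= addrN.
- by rewrite tot_mul /tot big_nil addr0.
- by rewrite len_mul /len addn0.
Qed.

Lemma ev_len0 (w : wrd) : len w = 0%N -> ev w = A w.2.
Proof. by case: w => -[|//] s _; exact: ev_a. Qed.
Lemma tot_len0 (w : wrd) : len w = 0%N -> tot w = 0%R.
Proof. by case: w => -[|//] s _; rewrite /tot big_nil. Qed.

(* QP plays the role of the odometer a^sigma b, and xP is independent of it modulo G':
   the odometer is replaced by a section of its p-th power, and x by a section of x. *)
Lemma no_odometer n M x u v : sigma != 0%R -> P M ->
  M (ev (wmul v u)) -> M (ev (wmul x u)) -> (len v + len u <= mu)%N ->
  wt (wmul v u) = 0%R -> tot (wmul v u) != 0%R -> wt (wmul x u) != 0%R ->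
  (len x <= n)%N -> False.
Proof.
move=> sig0; elim/ltn_ind: n M x u v => n IH M x u v PM Mg My luv wg tg wy lx.
have sM := P_subgroup PM; set g := wmul v u in Mg wg tg.
have g2 : g.2 = (sigma * tot g)%R by apply/eqP; rewrite -subr_eq0; exact/eqP.
have g20 : g.2 != 0%R by rewrite g2 mulf_neq0.
have lg : (len g <= mu)%N by rewrite len_mul.
(* If [x] has no syllables, then whichever of [u], [v] has nonzero exponent sum of [b] fills the
   length [mu], and the other one is empty. So [x u] or [x v^-1] is a power of [a], of nonzero
   weight. *)
have [lx0|lx0] := posnP (len x).
  have tx := tot_len0 lx0.
  have Mxv : M (ev (wmul x (winv v))).
    have -> : ev (wmul x (winv v)) = ev (wmul x u) * (ev g)^-1.
      by rewrite !(ev_mul e p_prime) (ev_inv e p_prime); grpnorm.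
    by apply: subgM => //; exact: subgV.
  have wxv : wt (wmul x (winv v)) = wt (wmul x u).
    rewrite !wt_mul wt_inv; congr (_ + _)%R; apply/eqP.
    by rewrite eq_sym -addr_eq0 addrC -wt_mul; exact/eqP.
  have fin w : M (ev w) -> wt w = wt (wmul x u) -> len w = 0%N -> False.
    move=> Mw ww lw; apply: (@no_short_a M g w.2) => //; first by rewrite -ev_len0.
    by move: wy; rewrite -ww /wt (tot_len0 lw) mulr0 subr0.
  have [tu|tu] := eqVneq (tot u) 0%R.
    have tv : tot v != 0%R by move: tg; rewrite tot_mul tu addr0.
    have : (mu <= len (wmul x (winv v)))%N.
      by apply: mu_min PM Mxv _; rewrite tot_mul tot_inv tx add0r oppr_eq0.
    rewrite len_mul lx0 len_inv => lv.
    by apply: (fin (wmul x u)) => //; rewrite len_mul lx0; lia.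
  have : (mu <= len (wmul x u))%N by apply: mu_min PM My _; rewrite tot_mul tx add0r.
  rewrite len_mul lx0 => lu.
  by apply: (fin (wmul x (winv v))) => //; rewrite len_mul len_inv lx0; lia.
(* [k] makes [z = y g^k] fix the first level. The factor [g^k] may be long, but it is absorbed in
   the tail [r] shared by [z = x r] and [g^p = t r]; sections of both at [j] restore the hypotheses,
   with [x] replaced by its section and the other two lengths again adding up to [len g]. *)
set y := wmul x u in My wy; pose kF : F := (- y.2 / g.2)%R; pose k := val kF.
have kp : (k < p)%N by exact: Fp_val.
pose r := wmul u (wexp g k); pose z := wmul x r.
have zE : z = wmul y (wexp g k) by rewrite /z /r wmulA.
have z2 : z.2 = 0%R.
  by rewrite zE /= wexp2 -mulr_natr /k Fp_natE // /kF mulrC divfK // addrN.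
have wz : wt z = wt y by rewrite zE wt_mul wt_exp wg mul0rn addr0.
have Mz : M (ev z).
  by rewrite zE (ev_mul e p_prime) (ev_wexp e p_prime); apply: subgM => //; exact: subgX.
have [j [cj wj]] : exists j, (cn x j < len x)%N /\ wt (wsec z j) != 0%R.
  have [|j1 [j2 [j12 w1 w2]]] := two_good p_prime sig0 z2; first by rewrite wz.
  have : (cn x j1 + cn x j2 <= len x)%N.
    by rewrite len_cn (bigD1 j1) //= (bigD1 j2) 1?eq_sym //= addnA leq_addr.
  case: (ltnP (cn x j1) (len x)) => [h _|h1 h2]; first by exists j1.
  by exists j2; split=> //; lia.
pose t := wmul (wexp g (p - k.+1)) v.
have trE : wmul t r = wexp g p.
  rewrite /t /r -wmulA [wmul v _]wmulA -/g -[wmul g _]/(wexp g k.+1) -wexpD subnK //.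
have jt : (j + t.2 = j + x.2)%R.
  congr (_ + _)%R; apply: (addIr r.2); rewrite -[LHS]/((wmul t r).2) trE wexp2.
  by rewrite -[RHS]/(z.2) z2 -mulr_natr (pcharf0 (pchar_Fp p_prime)) mulr0.
have trj : wmul (wsec t j) (wsec r (j + x.2)%R) = wsec (wexp g p) j.
  by rewrite -jt -wsec_mul trE.
have xrj : wmul (wsec x j) (wsec r (j + x.2)%R) = wsec z j by rewrite -wsec_mul.
apply: (IH (cn x j) (leq_trans cj lx) (secgrp M (la j)) (wsec x j)
   (wsec r (j + x.2)%R) (wsec t j)) => //.
- exact: P_secgrp.
- rewrite trj; apply: secgrp_wsec; first by rewrite (ev_wexp e p_prime); exact: subgX.
  by rewrite wexp2 -mulr_natr (pcharf0 (pchar_Fp p_prime)) mulr0.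
- by rewrite xrj; exact: secgrp_wsec.
- by rewrite -len_mul trj len_pow.
- by rewrite trj /wt tot_pow // s_pow // subrr.
- by rewrite trj tot_pow.
- by rewrite xrj.
- by rewrite len_wsec.
Qed.

End Minimal.

Lemma length_reduction M : ~ P M.
Proof.
move=> PM; pose Q n := exists M w, [/\ P M, M (ev w), tot w != 0%R & len w = n].
have [w [Mw _ tw]] := P_full 0%R 1%R PM.
have Q0 : Q (len w) by exists M, w; rewrite tw oner_neq0.
have [mu [{Mw tw}M0 [{Q0}w0 [PM0 Mw tw lw]]] mu_min] := least_nat Q0.
have mu_min' M' w' : P M' -> M' (ev w') -> tot w' != 0%R -> (mu <= len w')%N.
  by move=> *; apply: mu_min; exists M', w'.
have w2 : w0.2 != 0%R.
  by apply/negP => /eqP w2; apply: (no_short_b mu_min' PM0 Mw) => //; rewrite lw.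
(* This section has the length and the exponent sum of [b] of [w0], but weight [0]; it fixes the
   first level when [sigma = 0]. *)
pose g := wsec (wexp w0 p) 0%R; pose M1 := secgrp M0 (la 0%R).
have PM1 : P M1 by exact: P_secgrp.
have lg : (len g <= mu)%N by rewrite len_pow // lw.
have tg : tot g != 0%R by rewrite tot_pow.
have Mg : M1 (ev g).
  apply: secgrp_wsec; first by rewrite (ev_wexp e p_prime); apply: subgX => //; exact: P_subgroup.
  by rewrite wexp2 -mulr_natr (pcharf0 (pchar_Fp p_prime)) mulr0.
have g2 : g.2 = (sigma * tot g)%R by rewrite s_pow // tot_pow.
have [sig0|sig0] := eqVneq sigma 0%R.
  by apply: (no_short_b mu_min' PM1 Mg) => //; rewrite g2 sig0 mul0r.
have [x [Mx x2 tx]] := P_full 1%R 0%R PM1.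
apply: (@no_odometer mu mu_min' (len x) M1 x (wone p) g) => //; rewrite ?wmul1 //.
- by rewrite addn0.
- by rewrite /wt g2 subrr.
- by rewrite /wt x2 tx mulr0 subr0 oner_neq0.
Qed.

End LengthReduction.

(** * Prodense subgroups *)

Section GGSGroup.
Variables (p : nat) (e : 'rV['F_p]_p.-1) (p_prime : prime p).
Local Notation F := 'F_p.
Local Notation wrd := (wrd p).
Local Notation a := (gen_a p).
Local Notation b := (gen_b e).
Local Notation A := (pw a).
Local Notation B := (B e).
Local Notation G := (GGS e).
Local Notation ee := (ee e).
Local Notation ev := (ev e).
Local Notation la := (la p_prime).
Hypothesis ee_neq0 : exists i, ee i != 0%R.
Implicit Types (g h f : tree_aut p) (M N : set (tree_aut p)) (x y : 'I_p).

Let sG : is_subgroup G := G_subgroup e.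

Lemma act_fix_St1 g x : G g -> act g x = x -> St1 g.
Proof.
move=> /(G_act p_prime)[s gs]; have [j ->] := la_surj p_prime x.
rewrite gs => /la_inj /eqP; rewrite -subr_eq0 addrC addKr => /eqP s0 y.
by have [i ->] := la_surj p_prime y; rewrite gs s0 addr0.
Qed.

Lemma commg_St1 g h : G g -> G h -> St1 [~ g, h].
Proof.
move=> /(G_act p_prime)[s gs] /(G_act p_prime)[t ht] y.
have [i ->] := la_surj p_prime y.
rewrite -(actVK (h * g) (la i)) -actM -commgC.
have [k ->] := la_surj p_prime (act (h * g)^-1 (la i)).
by rewrite !actM gs ht ht gs addrAC.
Qed.

Lemma A_neq1 s : s != 0%R -> A s <> 1.
Proof.
move=> s0 A1; have := act_A p_prime s 0%R; rewrite A1 act1 => /la_inj /esym /eqP.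
by rewrite add0r (negPf s0).
Qed.

Lemma A_St1 s : St1 (A s) -> s = 0%R.
Proof. by move=> /(_ (la 0%R)); rewrite act_A => /la_inj; rewrite add0r. Qed.

Lemma b_neq1 : b <> 1.
Proof.
move=> b1; have [d ed] := ee_neq0.
have d0 : d != 0%R by apply: contraNneq ed => ->; rewrite (ee0 e p_prime).
by apply: (A_neq1 ed); rewrite -(sec_bn e p_prime d0) b1 sec1.
Qed.

Lemma pw_b_neq_A k s : k != 0%R -> pw b k <> A s.
Proof.
move=> k0 E; have bs : St1 (A s) by rewrite -E; apply: St1X; exact: b_St1.
have s0 := A_St1 bs; apply: b_neq1.
have -> : b = pw b k ^+ val (k^-1)%R.
  by rewrite -pwM ?divff ?pw1 //; exact: b_exp.
by rewrite E s0 /pw /= expg0 expg1n.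
Qed.

Lemma comm_ab_neq1 : [~ a, b] <> 1.
Proof.
move=> /eqP /commgP ab; have Bb : B 1%R 1%R = b.
  by rewrite BE !pw1; apply/conjg_fixP/commgP.
have := sec_B e p_prime 1%R 1%R 1%R; rewrite eqxx Bb pw1.
rewrite (sec_bn e p_prime (oner_neq0 _)) => /esym; rewrite -{1}(pw1 b).
exact: pw_b_neq_A (oner_neq0 _).
Qed.

(** At [la j] the section of [B j 1] is [b], and that of [B (j - d) 1] is a nontrivial power of [a]
    when [ee d != 0]. *)
Lemma sec_surj g x : G g -> exists2 h, G h /\ St1 h & sec h x = g.
Proof.
have [j ->] := la_surj p_prime x.
pose H := [set g | exists2 h, G h /\ St1 h & sec h (la j) = g].
have sH : is_subgroup H.
  split.
  - by exists 1; [split; [exact: subg1 sG | exact: subg1 (St1_subgroup p)] | exact: sec1].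
  - move=> _ _ [h [Gh h1] <-] [k [Gk k1] <-]; exists (h * k); last exact: sec_St1M.
    by split; [exact: subgM sG Gh Gk | exact: subgM (St1_subgroup p) h1 k1].
  - move=> _ [h [Gh h1] <-]; exists h^-1; last exact: sec_St1V.
    by split; [exact: subgV sG Gh | exact: subgV (St1_subgroup p) h1].
apply: (G_min (M := H)) => //.
  have [d ed] := ee_neq0; have d0 : d != 0%R by apply: contraNneq ed => ->; rewrite (ee0 e p_prime).
  apply: (pw_gen p_prime (a_exp p_prime) sH ed); exists (B (j - d)%R 1%R).
    by split; [exact: GB | exact: B_St1].
  rewrite sec_B subKr mul1r ifN // -subr_eq0 addrAC subrr add0r oppr_eq0 //.
exists (B j 1%R); first by split; [exact: GB | exact: B_St1].
by rewrite sec_B eqxx pw1.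
Qed.

Lemma act_trans x y : exists2 g, G g & act g x = y.
Proof.
have [i ->] := la_surj p_prime x; have [j ->] := la_surj p_prime y.
by exists (A (j - i)%R); [exact: GA | rewrite act_A addrC subrK].
Qed.

Lemma level_trans (u v : word p) : size u = size v -> exists2 g, G g & g u = v.
Proof.
elim: u v => [|x u IH] [|y v] //= => [_|[/IH[g Gg guv]]].
  by exists 1; [exact: subg1 sG | ].
have [h [Gh h1] hx] := sec_surj x Gg; have [k Gk kxy] := act_trans x y.
have [l [Gl l1] ly] := sec_surj y (subgV sG (G_sec p_prime x Gk)).
exists (h * (k * l)); first by apply: subgM sG Gh _; exact: subgM sG Gk Gl.
by rewrite autE actM h1 actM kxy l1 sec_St1M // secM kxy ly mulgV mulg1 hx guv.
Qed.

Lemma G_secw g (u : word p) : G g -> G (secw g u).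
Proof. by elim: u g => //= x u IH g Gg; apply: IH; exact: G_sec. Qed.

(** Exponent sums are not known to be invariants of the element here, so only the existence of such
    a word is claimed; [word_derived] is the converse. *)
Lemma derived_word g : commutator_subgroup G G g ->
  exists w : wrd, [/\ g = ev w, w.2 = 0%R & tot w = 0%R].
Proof.
have tot1 : tot (([::], 0%R) : wrd) = 0%R by rewrite /tot big_nil.
pose H := [set g | exists w : wrd, [/\ g = ev w, w.2 = 0%R & tot w = 0%R]].
apply: (commutator_sub (H := H)).
  split.
  - by exists ([::], 0%R); split=> //; rewrite ev_a.
  - move=> _ _ [w [-> w2 w3]] [v [-> v2 v3]]; exists (wmul w v).
    by rewrite (ev_mul e p_prime) tot_mul /= w2 v2 w3 v3 !addr0.
  - move=> _ [w [-> w2 w3]]; exists (winv w).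
    by rewrite (ev_inv e p_prime) tot_inv /= w2 w3 !oppr0.
move=> _ _ /(G_word p_prime)[w ->] /(G_word p_prime)[v ->].
exists (wmul (winv w) (wmul (winv v) (wmul w v))); split.
- by rewrite !(ev_mul e p_prime) !(ev_inv e p_prime).
- by rewrite /= [(w.2 + _)%R]addrC addKr addNr.
- by rewrite !tot_mul !tot_inv [(tot w + _)%R]addrC addKr addNr.
Qed.

Lemma word_derived (w : wrd) : w.2 = 0%R -> tot w = 0%R ->
  commutator_subgroup G G (ev w).
Proof.
have nG := normal_refl sG; have nD := commutator_normal sG nG nG.
have sD := normal_subg nD.
suff H l : exists2 d, commutator_subgroup G G d & evl e l = d * pw b (tot (l, 0%R)).
  case: w => l s /= -> tl; have [d Dd E] := H l.
  by rewrite /ev /= E tl pw0 !mulg1.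
elim: l => [|[i k] l [d Dd IH]].
  by exists 1; [exact: subg1 sD | rewrite /tot big_nil pw0 mulg1].
exists ([~ pw b k, A i] ^ (pw b k)^-1 * d ^ (pw b k)^-1).
  have Gb_k : G (pw b k) by rewrite -(B00 e); exact: GB.
  have GV := subgV sG Gb_k.
  apply: (subgM sD); last exact: normalJ nD Dd GV.
  by apply: (normalJ nD) GV; apply: mem_commutator Gb_k _; exact: GA.
rewrite /= IH BE /tot big_cons /= (pwD p_prime (b_exp e p_prime)).
by rewrite -[(\sum_(j <- l) j.2)%R]/(tot (l, 0%R)); grpnorm.
Qed.

Lemma moved_word g : g <> 1 -> exists u0 : word p, forall n, (size u0 <= n)%N ->
  exists2 u : word p, size u = n & g u <> u.
Proof.
move=> g1; have [u gu] : exists u, g u <> u.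
  apply: contrapT => h; apply: g1; apply: tree_autP => u.
  by apply: contrapT => gu; apply: h; exists u.
exists u => n un; pose v := u ++ nseq (n - size u) (la 0%R).
exists v; first by rewrite size_cat size_nseq subnKC.
rewrite /v aut_cat => /eqP; rewrite eqseq_cat ?size_aut // => /andP[/eqP h _].
exact: gu.
Qed.

(* Contrary to common usage, [G] itself counts as prodense. *)
Definition prodense M := [/\ is_subgroup M, M `<=` G &
  forall N g, normal_subgroup N G -> N g -> g <> 1 -> G `<=` gprod M N].

Section Branching.
Variable R : set (tree_aut p).
Hypothesis nR : normal_subgroup R G.
Hypothesis R_emb : forall x r, R r -> R (emb x r).
Hypothesis R_nc : exists r1 r2, [/\ R r1, R r2 & [~ r1, r2] <> 1].

Let sR : is_subgroup R := normal_subg nR.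

Lemma R_embw u r : R r -> R (embw u r).
Proof. by move=> Rr; elim: u => //= x u; exact: R_emb. Qed.

(** If [g] moves [u], and [h], [k] are supported below [u], then [h ^ g] is supported below [g u]
    and commutes with [k], so [[[g, h], k] = [h, k]]. Level transitivity carries this to all
    vertices of the level. *)
Lemma normal_rist N g : normal_subgroup N G -> N g -> g <> 1 -> exists n0,
  forall u r1 r2, (n0 <= size u)%N -> R r1 -> R r2 -> N (embw u [~ r1, r2]).
Proof.
move=> nN Ng /moved_word[u0 mov]; have sN := normal_subg nN.
exists (size u0) => v r1 r2 /mov[u uv gu] Rr1 Rr2.
have Gi w r : R r -> G (embw w r) by move=> Rr; exact: (normal_sub nR (R_embw w Rr)).
have H s1 s2 : R s1 -> R s2 -> N (embw u [~ s1, s2]).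
  move=> Rs1 Rs2; pose h := embw u s1; pose k := embw u s2.
  have Gh : G h := Gi _ _ Rs1.
  have Gk : G k := Gi _ _ Rs2.
  have hgk : commute (h ^ g) k.
    rewrite /h /k embwJ; apply: embw_comm; first by rewrite size_aut.
    exact/eqP.
  have Nc : N [~ [~ g, h], k].
    exact: normalR nN (normalR nN Ng Gh) Gk.
  suff -> : embw u [~ s1, s2] = [~ [~ g, h], k] by [].
  have -> : [~ g, h] = (h ^ g)^-1 * h by rewrite commgEr -conjVg.
  rewrite comm_mull.
  have /commgP/eqP -> := commute_sym (commuteV (commute_sym hgk)).
  by rewrite conj1g mul1g embwR.
have szu : size u = size v := uv.
have [x Gx xu] := level_trans szu; pose c := (secw x u)^-1.
have Gc : G c by apply: subgV sG _; exact: G_secw.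
have -> : embw v [~ r1, r2] = embw u [~ r1 ^ c, r2 ^ c] ^ x.
  by rewrite embwJ xu -conjRg /c conjgKV.
by apply: (normalJ nN) => //; apply: H; apply: normalJ nR _ Gc.
Qed.

(** The elements all of whose conjugates commute with [g] form a normal subgroup. If nontrivial, it
    has a nontrivial element supported below a vertex moved by [g], and conjugation by [g] does not
    fix that element. *)
Lemma noncommuting_conj f g : G f -> G g -> f <> 1 -> g <> 1 ->
  exists2 c, G c & [~ f ^ c, g] <> 1.
Proof.
move=> Gf Gg f1 g1; apply: contrapT => h.
pose N := [set k | G k /\ forall c, G c -> commute (k ^ c) g].
have nN : normal_subgroup N G.
  split; last first.
  - move=> k d [Gk kc] Gd; split; first exact: subgJ sG Gk Gd.
    by move=> c Gc; rewrite -conjgM; apply: kc; exact: subgM sG Gd Gc.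
  - by move=> k [].
  split.
  - by split; [exact: subg1 sG | move=> c _; rewrite conj1g; exact/commute_sym/commute1].
  - move=> k l [Gk kc] [Gl lc]; split; first exact: subgM sG Gk Gl.
    move=> c Gc; rewrite conjMg; apply/commute_sym/commuteM; apply/commute_sym.
      exact: kc.
    exact: lc.
  - move=> k [Gk kc]; split; first exact: subgV sG Gk.
    by move=> c Gc; rewrite conjVg; apply/commute_sym/commuteV/commute_sym; exact: kc.
have Nf : N f.
  split=> // c Gc; apply/commgP; apply: contrapT => /negP fc; apply: h.
  by exists c => //; exact/eqP.
have [n0 Nr] := normal_rist nN Nf f1; have [u0 mov] := moved_word g1.
have [u un gu] := mov (maxn n0 (size u0)) (leq_maxr _ _).
have [r1 [r2 [Rr1 Rr2 r12]]] := R_nc.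
have Nu : N (embw u [~ r1, r2]) by apply: Nr => //; rewrite un leq_maxl.
have /(_ 1 (subg1 sG)) := Nu.2; rewrite conjg1 => /commgP/conjg_fixP E.
apply: r12; apply: (@embw_disjoint _ u (g u) _ ([~ r1, r2] ^ secw g u)).
- by rewrite size_aut.
- by rewrite eq_sym; exact/eqP.
- by rewrite -embwJ E.
Qed.

(** Testing the prodensity of [M] on this product yields elements of [M] with a prescribed section
    modulo [N]. Intersecting with [R] keeps the product inside [G]. *)
Lemma prodS_normal N g : normal_subgroup N G -> N g -> g <> 1 ->
  normal_subgroup (prodS (N `&` R)) G /\ exists2 h, prodS (N `&` R) h & h <> 1.
Proof.
move=> nN Ng g1; have nNR := normalI nN nR; have sNR := normal_subg nNR.
split; first split.
- exact: prodS_subgroup.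
- move=> f [f1 fs]; apply: (normal_sub nR); apply: emb_prod sR f1 _ => x.
  by apply: R_emb; have [] := fs x.
- move=> f h fs Gh; apply: prodSJ fs => k x NRk.
  by apply: normalJ nNR NRk _; exact: G_sec.
have [n0 Nr] := normal_rist nN Ng g1.
have [r1 [r2 [Rr1 Rr2 r12]]] := R_nc; pose x := la 0%R; pose u := nseq n0 x.
exists (emb x (embw u [~ r1, r2])).
  apply: prodS_emb => //; split; first by apply: Nr => //; rewrite size_nseq.
  by apply: R_embw; exact: subgR sR Rr1 Rr2.
by rewrite -(emb1 x) -(embw1 u) => /emb_inj /embw_inj.
Qed.

Lemma prodense_secgrp M x : prodense M -> prodense (secgrp M x).
Proof.
move=> [sM MG Md]; split; first exact: secgrp_subgroup.
  by move=> _ [g [Mg _ <-]]; apply: G_sec => //; exact: MG.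
move=> N g nN Ng g1 h Gh; have [nP [f Pf f1]] := prodS_normal nN Ng g1.
have [y [Gy y1] yx] := sec_surj x Gh.
have [m [q [Mm [q1 qs] yE]]] := Md _ f nP Pf f1 y Gy.
have m1 : St1 m.
  by have := subgM (St1_subgroup p) y1 (subgV (St1_subgroup p) q1); rewrite yE mulgK.
exists (sec m x), (sec q x); split; first by exists m.
  by have [] := qs x.
by rewrite -yx yE sec_St1M.
Qed.

Lemma prodense_conjs M g : prodense M -> G g -> prodense (conjs M g).
Proof.
move=> [sM MG Md] Gg; split; first exact: conjs_subgroup.
  by move=> x /MG h; rewrite -(conjgKV g x); exact: subgJ sG h Gg.
move=> N f nN Nf f1 h Gh.
have [m [n [Mm Nn E]]] := Md N f nN Nf f1 (h ^ g^-1) (subgJ sG Gh (subgV sG Gg)).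
exists (m ^ g), (n ^ g); split; first exact: conjsJ.
  exact: normalJ nN Nn Gg.
by rewrite -conjMg -E conjgKV.
Qed.

Let D := commutator_subgroup G G.
Let nD : normal_subgroup D G.
Proof. by apply: commutator_normal => //; exact: normal_refl. Qed.
Let Dab : D [~ a, b].
Proof. by apply: mem_commutator; [exact: Ga | exact: Gb]. Qed.

Lemma prodense_full M (s n : F) : prodense M ->
  exists w : wrd, [/\ M (ev w), w.2 = s & tot w = n].
Proof.
move=> [sM MG Md]; pose v : wrd := ([:: (0%R, n)], s).
have [m [q [Mm Dq E]]] := Md D _ nD Dab comm_ab_neq1 (ev v) (G_ev v).
have [w [qw w2 tw]] := derived_word Dq.
exists (wmul v (winv w)); split.
- by rewrite (ev_mul e p_prime) (ev_inv e p_prime) -qw E mulgK.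
- by rewrite /= w2 oppr0 addr0.
- by rewrite tot_mul tot_inv tw oppr0 addr0 /tot big_seq1.
Qed.

Lemma prodense_act M s : prodense M ->
  exists2 m, M m & forall i, act m (la i) = la (i + s)%R.
Proof.
move=> /(prodense_full s 0%R)[w [Mw ws _]]; exists (ev w) => // i.
by rewrite act_ev ws.
Qed.

Lemma secgrp_trans M x y : prodense M -> G `<=` secgrp M x -> G `<=` secgrp M y.
Proof.
move=> Md; have [sM MG _] := Md.
have [i ->] := la_surj p_prime x; have [j ->] := la_surj p_prime y.
move=> Mx h Gh; have [t Mt tE] := prodense_act (j - i)%R Md.
have tij : act t (la i) = la j by rewrite tE addrC subrK.
have Gt : G (sec t (la i)) by apply: G_sec => //; exact: MG.
have [m [Mm mi ms]] := Mx (h ^ (sec t (la i))^-1) (subgJ sG Gh (subgV sG Gt)).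
exists (m ^ t); split; first exact: subgJ.
  by rewrite -tij act_fixJ.
by rewrite -tij sec_fixJ // ms conjgKV.
Qed.

(** * Prodense subgroups with full section groups *)

Section Proper.
Variable M : set (tree_aut p).
Hypothesis Md : prodense M.
Hypothesis Mfull : forall x, G `<=` secgrp M x.

Let sM : is_subgroup M. Proof. by case: Md. Qed.
Let MG : M `<=` G. Proof. by case: Md. Qed.

Lemma full_sec g x : G g -> exists h, [/\ M h, St1 h & sec h x = g].
Proof.
move=> /(Mfull x)[h [Mh hx <-]]; exists h; split=> //.
by apply: (act_fix_St1 (x := x)) hx; exact: MG.
Qed.

(** The [g] with [emb x g] in [M] form a normal subgroup [L] of [G], because elements of [M] have
    arbitrary sections at [x]. Elements of [M] moving the letters carry [L] to every coordinate, so
    [M] contains the normal subgroup [L x ... x L]. *)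
Lemma single_support_full x g : M (emb x g) -> g <> 1 -> G `<=` M.
Proof.
move=> Mg g1; pose L := [set g | G g /\ M (emb x g)].
have sL : is_subgroup L.
  split.
  - by split; [exact: subg1 sG | rewrite emb1; exact: subg1].
  - move=> k l [Gk Mk] [Gl Ml]; split; first exact: subgM sG Gk Gl.
    by rewrite embM; exact: subgM.
  - move=> k [Gk Mk]; split; first exact: subgV sG Gk.
    by rewrite embV; exact: subgV.
have LJ k h : L k -> G h -> L (k ^ h).
  move=> [Gk Mk] Gh; split; first exact: subgJ sG Gk Gh.
  have [m [Mm m1 mx]] := full_sec x Gh.
  have -> : emb x (k ^ h) = emb x k ^ m by rewrite embJ m1 mx.
  exact: subgJ.
have LM y k : L k -> M (emb y k).
  have [i xi] := la_surj p_prime x; have [j yj] := la_surj p_prime y.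
  have [t Mt tE] := prodense_act (j - i)%R Md.
  have txy : act t x = y by rewrite xi yj tE addrC subrK.
  have Gt : G (sec t x) by apply: G_sec => //; exact: MG.
  move=> Lk; have [_ Mk] := LJ _ _ Lk (subgV sG Gt).
  have -> : emb y k = emb x (k ^ (sec t x)^-1) ^ t by rewrite embJ txy conjgKV.
  exact: subgJ.
have PM : prodS L `<=` M.
  by move=> f [f1 fL]; apply: emb_prod sM f1 _ => y; exact: LM.
have nP : normal_subgroup (prodS L) G.
  split; first exact: prodS_subgroup.
    by move=> f /PM/MG.
  by move=> f h fL Gh; apply: prodSJ fL => k y Lk; apply: LJ => //; exact: G_sec.
have Lg : L g by split=> //; rewrite -(sec_emb_same x g); apply: G_sec => //; exact: MG.
have eg1 : emb x g <> 1 by rewrite -(emb1 x) => /emb_inj.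
have [_ _ Mprod] := Md => h /(Mprod _ _ nP (prodS_emb x sL Lg) eg1)[m [q [Mm /PM Mq ->]]].
exact: subgM.
Qed.

Definition supp (g : tree_aut p) := #|[pred x | sec g x != 1]|.

(** The commutator of [m ^ h], with [h] fixing the letters, and a translate of [m] is supported in
    the intersection of the supports. Translating by the difference [d] of two letters of the
    support keeps [y] in both; as [d] generates ['F_p] and the support is not everything, some
    letter drops out. *)
Lemma small_support_full m : M m -> St1 m -> m <> 1 -> (supp m < p)%N ->
  (forall f, M f -> St1 f -> f <> 1 -> (supp m <= supp f)%N) -> G `<=` M.
Proof.
move=> Mm m1 mn1 mp min.
have [x mx] : exists x, sec m x != 1.
  apply: contrapT => h; apply: mn1; apply: aut_ext => x; first by rewrite m1 act1.
  by rewrite sec1; apply: contrapT => /eqP mx; apply: h; exists x.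
have [[y yx my]|single] := pselect (exists2 y, y != x & sec m y != 1); last first.
  apply: (@single_support_full x (sec m x)); last exact/eqP.
  rewrite -(_ : m = emb x (sec m x)) //; apply: emb_eq => // y yx.
  by apply: contrapT => /eqP my; apply: single; exists y.
have [i xi] := la_surj p_prime x; have [j yj] := la_surj p_prime y.
pose d := (j - i)%R; have d0 : d != 0%R.
  by rewrite subr_eq0; apply: contra yx => /eqP ji; rewrite xi yj ji.
have [z mz mzd] : exists2 z, sec m (la z) != 1 & sec m (la (z - d)%R) = 1.
  apply: contrapT => h.
  have H z : sec m (la z) != 1 -> sec m (la (z - d)%R) != 1.
    by move=> mz; apply/eqP => mzd; apply: h; exists z.
  have H' n : sec m (la (i - d *+ n)%R) != 1.
    elim: n => [|n IH]; first by rewrite mulr0n subr0 -xi.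
    by rewrite mulrSr opprD addrA; exact: H.
  suff E : supp m = p by move: mp; rewrite E ltnn.
  rewrite -[RHS](card_ord p); apply: eq_card => w; rewrite inE.
  have [k ->] := la_surj p_prime w; rewrite [RHS]inE.
  have := H' (val ((i - k) / d)%R).
  by rewrite -mulr_natr Fp_natE // mulrC divfK // subKr.
have [t Mt tE] := prodense_act d Md; pose m1' := m ^ t.
have m1'1 : St1 m1' by exact: St1J.
have m1'E k : sec m1' (la k) = sec m (la (k - d)%R) ^ sec t (la (k - d)%R).
  by rewrite -{1}(subrK d k) -tE sec_St1J.
have my' : sec m1' y != 1 by rewrite yj m1'E /d subKr -xi conjg_eq1.
have Gm f : M f -> G (sec f y) by move=> /MG; exact: G_sec.
have Mm1' : M m1' := subgJ sM Mm Mt.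
have [c Gc nc] := noncommuting_conj (Gm _ Mm) (Gm _ Mm1') (elimN eqP my) (elimN eqP my').
have [h [Mh h1 hy]] := full_sec y Gc.
pose q := [~ m ^ h, m1']; have mh1 : St1 (m ^ h) by exact: St1J.
have q1 : St1 q by apply: subgR (St1_subgroup p) mh1 m1'1.
have Mq : M q by apply: subgR sM _ Mm1'; exact: subgJ.
have qE w : sec q w = [~ sec m w ^ sec h w, sec m1' w].
  by rewrite sec_St1R // sec_St1JS.
have qy : sec q y <> 1 by rewrite qE hy.
have qn1 : q <> 1 by move=> qn; apply: qy; rewrite qn sec1.
exfalso; have := min q Mq q1 qn1; rewrite leqNgt => /negP; apply.
apply/proper_card/properP; split.
  apply/fintype.subsetP => w; rewrite !inE qE; apply: contra => /eqP ->.
  by rewrite conj1g comm1g.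
exists (la z); first by rewrite inE.
by rewrite inE qE m1'E mzd conj1g commg1 eqxx.
Qed.

(** Let [H] be the first-level stabiliser in [M]. It projects injectively at [la d], and [H']
    projects onto [G']; so an element of [H] with section in [G'] at [la d] lies in [H'], and its
    section at [la 0] fixes the first level. An [m] congruent to [g0] modulo [G'] in each coordinate
    violates this. *)
Lemma full_support_absurd : odd p ->
  (forall f y, M f -> St1 f -> sec f y = 1 -> f = 1) -> False.
Proof.
move=> p_odd inj; have [d ed] := ee_neq0.
have d0 : d != 0%R by apply: contraNneq ed => ->; rewrite (ee0 e p_prime).
have dNd : (- d == d)%R = false.
  rewrite eq_sym -subr_eq0 opprK -mulr2n -mulr_natr mulf_eq0 (negPf d0).
  exact: negPf (two_neq0 p_prime p_odd).
(* Makes the exponents [ee (d + d)] and [t ee d] in the section of [g0] at [la d] cancel. *)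
pose t : F := (- (ee (d + d) / ee d))%R.
pose g0 := B (- d)%R 1%R * B 0%R t.
have Gg0 : G g0 by apply: subgM sG _ _; exact: GB.
have g01 : St1 g0 by apply: subgM (St1_subgroup p) _ _; exact: B_St1.
have g0y : sec g0 (la d) = 1.
  rewrite sec_St1M; last exact: B_St1.
  rewrite !sec_B dNd eq_sym (negPf d0) -(pwD p_prime (a_exp p_prime)).
  by rewrite mul1r opprK subr0 /t mulNr divfK // addrN pw0.
have g0x : sec g0 (la 0%R) = A (ee d) * pw b t.
  rewrite sec_St1M; last exact: B_St1.
  by rewrite !sec_B eqxx oppr_eq0 (negPf d0) opprK add0r mul1r.
have [nP [f Pf f1]] := prodS_normal nD Dab comm_ab_neq1.
have [_ _ Mprod] := Md; have [m [q [Mm [q1 qs] g0E]]] := Mprod _ _ nP Pf f1 _ Gg0.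
have mE : m = g0 * q^-1 by rewrite g0E mulgK.
have q1V := subgV (St1_subgroup p) q1.
have m1 : St1 m by rewrite mE; exact: subgM (St1_subgroup p) g01 q1V.
have sD := normal_subg nD.
have secD x : D (sec q x)^-1 by apply: (subgV sD); have [] := qs x.
pose H := [set f | M f /\ St1 f].
pose H' := commutator_subgroup H H.
have sH' : is_subgroup H' := commutator_subgroupP H H.
have sHM : is_subgroup M := sM.
have H'sub : H' `<=` H.
  apply: commutator_sub => [|g h [Mg g1] [Mh h1]]; last first.
    by split; [exact: subgR | apply: subgR (St1_subgroup p) g1 h1].
  split=> [|g h [Mg g1] [Mh h1]|g [Mg g1]].
  - by split; [exact: subg1 | exact: subg1 (St1_subgroup p)].
  - by split; [exact: subgM | exact: subgM (St1_subgroup p) g1 h1].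
  - by split; [exact: subgV | exact: subgV (St1_subgroup p) g1].
have lift g : D g -> exists2 h, H' h & sec h (la d) = g.
  apply: (commutator_sub (H := [set g | exists2 h, H' h & sec h (la d) = g])).
    split.
    - by exists 1; [exact: subg1 sH' | exact: sec1].
    - move=> _ _ [h H'h <-] [k H'k <-]; exists (h * k); first exact: subgM sH' H'h H'k.
      by apply: sec_St1M; have [] := H'sub _ H'h.
    - move=> _ [h H'h <-]; exists h^-1; first exact: subgV sH' H'h.
      by apply: sec_St1V; have [] := H'sub _ H'h.
  move=> _ _ /(full_sec (la d))[h [Mh h1 <-]] /(full_sec (la d))[k [Mk k1 <-]].
  by exists [~ h, k]; [exact: mem_commutator | rewrite sec_St1R].
have my : D (sec m (la d)) by rewrite mE sec_St1M // g0y mul1g sec_St1V.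
have [h H'h hy] := lift _ my; have [Mh h1] := H'sub _ H'h.
have mh : m = h.
  apply: divg1_eq; apply: (inj _ (la d)).
  - by apply: subgM => //; exact: subgV.
  - by apply: (subgM (St1_subgroup p) m1); exact: subgV (St1_subgroup p) h1.
  - by rewrite sec_St1M // sec_St1V // -hy mulgV.
have H'x : H' `<=` [set f | St1 f /\ St1 (sec f (la 0%R))].
  apply: commutator_sub => [|k l [Mk k1] [Ml l1]].
    split.
    - by split; [exact: subg1 (St1_subgroup p) | rewrite sec1; exact: subg1 (St1_subgroup p)].
    - move=> k l [k1 k0] [l1 l0]; split; first exact: subgM (St1_subgroup p) k1 l1.
      by rewrite sec_St1M //; exact: subgM (St1_subgroup p) k0 l0.
    - move=> k [k1 k0]; split; first exact: subgV (St1_subgroup p) k1.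
      by rewrite sec_St1V //; exact: subgV (St1_subgroup p) k0.
  split; first exact: subgR (St1_subgroup p) k1 l1.
  by rewrite sec_St1R //; apply: commg_St1; apply: G_sec => //; exact: MG.
have [_] := H'x _ H'h; rewrite -mh mE sec_St1M // g0x sec_St1V // => s1.
have D1 : D `<=` @St1 p.
  apply: commutator_sub; first exact: St1_subgroup.
  by move=> k l Gk Gl; exact: commg_St1.
have := subgMl (St1_subgroup p) (D1 _ (secD (la 0%R))) s1.
have bt1 : St1 (pw b t) by apply: St1X; exact: b_St1.
move=> /(subgMl (St1_subgroup p) bt1)/A_St1/eqP.
by rewrite (negPf ed).
Qed.

Lemma proper_sections : odd p -> G `<=` M.
Proof.
move=> p_odd; have [h [Mh h1 hb]] := full_sec (la 0%R) (@Gb p e).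
pose Q n := exists m, [/\ M m, St1 m, m <> 1 & supp m = n].
have Qh : Q (supp h).
  exists h; split=> // h_1; apply: b_neq1; by rewrite -hb h_1 sec1.
have [_ [m [Mm m1 mn1 <-]] min] := least_nat Qh.
have min' f : M f -> St1 f -> f <> 1 -> (supp m <= supp f)%N.
  by move=> Mf f1 fn1; apply: min; exists f.
have [lt|ge] := ltnP (supp m) p; first exact: small_support_full Mm m1 mn1 lt min'.
case: (full_support_absurd p_odd) => f y Mf f1 fy; apply: contrapT => fn1.
have : (supp f < p)%N.
  rewrite -[X in (_ < X)%N](card_ord p) /supp; apply/proper_card/properP; split.
    by apply/fintype.subsetP => w _; rewrite inE.
  by exists y; rewrite ?inE // fy eqxx.
by rewrite ltnNge (leq_trans ge (min' f Mf f1 fn1)).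
Qed.

End Proper.

Theorem prodense_full_group M : odd p -> prodense M -> G `<=` M.
Proof.
move=> p_odd Md; apply: contrapT => nGM.
apply: (@length_reduction p e p_prime p_odd ee_neq0
  (fun M => prodense M /\ ~ (G `<=` M)) _ _ _ _ _ M) => {M Md nGM} //.
- by move=> M [[]].
- move=> M x [Md nGM]; split; first exact: prodense_secgrp.
  move=> Gx; apply: nGM; apply: (proper_sections Md) => // y.
  exact: secgrp_trans Md Gx.
- move=> M g [Md nGM] Gg; split; first exact: prodense_conjs.
  move=> Gc; apply: nGM => h Gh.
  by have := Gc _ (subgJ sG Gh Gg); rewrite /conjs /= conjgK.
- by move=> M s n [Md _]; exact: prodense_full.
- by move=> M [[sM _ _] nGM] Ma Mb; apply: nGM; exact: G_min.
Qed.

End Branching.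
End GGSGroup.

(** * Computations modulo a normal subgroup *)

Section ModuloNormal.
Variable gT : groupType.
Implicit Types (G Z X Y : set gT) (x y g h : gT).

Lemma centralizer_mod G Z x : is_subgroup G -> normal_subgroup Z G -> G x ->
  is_subgroup [set h | G h /\ Z [~ x, h]].
Proof.
move=> sG nZ Gx; have sZ := normal_subg nZ; split.
- by split; [exact: subg1 sG | rewrite commg1; exact: subg1 sZ].
- move=> g h [Gg Zg] [Gh Zh]; split; first exact: subgM sG Gg Gh.
  rewrite comm_mulr.
  by apply: (subgM sZ) => //; exact: normalJ nZ Zg Gh.
- move=> g [Gg Zg]; split; first exact: subgV sG Gg.
  rewrite comm_invr.
  exact: normalJ nZ (subgV sZ Zg) (subgV sG Gg).
Qed.

Lemma commg_sym_mod Z x y : is_subgroup Z -> Z [~ x, y] -> Z [~ y, x].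
Proof. by move=> sZ /(subgV sZ); rewrite invgR. Qed.

Lemma central_mod_normal G Z : is_subgroup G -> normal_subgroup Z G ->
  normal_subgroup [set d | G d /\ forall h, G h -> Z [~ d, h]] G.
Proof.
move=> sG nZ; have sZ := normal_subg nZ; split.
- split.
  + by split; [exact: subg1 sG | move=> h _; rewrite comm1g; exact: subg1 sZ].
  + move=> k l [Gk kc] [Gl lc]; split; first exact: subgM sG Gk Gl.
    move=> h Gh; rewrite comm_mull.
    by apply: (subgM sZ); [exact: normalJ nZ (kc _ Gh) Gl | exact: lc].
  + move=> k [Gk kc]; split; first exact: subgV sG Gk.
    move=> h Gh; rewrite comm_invl.
    by apply: (normalJ nZ); [apply: (subgV sZ); exact: kc | exact: subgV sG Gk].
- by move=> k [].
- move=> k l [Gk kc] Gl; split; first exact: subgJ sG Gk Gl.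
  move=> h Gh; rewrite -(conjgKV l h) -conjRg; apply: (normalJ nZ) => //.
  by apply: kc; exact: subgJ sG Gh (subgV sG Gl).
Qed.

Lemma expg_comm_mod G Z x y n : is_subgroup G -> normal_subgroup Z G -> G x -> G y ->
  (forall g, G g -> Z [~ [~ x, y], g]) -> Z ([~ x ^+ n, y]^-1 * [~ x, y] ^+ n).
Proof.
move=> sG nZ Gx Gy cen; have sZ := normal_subg nZ.
have Gc : G [~ x, y] by exact: subgR.
elim: n => [|n IH].
  by rewrite expg0 comm1g invg1 mulg1; exact: subg1.
have -> : [~ x ^+ n.+1, y] = [~ x, y] ^ x ^+ n * [~ x ^+ n, y].
  by rewrite expgS comm_mull.
have Gxn : G (x ^+ n) by exact: subgX.
have Gd : G [~ x ^+ n, y] by exact: subgR.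
move: IH (cen _ Gxn) Gd; set c := [~ x, y]; set d := [~ x ^+ n, y] => IH Zc Gd.
have -> : (c ^ x ^+ n * d)^-1 * c ^+ n.+1 = [~ c, x ^+ n]^-1 ^ d * (d^-1 * c ^+ n).
  by rewrite [c ^+ n.+1]expgS; grpnorm.
by apply: (subgM sZ) => //; exact: normalJ nZ (subgV sZ Zc) Gd.
Qed.

Lemma cyclic_generated x z : generated [set x] z -> exists m k, z = x ^+ m * (x ^+ k)^-1.
Proof.
apply: (generated_sub (H := [set z | exists m k, z = x ^+ m * (x ^+ k)^-1])).
  split.
  - by exists 0%N, 0%N; rewrite mulgV.
  - move=> _ _ [m [k ->]] [m' [k' ->]]; exists (m + m')%N, (k + k')%N.
    have E : commute (x ^+ k)^-1 (x ^+ m') by apply/commute_sym/commuteV/commuteX2/commute_refl.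
    rewrite [(k + k')%N]addnC !expgnDr invgM !mulgA; congr (_ * _).
    by rewrite -!mulgA [_ * x ^+ m']E.
  - by move=> _ [m [k ->]]; exists k, m; rewrite invgM invgK.
by move=> _ ->; exists 1%N, 0%N; rewrite expg1 expg0 invg1 mulg1.
Qed.

Lemma cyclic_supplement G Y x g n : normal_subgroup Y G -> G x -> (0 < n)%N ->
  Y (x ^+ n) -> gprod (generated [set x]) Y g -> exists m, Y ((x ^+ m)^-1 * g).
Proof.
move=> nY Gx n0 Yxn; have sY := normal_subg nY.
have YJ y z : Y y -> G z -> Y (y ^ z) by exact: normalJ.
move=> [z [y [zx Yy ->]]].
suff [m Ym] : exists m, Y ((x ^+ m)^-1 * z) by exists m; rewrite mulgA; exact: subgM.
have [m [k ->]] := cyclic_generated zx.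
exists (m + k * n.-1)%N.
have -> : (x ^+ (m + k * n.-1))^-1 * (x ^+ m * (x ^+ k)^-1) = ((x ^+ n) ^+ k)^-1.
  rewrite -expgnA expgnDr invgM mulgA -[_ * x ^+ m]mulgA mulVg mulg1 -invgM -expgnDr.
  by congr (_ ^-1); congr (_ ^+ _); rewrite -[in RHS](prednK n0) mulSn mulnC.
by apply: subgV => //; exact: subgX.
Qed.

Lemma normal_between G X Y g : is_subgroup G -> normal_subgroup Y G -> (forall x h, X x -> G h -> Y [~ x, h]) ->
  G g -> X g -> normal_subgroup (gprod (generated [set g]) Y) G.
Proof.
move=> sG nY cen Gg Xg; have sY := normal_subg nY.
have gG : generated [set g] `<=` G by apply: generated_sub => // _ ->.
have sT := gprod_subgroup (generated_subgroup _) gG nY.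
have TG : gprod (generated [set g]) Y `<=` G by apply: gprod_sub => //; exact: normal_sub nY.
have YT : Y `<=` gprod (generated [set g]) Y by apply: gprodr; exact: subg1 (generated_subgroup _).
have Tg : gprod (generated [set g]) Y g.
  by exists g, 1; split; [exact: mem_generated | exact: subg1 | rewrite mulg1].
split=> // x h [z [y [zg Yy ->]]] Gh; rewrite conjMg; apply: (subgM sT); last first.
  by apply: YT; exact: normalJ nY Yy Gh.
move: z zg; apply: (generated_sub (H := [set z | gprod (generated [set g]) Y (z ^ h)])).
  split=> [|k l Hk Hl|k Hk] /=.
  - by rewrite conj1g; exact: subg1 sT.
  - by rewrite conjMg; exact: subgM sT Hk Hl.
  - by rewrite conjVg; exact: subgV sT Hk.
move=> _ ->; rewrite /= (_ : g ^ h = g * [~ g, h]); last by grpnorm.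
by apply: (subgM sT) => //; apply: YT; exact: cen.
Qed.

End ModuloNormal.

(** * Finite quotients of G of p-power order *)

Section GGSquotients.
Variables (p : nat) (e : 'rV['F_p]_p.-1) (p_prime : prime p).
Local Notation F := 'F_p.
Local Notation wrd := (wrd p).
Local Notation a := (gen_a p).
Local Notation b := (gen_b e).
Local Notation A := (pw a).
Local Notation B := (B e).
Local Notation G := (GGS e).
Local Notation ev := (ev e).
Local Notation la := (la p_prime).
Implicit Types (f g h x y : tree_aut p) (M N X Y U Z : set (tree_aut p)).

Let sG : is_subgroup G := G_subgroup e.
Let nG : normal_subgroup G G := normal_refl sG.
Let D := commutator_subgroup G G.
Let nD : normal_subgroup D G := commutator_normal sG nG nG.

Lemma derived_sub Z : normal_subgroup Z G -> Z [~ a, b] -> D `<=` Z.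
Proof.
move=> nZ Zab; have sZ := normal_subg nZ.
have aa : Z [~ a, a] by rewrite commgg; exact: subg1.
have bb : Z [~ b, b] by rewrite commgg; exact: subg1.
have ca g : G g -> Z [~ a, g].
  suff : G `<=` [set h | G h /\ Z [~ a, h]] by move=> H /H[].
  by apply: G_min; [exact: centralizer_mod sG nZ (@Ga p e) | split => //; exact: Ga | split => //; exact: Gb].
have cb g : G g -> Z [~ b, g].
  suff : G `<=` [set h | G h /\ Z [~ b, h]] by move=> H /H[].
  apply: G_min; [exact: centralizer_mod sG nZ (@Gb p e) | split; first exact: Ga | split => //; exact: Gb].
  exact: commg_sym_mod.
apply: commutator_sub => // g h Gg Gh.
suff : G `<=` [set h | G h /\ Z [~ g, h]] by move=> H; have [] := H _ Gh.
apply: G_min; [exact: centralizer_mod sG nZ Gg | split; first exact: Ga | split; first exact: Gb].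
  by apply: commg_sym_mod => //; exact: ca.
by apply: commg_sym_mod => //; exact: cb.
Qed.

Lemma derived_sub_pw Z s : normal_subgroup Z G -> s != 0%R -> Z [~ b, A s] -> D `<=` Z.
Proof.
move=> nZ s0 Zbs; apply: derived_sub => //; apply: commg_sym_mod; first exact: normal_subg nZ.
have sC := centralizer_mod sG nZ (@Gb p e).
by have [] := pw_gen p_prime (a_exp p_prime) sC s0 (conj (@GA p e s) Zbs).
Qed.

(* The terms of a descending central series of G with factors of order at most p. *)
Inductive ppn : set (tree_aut p) -> Prop :=
| ppn_top : ppn G
| ppn_ker X (chi : tree_aut p -> F) : ppn X ->
    (forall g h, X g -> X h -> chi (g * h) = (chi g + chi h)%R) ->
    (forall g h, X g -> G h -> chi (g ^ h) = chi g) ->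
    ppn [set g | X g /\ chi g = 0%R].

Section Ker.
Variables (X : set (tree_aut p)) (chi : tree_aut p -> F).
Hypothesis nX : normal_subgroup X G.
Hypothesis chiM : forall g h, X g -> X h -> chi (g * h) = (chi g + chi h)%R.
Hypothesis chiJ : forall g h, X g -> G h -> chi (g ^ h) = chi g.
Let sX : is_subgroup X := normal_subg nX.

Lemma chi1 : chi 1 = 0%R.
Proof.
have := chiM (subg1 sX) (subg1 sX); rewrite mulg1 => /eqP.
by rewrite -subr_eq0 opprD addrA subrr sub0r oppr_eq0 => /eqP.
Qed.

Lemma chiV g : X g -> chi g^-1 = (- chi g)%R.
Proof.
move=> Xg; apply/eqP; rewrite -addr_eq0 -chiM ?mulVg ?chi1 //.
exact: subgV.
Qed.

Lemma ker_normal : normal_subgroup [set g | X g /\ chi g = 0%R] G.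
Proof.
split.
- split; first by split; [exact: subg1 | exact: chi1].
    move=> g h [Xg g0] [Xh h0]; split; first exact: subgM.
    by rewrite chiM // g0 h0 addr0.
  move=> g [Xg g0]; split; first exact: subgV.
  by rewrite chiV // g0 oppr0.
- by move=> g [/(normal_sub nX)].
- move=> g h [Xg g0] Gh; split; first exact: normalJ nX Xg Gh.
  by rewrite chiJ.
Qed.

Lemma chi_comm g h : X g -> G h -> chi [~ g, h] = 0%R.
Proof.
move=> Xg Gh; rewrite commgEl chiM ?chiV ?chiJ ?addNr //; first exact: subgV.
exact: normalJ nX Xg Gh.
Qed.
End Ker.

Lemma ppn_normal X : ppn X -> normal_subgroup X G.
Proof. by elim=> // {}X chi _ nX chiM chiJ; exact: ker_normal. Qed.

(** The Frattini property of finite [p]-groups, by induction along the series: [M X] also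
    supplements [G'], hence is [G]; as [X] is central modulo a kernel contained in [M],
    [central_supplement] gives [G' <= M]. *)
Lemma ppn_frattini X M : ppn X -> is_subgroup M -> M `<=` G -> X `<=` M ->
  G `<=` gprod M D -> G `<=` M.
Proof.
move=> pX; elim: pX M => // {}X chi pX IH chiM chiJ M sM MG kM MD.
have nX := ppn_normal pX; have sX := normal_subg nX.
have GMX : G `<=` gprod M X.
  apply: IH.
  - exact: gprod_subgroup MG nX.
  - by apply: gprod_sub => //; exact: normal_sub nX.
  - by apply: gprodr; exact: subg1.
  - move=> g /MD[m [d [Mm Dd ->]]]; exists m, d; split=> //.
    by apply: gprodl => //; exact: subg1.
have DM : D `<=` M.
  apply: (central_supplement sM sG GMX) => [x m Xx Mm|x y Xx Xy]; apply: kM; split.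
  - by apply: normalR nX Xx _; exact: MG.
  - by apply: (chi_comm nX) => //; exact: MG.
  - exact: subgR.
  - by apply: (chi_comm nX) => //; exact: (normal_sub nX).
by move=> g /MD[m [d [Mm /DM Md ->]]]; exact: subgM.
Qed.

(** If [X / Y] is central and generated by [x] of order dividing [p], the exponent of [x] modulo [p]
    is the character [chi] that extends the series. *)
Lemma ppn_cyclic X Y (x : tree_aut p) : ppn X -> normal_subgroup Y G -> Y `<=` X -> X x -> Y (x ^+ p) ->
  X `<=` gprod (generated [set x]) Y -> (forall g h, X g -> G h -> Y [~ g, h]) -> ppn Y.
Proof.
move=> pX nY YX Xx Yxp gen cen; have nX := ppn_normal pX.
have [sX sY] := (normal_subg nX, normal_subg nY); have Gx := normal_sub nX Xx.
have [Yx|nYx] := pselect (Y x).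
  have -> : Y = X by apply/seteqP; split=> // g /gen[z [y [zx Yy ->]]]; apply: (subgM sY) Yy; apply: zx; split => // _ ->.
  exact: pX.
have Yn n : Y (x ^+ n) -> (p %| n)%N.
  move=> Yxn; apply: contrapT => /negP pn; apply: nYx.
  have : coprime p n by rewrite prime_coprime.
  rewrite coprime_sym => cop; have n0 : (0 < n)%N.
    by apply: contraNT pn; rewrite -leqNgt leqn0 => /eqP->; exact: dvdn0.
  have [k l E _] := egcdnP p n0; rewrite (eqP cop) in E.
  have : Y (x ^+ (k * n)) by rewrite mulnC expgnA; exact: subgX.
  rewrite E expgnDr => h; apply: (subgMr sY _ h).
  by rewrite mulnC expgnA; exact: subgX.
have ex g : X g -> exists m, Y ((x ^+ m)^-1 * g).
  by move=> /gen; exact: cyclic_supplement nY Gx (prime_gt0 p_prime) Yxp.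
pose T g (s : F) := exists2 m, Y ((x ^+ m)^-1 * g) & s = m%:R%R.
have Tu g s t : T g s -> T g t -> s = t.
  suff H m n : Y ((x ^+ m)^-1 * g) -> Y ((x ^+ n)^-1 * g) -> (m <= n)%N ->
      m%:R%R = n%:R%R :> F.
    move=> [m Ym ->] [n Yn' ->]; case/orP: (leq_total m n) => mn; first exact: H.
    by apply/esym; exact: H.
  move=> Ym Yn' mn; have : Y (x ^+ (n - m)).
    rewrite expgnFr //; have := subgM sY Ym (subgV sY Yn').
    rewrite invgM invgK mulgA mulgK => h.
    have -> : x ^+ n / x ^+ m = ((x ^+ m)^-1 * x ^+ n) by apply: commuteV; exact/commuteX2/commute_refl.
    exact: h.
  move=> /Yn /dvdnP[k E]; rewrite -(subnK mn) E natrD natrM.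
  by rewrite (pcharf0 (pchar_Fp p_prime)) mulr0 add0r.
pose chi g : F := xget 0%R (T g).
have chiT g : X g -> T g (chi g).
  move=> /ex[m Ym]; rewrite /chi; case: xgetP => [s -> //|/(_ m%:R%R)[]].
  by exists m.
have -> : Y = [set g | X g /\ chi g = 0%R].
  apply/seteqP; split=> [g Yg|g [Xg g0]].
    split; first exact: YX.
    apply: (Tu g); first exact/chiT/YX.
    by exists 0%N; rewrite // expg0 invg1 mul1g.
  have [m Ym E] := chiT g Xg; rewrite g0 in E.
  have /dvdnP[k mE] : (p %| m)%N.
    by have /(congr1 val) := E; rewrite (Fp_val_nat p_prime) => /esym/eqP.
  have Yxm : Y (x ^+ m) by rewrite mE mulnC expgnA; exact: subgX.
  exact: subgMr sY (subgV sY Yxm) Ym.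
apply: ppn_ker => // [g h Xg Xh|g h Xg Gh].
  apply: (Tu (g * h)); first by apply: chiT; exact: subgM.
  have [[m Ym ->] [n Yn' ->]] := (chiT g Xg, chiT h Xh).
  exists (n + m)%N; last by rewrite addrC natrD.
  have -> : (x ^+ (n + m))^-1 * (g * h) =
     ((x ^+ m)^-1 * g) ^ (x ^+ n) * ((x ^+ n)^-1 * h).
    by rewrite addnC expgnDr; grpnorm.
  by apply: subgM => //; exact: normalJ nY Ym (subgX _ sG Gx).
apply: (Tu (g ^ h)); first by apply: chiT; exact: normalJ nX Xg Gh.
have [m Ym ->] := chiT g Xg; exists m => //.
have -> : (x ^+ m)^-1 * g ^ h = (x ^+ m)^-1 * g * [~ g, h] by grpnorm.
by apply: subgM => //; exact: cen.
Qed.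


Fixpoint prodU (n : nat) U : set (tree_aut p) :=
  if n is m.+1 then G `&` prodS (prodU m U) else U.

Lemma prodU_sub n U H : is_subgroup H ->
  (forall u g, size u = n -> U g -> H (embw u g)) -> prodU n U `<=` H.
Proof.
elim: n H => [|n IH] H sH HU g; first by move=> Ug; exact: (HU [::]).
move=> [_ [g1 gU]]; apply: (emb_prod sH g1) => x.
apply: (IH [set g | H (emb x g)]) (gU x).
  split=> [|k l Hk Hl|k Hk] /=.
  - by rewrite emb1; exact: subg1 sH.
  - by rewrite embM; exact: subgM sH Hk Hl.
  - by rewrite embV; exact: subgV sH Hk.
by move=> u k un Uk; apply: (HU (x :: u)) => //=; rewrite un.
Qed.

Section PpnProd.
Variables (X : set (tree_aut p)) (chi : tree_aut p -> F).
Hypothesis nX : normal_subgroup X G.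
Hypothesis chiM : forall g h, X g -> X h -> chi (g * h) = (chi g + chi h)%R.
Hypothesis chiJ : forall g h, X g -> G h -> chi (g ^ h) = chi g.
Let P := G `&` prodS X.

Let phi g (j : F) : F := chi (sec g (la j)).

Lemma prod_normal : normal_subgroup P G.
Proof.
have sX := normal_subg nX; split.
- have sP := prodS_subgroup sX; split.
  + by split; [exact: subg1 sG | exact: subg1 sP].
  + by move=> g h [Gg Pg] [Gh Ph]; split; [exact: subgM sG Gg Gh | exact: subgM sP Pg Ph].
  + by move=> g [Gg Pg]; split; [exact: subgV sG Gg | exact: subgV sP Pg].
- by move=> g [].
- move=> g h [Gg Pg] Gh; split; first exact: subgJ sG Gg Gh.
  by apply: prodSJ Pg => k x Xk; apply: (normalJ nX Xk); exact: G_sec.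
Qed.

Lemma dif_phiM n g h j : P g -> P h ->
  iter n (@dif p) (phi (g * h)) j = (iter n (@dif p) (phi g) j + iter n (@dif p) (phi h) j)%R.
Proof.
move=> [_ [g1 gX]] [_ [_ hX]]; elim: n j => [|n IH] j /=.
  by rewrite /phi sec_St1M // chiM.
by rewrite /dif !IH opprD addrACA.
Qed.

Lemma dif_phiJ n g h s j : P g -> G h -> (forall i, act h (la i) = la (i + s)%R) ->
  iter n (@dif p) (phi (g ^ h)) j = iter n (@dif p) (phi g) (j - s)%R.
Proof.
move=> [_ [g1 gX]] Gh hs; elim: n j => [|n IH] j /=.
  by rewrite /phi -{1}(subrK s j) -hs sec_St1J // chiJ //; exact: G_sec.
by rewrite /dif !IH addrAC.
Qed.

(** The values of [chi] on the coordinates form a function on ['F_p], on which [G] acts by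
    translations. The subgroups [E n], where its [n]-th differences vanish, run from [P] at [n = p]
    to the product of the kernels at [n = 0]; on [E n.+1] the [n]-th difference is constant, hence a
    [G]-invariant character. *)
Lemma ppn_prod_step : ppn P -> ppn (G `&` prodS [set g | X g /\ chi g = 0%R]).
Proof.
move=> pP; have nP := prod_normal.
pose E n := [set g | P g /\ forall j, iter n (@dif p) (phi g) j = 0%R].
suff H k : (k <= p)%N -> ppn (E (p - k)%N).
  have := H p (leqnn p); rewrite subnn.
  have -> // : E 0%N = G `&` prodS [set g | X g /\ chi g = 0%R].
  apply/seteqP; split=> g.
    move=> [[Gg [g1 gX]] g0]; split=> //; split=> // x; split; first exact: gX.
    by have [j ->] := la_surj p_prime x; exact: g0.
  move=> [Gg [g1 gX]]; split; last by move=> j; have [] := gX (la j).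
  by split=> //; split=> // x; have [] := gX x.
elim: k => [|k IH] kp.
  rewrite subn0; have -> // : E p = P.
  by apply/seteqP; split=> [g []//|g Pg]; split=> // j; exact: dif_iter_p.
set n := (p - k.+1)%N; have nE : (p - k)%N = n.+1 by rewrite -subSn // subSS.
have {}IH := IH (ltnW kp); rewrite nE in IH.
have const g j : E n.+1 g -> iter n (@dif p) (phi g) j = iter n (@dif p) (phi g) 0%R.
  move=> [_ g0]; rewrite -[in LHS](Fp_natE p_prime j); elim: (val j) => // m Em.
  have /eqP := g0 m%:R%R; rewrite iterS /dif subr_eq0 Em => /eqP.
  by rewrite -natr1 => ->.
have -> : E n = [set g | E n.+1 g /\ iter n (@dif p) (phi g) 0%R = 0%R].
  apply/seteqP; split=> g.
    move=> [Pg g0]; split; last exact: g0.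
    by split=> // j; rewrite iterS /dif !g0 subrr.
  move=> [[Pg g1] g0]; split=> // j.
  by rewrite const.
apply: ppn_ker IH _ _ => [g h [Pg _] [Ph _]|g h Eg Gh]; first exact: dif_phiM.
have [s hs] := G_act p_prime Gh; have [Pg _] := Eg.
by rewrite (dif_phiJ _ _ Pg Gh hs) const.
Qed.
End PpnProd.

Lemma ppn_prod U : ppn U -> ppn (G `&` prodS U).
Proof.
elim=> [|X chi pX pP chiM chiJ]; last exact: ppn_prod_step (ppn_normal pX) chiM chiJ pP.
(* For [U = G] the product is the first-level stabiliser, the kernel of the rotation that [g]
   induces on the letters. *)
pose r (g : tree_aut p) : F := xget 0%R [set s | forall j, act g (la j) = la (j + s)%R].
have rE g : G g -> forall j, act g (la j) = la (j + r g)%R.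
  move=> /(G_act p_prime)[s gs]; rewrite /r; case: xgetP => [t -> //|/(_ s)].
  by case.
have rU g s : G g -> act g (la 0%R) = la s -> r g = s.
  by move=> Gg; rewrite rE // => /la_inj; rewrite add0r.
have -> : G `&` prodS G = [set g | G g /\ r g = 0%R].
  apply/seteqP; split=> g.
    by move=> [Gg [g1 _]]; split=> //; apply: rU => //; rewrite g1.
  move=> [Gg g0]; split=> //; split; last by move=> x; exact: G_sec.
  by move=> x; have [j ->] := la_surj p_prime x; rewrite rE // g0 addr0.
have rM g h : G g -> G h -> r (g * h) = (r g + r h)%R.
  by move=> Gg Gh; apply: rU; [exact: subgM sG Gg Gh | rewrite actM !rE // add0r].
apply: ppn_ker => //; first exact: ppn_top.
move=> g h Gg Gh; apply: (addrI (r h)); rewrite -rM //; last exact: subgJ sG Gg Gh.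
by rewrite -conjgC rM // addrC.
Qed.

Lemma ppn_prodU n U : ppn U -> ppn (prodU n U).
Proof. by move=> pU; elim: n => //= n; exact: ppn_prod. Qed.

Let c : tree_aut p := [~ a, b].
Let D3 := commutator_subgroup D G.
Let D4 := commutator_subgroup D3 G.
Let nD3 : normal_subgroup D3 G := commutator_normal sG nD nG.
Let nD4 : normal_subgroup D4 G := commutator_normal sG nD3 nG.
Let Dc : D c. Proof. by apply: mem_commutator; [exact: Ga | exact: Gb]. Qed.
Let Ga' : G a := @Ga p e.
Let Gb' : G b := @Gb p e.
Let Gc : G c := normal_sub nD Dc.

Lemma cyclic_power_mod Z x y : normal_subgroup Z G -> G x -> G y -> x ^+ p = 1 ->
  (forall g, G g -> Z [~ [~ x, y], g]) -> Z ([~ x, y] ^+ p).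
Proof.
move=> nZ Gx Gy xp cen; have := expg_comm_mod p sG nZ Gx Gy cen.
by rewrite xp comm1g invg1 mul1g.
Qed.

(** The series [G >= Y >= D >= D3 >= T >= D4] has central factors generated by [b], [a], [c =
    [a, b]], [[b, c]] and [[a, c]]; the orders divide [p] because [a^p = b^p = 1]. *)
Lemma ppn_gamma4 : ppn D4.
Proof.
pose Y := [set g | exists2 w : wrd, g = ev w & tot w = 0%R].
have sY : is_subgroup Y.
  split.
  - by exists ([::], 0%R); rewrite ?ev_a // /tot big_nil.
  - move=> _ _ [w -> w0] [v -> v0]; exists (wmul w v); first by rewrite (ev_mul e p_prime).
    by rewrite tot_mul w0 v0 addr0.
  - move=> _ [w -> w0]; exists (winv w); first by rewrite (ev_inv e p_prime).
    by rewrite tot_inv w0 oppr0.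
have YG : Y `<=` G by move=> _ [w -> _]; exact: G_ev.
have DY : D `<=` Y by move=> g /(derived_word p_prime)[w [-> _ w0]]; exists w.
have Dcomm g h : G g -> G h -> D [~ g, h] by exact: mem_commutator.
have nY : normal_subgroup Y G.
  split=> // g h Yg Gh; rewrite (_ : g ^ h = g * [~ g, h]); last by grpnorm.
  exact: subgM sY Yg (DY _ (Dcomm _ _ (YG _ Yg) Gh)).
have pY : ppn Y.
  apply: (ppn_cyclic ppn_top nY YG Gb').
  - by rewrite b_exp //; exact: subg1 sY.
  - move=> g /(G_word p_prime)[w ->].
    exists (pw b (tot w)), (ev (wmul ([:: (0%R, (- tot w)%R)], 0%R) w)); split.
    + by apply: (subgX _ (generated_subgroup _)); exact: mem_generated.
    + by exists (wmul ([:: (0%R, (- tot w)%R)], 0%R) w) => //; rewrite tot_mul /tot big_seq1 addNr.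
    + rewrite (ev_mul e p_prime) (ev_B e) B00 pwN ?mulVKg //; exact: b_exp.
  - by move=> g h Gg Gh; apply: DY; exact: Dcomm.
have pD : ppn D.
  apply: (ppn_cyclic pY nD DY (x := a)).
  - by exists ([::], 1%R); rewrite ?ev_a ?pw1 // /tot big_nil.
  - by rewrite a_exp //; exact: subg1 (normal_subg nD).
  - move=> _ [w -> w0].
    exists (A w.2), (ev (wmul ([::], (- w.2)%R) w)); split.
    + by apply: (subgX _ (generated_subgroup _)); exact: mem_generated.
    + by apply: word_derived => //=; rewrite ?addNr // tot_mul w0 addr0 /tot big_nil.
    + rewrite (ev_mul e p_prime) ev_a pwN ?mulVKg //; exact: a_exp.
  - by move=> g h /YG Gg Gh; exact: Dcomm.
have D3D : D3 `<=` D.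
  by apply: commutator_sub (normal_subg nD) _ => x y Dx Gy; exact: normalR nD Dx Gy.
have D4D3 : D4 `<=` D3.
  by apply: commutator_sub (normal_subg nD3) _ => x y Dx Gy; exact: normalR nD3 Dx Gy.
have c3 x h : D x -> G h -> D3 [~ x, h] by exact: mem_commutator.
have c4 x h : D3 x -> G h -> D4 [~ x, h] by exact: mem_commutator.
have pD3 : ppn D3.
  apply: (ppn_cyclic pD nD3 D3D Dc) => //.
    apply: cyclic_power_mod => //; [exact: a_exp | by move=> g; exact: c3].
  apply: derived_sub; first exact: normal_between sG nD3 c3 Gc Dc.
  by exists c, 1; split; [exact: mem_generated | exact: subg1 (normal_subg nD3) | rewrite mulg1].
pose ca := [~ a, c]; pose cb := [~ b, c].
have D3ca : D3 ca by apply: commg_sym_mod (normal_subg nD3) _; exact: c3.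
have D3cb : D3 cb by apply: commg_sym_mod (normal_subg nD3) _; exact: c3.
have [Gca Gcb] := (normal_sub nD3 D3ca, normal_sub nD3 D3cb).
have nT := normal_between sG nD4 c4 Gca D3ca; set T := gprod _ _ in nT.
have sT := normal_subg nT.
have TD3 : T `<=` D3.
  apply: gprod_sub (normal_subg nD3) _ D4D3.
  by apply: generated_sub (normal_subg nD3) _ => _ ->.
have D4T : D4 `<=` T by apply: gprodr; exact: subg1 (generated_subgroup _).
have cT x h : D3 x -> G h -> T [~ x, h] by move=> Dx Gh; apply: D4T; exact: c4.
have pT : ppn T.
  apply: (ppn_cyclic pD3 nT TD3 D3cb) => //.
    by apply: cyclic_power_mod => //; [exact: b_exp | move=> g; exact: cT].
  have nT' := normal_between sG nT cT Gcb D3cb; set T' := gprod _ T in nT' *.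
  have sT' := normal_subg nT'.
  have TT' : T `<=` T' by apply: gprodr; exact: subg1 (generated_subgroup _).
  have T'ca : T' [~ c, a].
    apply: commg_sym_mod sT' _; apply: TT'; exists ca, 1.
    by split; [exact: mem_generated | exact: subg1 (normal_subg nD4) | rewrite mulg1].
  have T'cb : T' [~ c, b].
    apply: commg_sym_mod sT' _; exists cb, 1.
    by split; [exact: mem_generated | exact: subg1 | rewrite mulg1].
  have T'c g : G g -> T' [~ c, g].
    suff : G `<=` [set h | G h /\ T' [~ c, h]] by move=> H /H[].
    by apply: G_min; first exact: centralizer_mod sG nT' Gc.
  apply: (commutator_sub sT') => d g Dd Gg.
  suff H : D `<=` [set d | G d /\ forall h, G h -> T' [~ d, h]] by have [_] := H _ Dd; apply.
  by apply: derived_sub; [exact: central_mod_normal | split].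
apply: (ppn_cyclic pT nD4 D4T (x := ca)) => //.
- by exists ca, 1; split; [exact: mem_generated | exact: subg1 (normal_subg nD4) | rewrite mulg1].
- exact: (cyclic_power_mod nD4 Ga' Gc (a_exp p_prime) (fun g => c4 ca g D3ca)).
- by move=> g h /TD3; exact: c4.
Qed.

End GGSquotients.

(** * Projections to a letter and embeddings at a letter *)

Section FirstLevel.
Variables (p : nat) (e : 'rV['F_p]_p.-1) (p_prime : prime p).
Local Notation F := 'F_p.
Local Notation wrd := (wrd p).
Local Notation a := (gen_a p).
Local Notation b := (gen_b e).
Local Notation A := (pw a).
Local Notation B := (B e).
Local Notation G := (GGS e).
Local Notation ee := (ee e).
Local Notation ev := (ev e).
Local Notation la := (la p_prime).
Implicit Types (f g h : tree_aut p) (M N X Y U Z : set (tree_aut p)).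
Hypothesis ee_neq0 : exists i, ee i != 0%R.

Let sG : is_subgroup G := G_subgroup e.
Let nG : normal_subgroup G G := normal_refl sG.
Let D := commutator_subgroup G G.
Let nD : normal_subgroup D G := commutator_normal sG nG nG.

Definition lev Y : set (tree_aut p) :=
  [set g | exists h, [/\ Y h, St1 h & sec h (la 0%R) = g]].

Lemma lev_normal Y : normal_subgroup Y G -> normal_subgroup (lev Y) G.
Proof.
move=> nY; have sY := normal_subg nY; split.
- split.
  + by exists 1; split; [exact: subg1 sY | exact: subg1 (St1_subgroup p) | exact: sec1].
  + move=> _ _ [h [Yh h1 <-]] [k [Yk k1 <-]]; exists (h * k).
    by split; [exact: subgM sY Yh Yk | exact: subgM (St1_subgroup p) h1 k1 | exact: sec_St1M].
  + move=> _ [h [Yh h1 <-]]; exists h^-1.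
    by split; [exact: subgV sY Yh | exact: subgV (St1_subgroup p) h1 | exact: sec_St1V].
- by move=> _ [h [Yh _ <-]]; apply: G_sec => //; exact: (normal_sub nY).
- move=> _ g [h [Yh h1 <-]] Gg; have [k [Gk k1] <-] := sec_surj p_prime ee_neq0 (la 0%R) Gg.
  exists (h ^ k); split; [exact: normalJ nY Yh Gk | exact: St1J | exact: sec_St1JS].
Qed.

Lemma secJ_A h s j : St1 h -> sec (h ^ A s) (la (j + s)%R) = sec h (la j).
Proof. by move=> h1; rewrite -act_A sec_St1J // sec_A conjg1. Qed.

Lemma lev_at Y h j : normal_subgroup Y G -> Y h -> St1 h -> lev Y (sec h (la j)).
Proof.
move=> nY Yh h1; exists (h ^ A (- j)%R); split; first exact: normalJ nY Yh (@GA p e _).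
  exact: St1J.
by rewrite -(addrN j) secJ_A.
Qed.

Lemma lev_get Y g j : normal_subgroup Y G -> lev Y g ->
  exists h, [/\ Y h, St1 h & sec h (la j) = g].
Proof.
move=> nY [h [Yh h1 <-]]; exists (h ^ A j); split; first exact: normalJ nY Yh (@GA p e _).
  exact: St1J.
by rewrite -[X in la X](add0r j) secJ_A.
Qed.

Definition low Y : set (tree_aut p) := [set g | G g /\ Y (emb (la 0%R) g)].

Lemma low_normal Y : normal_subgroup Y G -> normal_subgroup (low Y) G.
Proof.
move=> nY; have sY := normal_subg nY; split.
- split.
  + by split; [exact: subg1 sG | rewrite emb1; exact: subg1 sY].
  + move=> g h [Gg Yg] [Gh Yh]; split; first exact: subgM sG Gg Gh.
    by rewrite embM; exact: subgM sY Yg Yh.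
  + move=> g [Gg Yg]; split; first exact: subgV sG Gg.
    by rewrite embV; exact: subgV sY Yg.
- by move=> g [].
- move=> g h [Gg Yg] Gh; split; first exact: subgJ sG Gg Gh.
  have [k [Gk k1] <-] := sec_surj p_prime ee_neq0 (la 0%R) Gh.
  rewrite -{1}(k1 (la 0%R)) -embJ; exact: normalJ nY Yg Gk.
Qed.

Lemma low_emb Y g x : normal_subgroup Y G -> low Y g -> Y (emb x g).
Proof.
move=> nY [_ Yg]; have [j ->] := la_surj p_prime x.
have -> : emb (la j) g = emb (la 0%R) g ^ A j by rewrite embJ act_A add0r sec_A conjg1.
exact: normalJ nY Yg (@GA p e _).
Qed.

Lemma comm_emb g h x : St1 g -> St1 h ->
  (forall y, y != x -> commute (sec g y) (sec h y)) ->
  [~ g, h] = emb x [~ sec g x, sec h x].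
Proof.
move=> g1 h1 gh; apply: emb_eq.
- exact: subgR (St1_subgroup p) g1 h1.
- by rewrite sec_St1R.
- by move=> y /gh/commgP/eqP E; rewrite sec_St1R.
Qed.

(** To realise a commutator at [x], only one of its entries has to be supported at [x]; for the
    other a prescribed section suffices, which is what [lev] provides. *)
Lemma emb_comm_sec x r h : St1 h -> emb x [~ r, sec h x] = [~ emb x r, h].
Proof. by move=> h1; rewrite embM embV commgEl embJ h1. Qed.

End FirstLevel.

(** * Non-constant defining vectors *)

Section NonConstant.
Variables (p : nat) (e : 'rV['F_p]_p.-1) (p_prime : prime p) (p_odd : odd p).
Local Notation F := 'F_p.
Local Notation wrd := (wrd p).
Local Notation a := (gen_a p).
Local Notation b := (gen_b e).
Local Notation A := (pw a).
Local Notation B := (B e).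
Local Notation G := (GGS e).
Local Notation ee := (ee e).
Local Notation ev := (ev e).
Local Notation la := (la p_prime).
Implicit Types (f g h : tree_aut p) (M N X Y U Z : set (tree_aut p)).
Hypothesis nconst : ~ exists c, forall i, i != 0%R -> ee i = c.

Let sG : is_subgroup G := G_subgroup e.
Let nG : normal_subgroup G G := normal_refl sG.
Let D := commutator_subgroup G G.
Let D3 := commutator_subgroup D G.
Let D4 := commutator_subgroup D3 G.
Let nD : normal_subgroup D G := commutator_normal sG nG nG.
Let nD3 : normal_subgroup D3 G := commutator_normal sG nD nG.
Let nD4 : normal_subgroup D4 G := commutator_normal sG nD3 nG.
Let Dcomm g h : G g -> G h -> D [~ g, h]. Proof. exact: mem_commutator. Qed.
Let D3comm g h : D g -> G h -> D3 [~ g, h]. Proof. exact: mem_commutator. Qed.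

Lemma Fp_nat_neq0 n : (0 < n < p)%N -> (n%:R : F)%R != 0%R.
Proof.
move=> /andP[n0 np]; apply/eqP => /(congr1 val); rewrite (Fp_val_nat p_prime) modn_small //.
by move=> n00; rewrite n00 in n0.
Qed.

Lemma ee_neq0 : exists i, ee i != 0%R.
Proof.
apply: contrapT => h; apply: nconst; exists 0%R => i _.
by apply: contrapT => /eqP ei; apply: h; exists i.
Qed.

Lemma exists_jump : exists j, [/\ j != 0%R, j != 1%R & ee (j - 1)%R != ee j].
Proof.
apply: contrapT => h; apply: nconst; exists (ee 1%R) => i i0.
rewrite -(Fp_natE p_prime i) in i0 *; have : (val i < p)%N := Fp_val p_prime i.
case: (val i) i0 => [|m]; first by rewrite eqxx.
move=> _; elim: m => [|m IH] mp; first by [].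
rewrite -IH 1?ltnW //; apply/esym/eqP; apply: contrapT => /negP ne; apply: h.
have E : (m.+2%:R - 1 = m.+1%:R :> F)%R by rewrite -natr1 addrK.
exists (m.+2%:R)%R; split; last by rewrite E // eq_sym.
  by apply: Fp_nat_neq0; rewrite mp.
by rewrite -subr_eq0 E; apply: Fp_nat_neq0; rewrite (ltnW mp).
Qed.

Let k0 : tree_aut p := [~ b, a].
Lemma k0E : k0 = (B 0%R 1%R)^-1 * B 1%R 1%R.
Proof. by rewrite B00 BE !pw1. Qed.
Lemma k0_St1 : St1 k0.
Proof. by apply: (commg_St1 p_prime); [exact: Gb | exact: Ga]. Qed.
Lemma k0_sec j : j != 0%R -> j != 1%R -> sec k0 (la j) = A (ee (j - 1) - ee j)%R.
Proof.
move=> j0 j1; rewrite k0E sec_St1M; last exact/(subgV (St1_subgroup p))/B_St1.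
rewrite sec_St1V; last exact: B_St1.
rewrite !sec_B eq_sym (negPf j0) [(1 == j)%R]eq_sym (negPf j1) !mul1r subr0.
rewrite -pwN ?(a_exp p_prime) // -pwD ?(a_exp p_prime) //.
by rewrite addrC.
Qed.
Let Dk0 : D k0. Proof. by apply: Dcomm; [exact: Gb | exact: Ga]. Qed.

(** At a jump [j] the section of [[b, a]] is a nontrivial power of [a]; at [la 1] it is [b] up to a
    power of [a]. *)
Lemma lev_D : G `<=` lev p_prime D.
Proof.
have nL := lev_normal p_prime ee_neq0 nD; have sL := normal_subg nL.
have [j [j0 j1 ej]] := exists_jump.
have La : lev p_prime D a.
  have := lev_at p_prime j nD Dk0 k0_St1; rewrite k0_sec //; apply: pw_gen => //.
    exact: a_exp.
  by rewrite subr_eq0.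
apply: G_min => //.
have := lev_at p_prime 1%R nD Dk0 k0_St1; rewrite k0E.
rewrite sec_St1M ?sec_St1V ?sec_B; try exact: B_St1; last exact/(subgV (St1_subgroup p))/B_St1.
rewrite eqxx eq_sym oner_eq0 pw1 => h; apply: (subgMr sL _ h).
by apply: (subgV sL); exact: (subgX _ sL La).
Qed.

Lemma lev_D3 : D `<=` lev p_prime D3.
Proof.
have nL := lev_normal p_prime ee_neq0 nD3; have [j [j0 j1 ej]] := exists_jump.
have kB : D3 [~ k0, B j 1%R] by apply: D3comm => //; exact: GB.
have kB1 : St1 [~ k0, B j 1%R] by apply: (subgR (St1_subgroup p) k0_St1); exact: B_St1.
have := lev_at p_prime j nD3 kB kB1.
rewrite sec_St1R; [|exact: k0_St1|exact: B_St1].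
rewrite k0_sec // sec_B eqxx pw1 => /(commg_sym_mod (normal_subg nL)).
by apply: derived_sub_pw => //; rewrite subr_eq0.
Qed.

Let E := low e p_prime D3.
Let nE : normal_subgroup E G := low_normal p_prime ee_neq0 nD3.
Let sE : is_subgroup E := normal_subg nE.

(** At [la (- i)] the section of [B 0 1] is trivial, so [[B 0 1, B (- i) 1]] is supported at [la 0]
    alone, with section [[b, a^(ee i)]]. This section is therefore central modulo [E], and so is all
    of [G']. *)
Lemma low_D3_single i : ee i != 0%R -> ee (- i)%R = 0%R -> D3 `<=` E.
Proof.
move=> ei eNi; have i0 : i != 0%R by apply: contraNneq ei => ->; rewrite (ee0 e p_prime).
have z1 : [~ B 0%R 1%R, B (- i)%R 1%R] = emb (la 0%R) [~ b, A (ee i)].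
  rewrite (@comm_emb _ _ _ (la 0%R)); try exact: B_St1.
    by rewrite !sec_B eqxx oppr_eq0 (negPf i0) opprK add0r pw1 mul1r.
  move=> y; have [j ->] := la_surj p_prime y; rewrite (inj_eq (@la_inj _ _)) => j0.
  rewrite !sec_B eq_sym (negPf j0); case: eqP => [<-|_]; last exact/commuteX2/commute_refl.
  by rewrite subr0 eNi mulr0; exact/commute_sym/commute1.
have := central_mod_normal sG nE => nZ.
apply: commutator_sub sE _ => d g Dd Gg.
have : D `<=` [set d | G d /\ forall h, G h -> E [~ d, h]]; last by case/(_ d Dd) => _; apply.
apply: (derived_sub_pw p_prime nZ ei); split.
  by apply: subgR sG (@Gb p e) _; exact: GA.
move=> h Gh; have [k [Gk k1] <-] := sec_surj p_prime ee_neq0 (la 0%R) Gh.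
split; first by apply: subgR sG _ _; [apply: subgR sG (@Gb p e) _; exact: GA | exact: G_sec].
rewrite emb_comm_sec // -z1; apply: D3comm Gk.
by apply: Dcomm; exact: GB.
Qed.

Let H := [set h | G h /\ forall d, D d -> E [~ d, h]].

Lemma H_subgroup : is_subgroup H.
Proof.
split.
- by split=> [|d _]; [exact: subg1 sG | rewrite commg1; exact: subg1 sE].
- move=> g h [Gg Hg] [Gh Hh]; split=> [|d Dd]; first exact: subgM sG Gg Gh.
  have [] := subgM (centralizer_mod sG nE (normal_sub nD Dd)) (conj Gg (Hg _ Dd)) (conj Gh (Hh _ Dd)).
  by [].
- move=> g [Gg Hg]; split=> [|d Dd]; first exact: subgV sG Gg.
  by have [] := subgV (centralizer_mod sG nE (normal_sub nD Dd)) (conj Gg (Hg _ Dd)).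
Qed.

Let rr (i k t : F) : F :=
  (- ((ee i + t * ee (i - k)) / ee (- i)) * ee (- (i + i)) + t * ee (- k))%R.

(* The element B_0 B_(2i)^be B_k^t, with be chosen so as to have trivial section
   at [la i], has section b a^(rr i k t) at [la 0]. *)
Lemma H_side i k t : ee i != 0%R -> ee (- i)%R != 0%R -> k != 0%R -> k != i ->
  H (b * A (rr i k t)).
Proof.
move=> ei eNi k0' ki; have i0 : i != 0%R by apply: contraNneq ei => ->; rewrite (ee0 e p_prime).
pose be : F := (- ((ee i + t * ee (i - k)) / ee (- i)))%R.
pose y := B 0%R 1%R * (B (i + i)%R be * B k t).
have Gy : G y by apply: subgM sG _ _; [exact: GB | apply: subgM sG _ _; exact: GB].
have y1 : St1 y.
  by apply: subgM (St1_subgroup p) _ _; [exact: B_St1 | apply: subgM (St1_subgroup p) _ _; exact: B_St1].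
have ysec z : sec y (la z) = sec (B 0%R 1%R) (la z) * (sec (B (i + i)%R be) (la z) * sec (B k t) (la z)).
  rewrite (sec_St1M _ _ (B_St1 e 0%R 1%R)); congr (_ * _).
  by rewrite (sec_St1M _ _ (B_St1 e (i + i)%R be)).
have ii0 : (i + i == 0)%R = false.
  by rewrite -mulr2n -mulr_natr mulf_eq0 (negPf i0) (negPf (two_neq0 p_prime p_odd)).
have yi : sec y (la i) = 1.
  rewrite ysec !sec_B eq_sym (negPf i0) -subr_eq0 addrK (negPf i0) (negPf ki).
  rewrite -!(pwD p_prime (a_exp p_prime)) subr0 mul1r.
  have iE : (i - (i + i) = - i)%R by rewrite opprD addrA subrr sub0r.
  rewrite iE /be mulNr divfK // (_ : (_ + _ = 0)%R) ?pw0 //.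
  by ring.
have y0 : sec y (la 0%R) = b * A (rr i k t).
  rewrite ysec !sec_B eqxx ii0 (negPf k0') pw1 !sub0r.
  by rewrite -(pwD p_prime (a_exp p_prime)).
pose C := [set d | G d /\ forall c, G c -> E [~ d ^ c, sec y (la 0%R)]].
have Gy0 : G (sec y (la 0%R)) by exact: G_sec.
have nC : normal_subgroup C G.
  split.
  - split.
    + by split=> [|c _]; [exact: subg1 sG | rewrite conj1g comm1g; exact: subg1 sE].
    + move=> g h [Gg Cg] [Gh Ch]; split=> [|c Gc]; first exact: subgM sG Gg Gh.
      rewrite conjMg comm_mull.
      by apply: (subgM sE); [exact: normalJ nE (Cg _ Gc) (subgJ sG Gh Gc) | exact: Ch].
    + move=> g [Gg Cg]; split=> [|c Gc]; first exact: subgV sG Gg.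
      rewrite conjVg comm_invl.
      exact: normalJ nE (subgV sE (Cg _ Gc)) (subgV sG (subgJ sG Gg Gc)).
  - by move=> g [].
  - move=> g h [Gg Cg] Gh; split=> [|c Gc]; first exact: subgJ sG Gg Gh.
    by rewrite -conjgM; apply: Cg; exact: subgM sG Gh Gc.
have DC : D `<=` C.
  apply: (derived_sub_pw p_prime nC eNi).
  have Gba : G [~ b, A (ee (- i)%R)] by apply: subgR sG (@Gb p e) _; exact: GA.
  split=> // c Gc; have [h [Gh h1] <-] := sec_surj p_prime ee_neq0 (la 0%R) Gc.
  (* [x0] has trivial sections outside [la 0] and [la i], and [y] is trivial at [la i]; so
     [[x0 ^ h, y]] is supported at [la 0]. *)
  pose x0 := [~ B 0%R 1%R, B i 1%R].
  have x01 : St1 x0 by apply: subgR (St1_subgroup p) _ _; exact: B_St1.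
  have Dx0 : D x0 by apply: Dcomm; exact: GB.
  have x0sec z : sec x0 (la z) = [~ sec (B 0%R 1%R) (la z), sec (B i 1%R) (la z)].
    by rewrite sec_St1R //; exact: B_St1.
  have xh1 : St1 (x0 ^ h) by exact: St1J.
  split; first by apply: subgR sG _ Gy0; apply: subgJ sG Gba _; exact: G_sec.
  have -> : [~ b, A (ee (- i)%R)] ^ sec h (la 0%R) = sec (x0 ^ h) (la 0%R).
    rewrite sec_St1JS // x0sec !sec_B eqxx (negPf i0) pw1 mul1r sub0r.
    by [].
  rewrite -comm_emb //; first by apply: D3comm Gy; exact: normalJ nD Dx0 Gh.
  move=> z; have [j ->] := la_surj p_prime z; rewrite (inj_eq (@la_inj _ _)) => j0.
  have [->|ji] := eqVneq j i; first by rewrite yi; exact: commute1.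
  rewrite sec_St1JS // x0sec !sec_B eq_sym (negPf j0) eq_sym (negPf ji).
  have /commgP/eqP -> : commute (A (1 * ee (j - 0))%R) (A (1 * ee (j - i))%R).
    exact/commuteX2/commute_refl.
  by rewrite conj1g; exact/commute_sym/commute1.
rewrite -y0; split=> // d /DC [Gd Cd]; rewrite -[d]conjg1; apply: Cd.
exact: subg1 sG.
Qed.

Lemma H_full r r' : r != r' -> H (b * A r) -> H (b * A r') -> D3 `<=` E.
Proof.
move=> rr' Hr Hr'; have sH := H_subgroup.
have HA : H (A (r' - r)%R).
  have := subgM sH (subgV sH Hr) Hr'; rewrite invgM -mulgA mulKg.
  by rewrite -(pwN p_prime (a_exp p_prime)) -(pwD p_prime (a_exp p_prime)) addrC.
have Ha : H a.
  have r0 : (r' - r)%R != 0%R by rewrite subr_eq0 eq_sym.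
  exact (pw_gen p_prime (a_exp p_prime) sH r0 HA).
have Hb : H b := subgMl sH (subgX _ sH Ha) Hr.
have GH : G `<=` H := G_min sH Ha Hb.
by apply: commutator_sub sE _ => d g Dd /GH[_]; apply.
Qed.

Lemma low_D3 : D3 `<=` E.
Proof.
have [i ei] := ee_neq0; have [eNi|eNi] := eqVneq (ee (- i)%R) 0%R.
  exact: low_D3_single ei eNi.
have i0 : i != 0%R by apply: contraNneq ei => ->; rewrite (ee0 e p_prime).
have Ni0 : (- i != 0)%R by rewrite oppr_eq0.
have iNi : (i == - i)%R = false.
  by rewrite -subr_eq0 opprK -mulr2n -mulr_natr mulf_eq0 (negPf i0) (negPf (two_neq0 p_prime p_odd)).
(* By [H_full], if the claim fails then [rr] takes a single value for all [k], [t] and both signs of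
   [i]. This makes [ee] geometric along the multiples of [i]; Fermat's little theorem together with
   [eq3] forces ratio [1], a constant vector. *)
apply: contrapT => nDE.
have Heq r r' : H (b * A r) -> H (b * A r') -> r = r'.
  by move=> Hr Hr'; apply: contrapT => /eqP rr'; apply: nDE; exact: H_full rr' Hr Hr'.
pose al : F := (ee (- (i + i)) / ee (- i))%R; pose al' : F := (ee (i + i) / ee i)%R.
have rrE k t : rr i k t = (- (ee i * al) + t * (ee (- k) - al * ee (i - k)))%R.
  by rewrite /rr /al; field.
have rrE' k t : rr (- i)%R k t = (- (ee (- i) * al') + t * (ee (- k) - al' * ee (- i - k)))%R.
  by rewrite /rr /al' opprD !opprK; field.
have eNNi : ee (- (- i))%R != 0%R by rewrite opprK.
have eq1 k : k != 0%R -> k != i -> ee (- k)%R = (al * ee (i - k))%R.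
  move=> k0' ki; have := Heq _ _ (H_side 1%R ei eNi k0' ki) (H_side 0%R ei eNi k0' ki).
  by rewrite !rrE mul0r mul1r => /addrI /eqP; rewrite subr_eq0 => /eqP.
have eq2 k : k != 0%R -> (k != - i)%R -> ee (- k)%R = (al' * ee (- i - k))%R.
  move=> k0' ki; have := Heq _ _ (H_side 1%R eNi eNNi k0' ki) (H_side 0%R eNi eNNi k0' ki).
  by rewrite !rrE' mul0r mul1r => /addrI /eqP; rewrite subr_eq0 => /eqP.
have eq3 : (ee i * al = ee (- i) * al')%R.
  have iNi' : (- i != i)%R by rewrite eq_sym iNi.
  have := Heq _ _ (H_side 0%R ei eNi Ni0 iNi') (H_side 0%R eNi eNNi i0 (negbT iNi)).
  by rewrite rrE rrE' !mul0r !addr0 => /oppr_inj.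
have pow n : (0 < n < p)%N -> ee (n%:R * i)%R = (al' ^+ n.-1 * ee i)%R.
  case: n => // n /= np; elim: n np => [|n IH] np; first by rewrite !mul1r.
  have ni0 : (n.+2%:R * i != 0)%R.
    by rewrite mulf_neq0 //; apply: Fp_nat_neq0; rewrite np.
  have := eq2 (- (n.+2%:R * i))%R; rewrite !oppr_eq0 opprK => ->.
  - have -> : (- i + n.+2%:R * i = n.+1%:R * i)%R by rewrite -[in LHS]natr1; ring.
    by rewrite IH ?(ltnW np) // mulrA -exprS.
  - exact: ni0.
  - rewrite eqr_opp -subr_eq0 (_ : (_ - _ = n.+1%:R * i)%R); last by rewrite -[in LHS]natr1; ring.
    by rewrite mulf_neq0 //; apply: Fp_nat_neq0; rewrite (ltnW np).
have p2 : (2 < p)%N by exact: odd_prime_gt2.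
have alal' : (al * al' = 1)%R.
  have := eq1 (- i)%R Ni0; rewrite eq_sym iNi opprK => /(_ isT) E1.
  have E2 := pow 2%N p2; rewrite expr1 in E2.
  have E3 : (i + i = 2%:R * i)%R by ring.
  by rewrite E3 E2 mulrA in E1; apply: (mulIf ei); rewrite mul1r -E1.
have al'0 : al' != 0%R by apply: contra_eq_neq alal' => ->; rewrite mulr0 eq_sym oner_eq0.
have ferm : (al' ^+ p.-1 = 1)%R.
  apply: (mulIf al'0); rewrite mul1r -exprSr prednK ?prime_gt0 //.
  by have := expf_card al'; rewrite card_F.
have eNiE : (al' * ee (- i) = ee i)%R.
  have -> : (- i = p.-1%:R * i)%R.
    apply/eqP; rewrite eq_sym -addr_eq0 -[X in (_ + X)%R]mul1r -mulrDl natr1 prednK ?prime_gt0 //.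
    by rewrite (pcharf0 (pchar_Fp p_prime)) mul0r.
  have p1 : (0 < p.-1)%N by rewrite -subn1 subn_gt0 ltnW.
  rewrite pow; last by rewrite p1 ltn_predL prime_gt0.
  by rewrite mulrA -exprS prednK ?ferm ?mul1r.
have al1 : al = 1%R by apply: (mulfI ei); rewrite eq3 mulrC eNiE mulr1.
have al'1 : al' = 1%R by rewrite -alal' al1 mul1r.
apply: nconst; exists (ee i) => j j0.
have ji : j = ((j / i) * i)%R by rewrite divfK.
rewrite ji -(Fp_natE p_prime (j / i)%R) pow ?al'1 ?expr1n ?mul1r //.
rewrite Fp_val // lt0n andbT; apply: contraNneq j0 => v0.
by rewrite ji -(Fp_natE p_prime (j / i)%R) v0 mul0r.
Qed.

Let D3_emb x r : D3 r -> D3 (emb x r).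
Proof. by move=> Dr; apply: low_emb nD3 (low_D3 Dr). Qed.

(** [g] is the section at [y] of an element of [D], itself the section at [x] of an element [h] of
    [D3]. This costs two levels, whence [n0.+2] in [nonconstant_prodense]. *)
Lemma deep_comm x y r g : D3 r -> G g -> exists r1 r2,
  [/\ D3 r1, D3 r2 & emb x (emb y [~ r, g]) = [~ r1, r2]].
Proof.
have [i ->] := la_surj p_prime x; have [j ->] := la_surj p_prime y => Dr Gg.
have [d [Dd d1 <-]] := lev_get j nD (lev_D Gg).
have [h [Dh h1 hd]] := lev_get i nD3 (lev_D3 Dd).
exists (emb (la i) (emb (la j) r)), h; split=> //; first by apply: D3_emb; exact: D3_emb.
by rewrite emb_comm_sec // -hd emb_comm_sec.
Qed.

Lemma D3_noncommuting : exists r1 r2, [/\ D3 r1, D3 r2 & [~ r1, r2] <> 1].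
Proof.
have [j [j0 j1 ej]] := exists_jump; have ej' : (ee (j - 1) - ee j)%R != 0%R by rewrite subr_eq0.
pose r := [~ k0, B j 1%R].
have Dr : D3 r by apply: D3comm => //; exact: GB.
have r1 : r <> 1.
  move=> /(congr1 (fun f => sec f (la j))); rewrite sec1 sec_St1R; [|exact: k0_St1|exact: B_St1].
  rewrite k0_sec // sec_B eqxx pw1 => /eqP /commgP Ab.
  apply: (comm_ab_neq1 p_prime ee_neq0); apply/eqP/commgP/commute_sym.
  have -> : a = A (ee (j - 1) - ee j)%R ^+ val ((ee (j - 1) - ee j)^-1)%R.
    by rewrite -pwM ?divff ?pw1 //; exact: a_exp.
  by apply: commuteX; exact: commute_sym.
pose r' := emb (la 0%R) r.
have r'a : [~ r', a] <> 1.
  have ne : [:: la 0%R] != [:: act a (la 0%R)].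
    rewrite eqseq_cons andbT -{1}(pw1 a) act_A (inj_eq (@la_inj _ _)) add0r.
    by rewrite eq_sym oner_eq0.
  move=> /eqP /conjg_fixP; rewrite /r' embJ => E'; apply: r1.
  exact (@embw_disjoint p [:: la 0%R] [:: act a (la 0%R)] r _ erefl ne (esym E')).
have [s1 [s2 [Ds1 Ds2 sE']]] := deep_comm (la 0%R) (la 0%R) (D3_emb (la 0%R) Dr) (@Ga p e).
exists s1, s2; split=> //; rewrite -sE' => /(congr1 (fun f => sec (sec f (la 0%R)) (la 0%R))).
by rewrite !sec_emb_same !sec1.
Qed.

Lemma nonconstant_prodense M : is_subgroup M -> M `<=` G -> G `<=` gprod M D ->
  prodense e M.
Proof.
move=> sM MG MD; split=> // N g nN Ng g1; have sN := normal_subg nN.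
have [n0 Nr] := normal_rist p_prime ee_neq0 nD3 D3_emb nN Ng g1.
have UN : prodU e n0.+2 D4 `<=` N.
  apply: (prodU_sub sN) => u k.
  case/lastP: u => // u y; case/lastP: u => // u x; rewrite !size_rcons => -[un].
  pose K := [set k | N (embw (rcons (rcons u x) y) k)].
  have sK : is_subgroup K.
    split=> [|k1 k2 /= Hk Hl|k1 /= Hl]; rewrite /K /=.
    - by rewrite embw1; exact: subg1 sN.
    - by rewrite embwM; exact: subgM sN Hk Hl.
    - by rewrite embwV; exact: subgV sN Hl.
  move: k; apply: (commutator_sub sK) => r h Dr Gh; rewrite /K /=.
  rewrite !embw_rcons; have [r1 [r2 [Dr1 Dr2 ->]]] := deep_comm x y Dr Gh.
  by apply: Nr => //; rewrite un.
have pU := ppn_prodU p_prime n0.+2 (ppn_gamma4 e p_prime).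
have nMN := gprod_subgroup sM MG nN.
apply: (ppn_frattini pU nMN).
- by apply: gprod_sub => //; exact: normal_sub nN.
- by move=> h /UN Nh; apply: gprodr => //; exact: subg1 sM.
- move=> h /MD[m [d [Mm Dd ->]]]; exists m, d; split=> //.
  by apply: gprodl => //; exact: subg1 sN.
Qed.

Lemma nonconstant_frattini M : is_subgroup M -> M `<=` G -> G `<=` gprod M D -> G `<=` M.
Proof.
move=> sM MG MD.
apply: (prodense_full_group p_prime ee_neq0 nD3 D3_emb D3_noncommuting p_odd).
exact: nonconstant_prodense.
Qed.

End NonConstant.

(** * Maximal subgroups of virtually nilpotent groups *)

Section FiniteIndex.
Variable gT : groupType.
Implicit Types (G H M N Q X Y Z : set gT) (x y g h s : gT) (S : seq gT).

(** A colouring of [G] by finitely many colours, each inside one right coset of [H]. Colours may be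
    finer than cosets, which makes intersections and towers immediate. *)
Definition fin_idx H G := exists (I : finType) (f : gT -> I),
  forall g h, G g -> G h -> f g = f h -> H (g * h^-1).

Lemma fin_idx_sub H M G : fin_idx H G -> H `<=` M -> fin_idx M G.
Proof. by move=> [I [f fP]] HM; exists I, f => g h Gg Gh /(fP g h Gg Gh)/HM. Qed.

Lemma fin_idxI H M G : fin_idx H G -> fin_idx M G -> fin_idx (H `&` M) G.
Proof.
move=> [I [f fP]] [J [k kP]]; exists (I * J)%type, (fun g => (f g, k g)) => g h Gg Gh [E1 E2].
by split; [exact: fP | exact: kP].
Qed.

Lemma fin_idx_reps H G : is_subgroup G -> fin_idx H G -> exists (I : finType) (f : gT -> I) (r : I -> gT),
  (forall i, G (r i)) /\ forall g, G g -> f (r (f g)) = f g /\ H (g * (r (f g))^-1).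
Proof.
move=> sG [I [f fP]].
pose r i := xget 1 [set g | G g /\ f g = i]; exists I, f, r; split=> [i|g Gg].
  by rewrite /r; case: xgetP => [g _ []//|_]; exact: subg1 sG.
have [Gr fr] : G (r (f g)) /\ f (r (f g)) = f g.
  by rewrite /r; case: xgetP => [h _ [] //|/(_ g)] [].
by split=> //; apply: fP.
Qed.

Lemma fin_idx_trans H K G : is_subgroup G -> fin_idx H K -> fin_idx K G -> fin_idx H G.
Proof.
move=> sG [J [k kP]] /(fin_idx_reps sG)[I [f [r [Gr rP]]]].
exists (I * J)%type, (fun g => (f g, k (g * (r (f g))^-1))) => g h Gg Gh [fE kE].
have [_ Kg] := rP g Gg; have [_ Kh] := rP h Gh.
by have := kP _ _ Kg Kh kE; rewrite -fE; grpnorm.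
Qed.

Lemma fin_idx_finite_index H G : is_subgroup H -> is_subgroup G -> fin_idx H G -> finite_index H G.
Proof.
move=> sH sG /(fin_idx_reps sG)[I [f [r [Gr rP]]]]; rewrite /finite_index.
apply: (@sub_finite_set _ _ [set [set h * r i | h in H] | i in [set: I]]); last first.
  exact: finite_image.
move=> _ [g Gg <-]; exists (f g) => //; apply/seteqP; have [_ Hg] := rP g Gg.
split=> _ [h Hh <-].
  exists (h * (g * (r (f g))^-1)^-1); last by grpnorm.
  by apply: (subgM sH) => //; exact: subgV.
by exists (h * (g * (r (f g))^-1)); [exact: subgM | grpnorm].
Qed.

Definition fg X := exists S, (forall s, s \in S -> X s) /\ X `<=` generated [set s | s \in S].

(** Schreier generators. Since colours may refine cosets and the representative for the colour of
    [1] need not be [1], the elements [(r (f 1))^-1] and those [r i] lying in [H] are added. *)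
Lemma schreier H G (a b : gT) : G = generated [set a; b] -> is_subgroup H -> H `<=` G ->
  fin_idx H G -> fg H.
Proof.
move=> GE sH HG; have sG : is_subgroup G by rewrite GE; exact: generated_subgroup.
have Ga : G a by rewrite GE; apply: mem_generated; left.
have Gb : G b by rewrite GE; apply: mem_generated; right.
move=> /(fin_idx_reps sG)[I [f [r [Gr rP]]]].
pose gens := [:: a; b; a^-1; b^-1].
have Ggens x : x \in gens -> G x.
  by rewrite !inE => /or4P[] /eqP->; rewrite //; exact: subgV.
pose S := [seq r i * x * (r (f (r i * x)))^-1 | i <- enum I, x <- gens] ++
  ((r (f 1))^-1 :: [seq (if `[< H (r i) >] then r i else 1) | i <- enum I]).
have S1 i x : x \in gens -> r i * x * (r (f (r i * x)))^-1 \in S.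
  move=> xg; rewrite mem_cat; apply/orP; left; apply/allpairsP.
  by exists (i, x); rewrite mem_enum.
have S2 : (r (f 1))^-1 \in S by rewrite mem_cat inE eqxx orbT.
have S3 i : H (r i) -> r i \in S.
  move=> Hi; rewrite mem_cat inE; apply/orP; right; apply/orP; right.
  apply/mapP; exists i; rewrite ?mem_enum //.
  by case: asboolP.
exists S; split.
  move=> s; rewrite mem_cat inE => /orP[/allpairsP[[i x] /= [_ xg ->]]|/orP[/eqP->|/mapP[i _ ->]]].
  - by have [] := rP (r i * x) (subgM sG (Gr i) (Ggens _ xg)).
  - by have [_] := rP 1 (subg1 sG); rewrite mul1g.
  - by case: asboolP => // _; exact: subg1 sH.
set SS := generated _; have sSS : is_subgroup SS := generated_subgroup _.
have SSm s : s \in S -> SS s by move=> sS; exact: mem_generated.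
pose W := [set g | exists s i, SS s /\ g = s * r i].
have Wx g x : W g -> x \in gens -> W (g * x).
  move=> [s [i [Ss ->]]] xg.
  exists (s * (r i * x * (r (f (r i * x)))^-1)), (f (r i * x)); split.
    by apply: (subgM sSS) => //; exact: SSm (S1 _ _ xg).
  by grpnorm.
have W1 : W 1.
  by exists (r (f 1))^-1, (f 1); split; [exact: SSm | rewrite mulVg].
have GW g : G g -> forall w, W w -> W (w * g) /\ W (w * g^-1).
  rewrite GE; apply: (generated_sub (H := [set g | forall w, W w -> W (w * g) /\ W (w * g^-1)])).
    split.
    - by move=> w Ww; rewrite invg1 mulg1.
    - move=> k l Hk Hl w Ww; rewrite invgM !mulgA; split.
        by have [] := Hl _ (proj1 (Hk _ Ww)).
      by have [] := Hk _ (proj2 (Hl _ Ww)).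
    - by move=> k Hk w Ww; rewrite invgK; have [] := Hk _ Ww.
  by move=> k [->|->] w Ww; split; apply: Wx => //; rewrite !inE eqxx ?orbT.
move=> h Hh; have [] := GW h (HG _ Hh) 1 W1; rewrite mul1g => -[s [i [Ss hE]]] _.
have Hs : H s.
  move: Ss; apply: (generated_sub sH) => k; rewrite /= mem_cat inE.
  move=> /orP[/allpairsP[[j x] /= [_ xg ->]]|/orP[/eqP->|/mapP[j _ ->]]].
  - by have [] := rP (r j * x) (subgM sG (Gr j) (Ggens _ xg)).
  - by have [_] := rP 1 (subg1 sG); rewrite mul1g.
  - by case: asboolP => // _; exact: subg1 sH.
rewrite hE; apply: (subgM sSS) => //; apply: SSm; apply: S3.
by apply: (subgMr sH Hs); rewrite -hE.
Qed.

(** A nontrivial finitely generated abelian group is not divisible. Generators are killed one by one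
    until [X / Q] is cyclic on [s]; then [q] is a prime divisor of the order of [s], or [2] if that
    order is infinite, and [s] is not a [q]-th power. *)
Lemma exists_prime_not_divisible X Q S : is_subgroup X -> normal_subgroup Q X ->
  (forall x y, X x -> X y -> Q [~ x, y]) -> (forall s, s \in S -> X s) ->
  X `<=` generated ([set s | s \in S] `|` Q) -> (exists2 x, X x & ~ Q x) ->
  exists2 q, prime q & exists2 x, X x & forall y, X y -> ~ Q (y ^+ q * x^-1).
Proof.
move=> sX; elim: S Q => [|s S IH] Q nQ ab SX gen [x Xx nQx]; have sQ := normal_subg nQ.
  by case: nQx; apply: (gen _ Xx Q); split=> // z [].
have Xs : X s by apply: SX; rewrite mem_head.
pose Q1 := gprod (generated [set s]) Q.
have nQ1 : normal_subgroup Q1 X := normal_between sX nQ ab Xs Xs.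
have sQ1 := normal_subg nQ1.
have QQ1 : Q `<=` Q1 by apply: gprodr; exact: subg1 (generated_subgroup _).
have Q1s : Q1 s by exists s, 1; split; [exact: mem_generated | exact: subg1 sQ | rewrite mulg1].
have [XQ1|XQ1] := pselect (X `<=` Q1); last first.
  have ex : exists2 y, X y & ~ Q1 y.
    by apply: contrapT => h; apply: XQ1 => y Xy; apply: contrapT => nQy; apply: h; exists y.
  have gen1 : X `<=` generated ([set s | s \in S] `|` Q1).
    move=> y /gen; apply: generated_sub; first exact: generated_subgroup.
    move=> z [/=|Qz]; last by apply: mem_generated; right; exact: QQ1.
    rewrite inE => /orP[/eqP->|zS]; first by apply: mem_generated; right.
    by apply: mem_generated; left.
  have [||q qp [y Xy yq]] := IH Q1 nQ1 _ _ gen1 ex.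
  - by move=> k l Xk Xl; apply: QQ1; exact: ab.
  - by move=> k kS; apply: SX; rewrite inE kS orbT.
  by exists q => //; exists y => // z Xz /QQ1; exact: yq.
have nQs : ~ Q s.
  move=> Qs; apply: nQx; have [z [u [zs Qu ->]]] := XQ1 _ Xx; apply: (subgM sQ) => //.
  by move: zs; apply: generated_sub => // _ ->.
have [q qp qdiv] : exists2 q, prime q & forall d, (0 < d)%N -> Q (s ^+ d) -> (q %| d)%N.
  have [[n /andP[n0 Qn]]|free] := pselect (exists n, (0 < n)%N && `[< Q (s ^+ n) >]); last first.
    exists 2%N => // d d0 Qd; case: free; exists d; rewrite d0; exact/asboolP.
  have ex : exists n, (0 < n)%N && `[< Q (s ^+ n) >] by exists n; rewrite n0.
  case: (ex_minnP ex) => m /andP[m0 /asboolP Qm] mmin.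
  have m1 : (1 < m)%N.
    rewrite ltn_neqAle m0 andbT; apply/eqP => m1; apply: nQs.
    by rewrite -(expg1 s) m1.
  exists (pdiv m); first exact: pdiv_prime.
  move=> d d0 Qd; apply: (dvdn_trans (pdiv_dvd m)); apply: contraT => md.
  have r0 : (0 < d %% m)%N by rewrite lt0n.
  have : (m <= d %% m)%N.
    apply: mmin; rewrite r0; apply/asboolP.
    have : Q (s ^+ (d %/ m * m) * s ^+ (d %% m)) by rewrite -expgnDr -divn_eq.
    by apply: (subgMr sQ); rewrite mulnC expgnA; exact: subgX.
  by rewrite leqNgt ltn_pmod.
exists q => //; exists s => // y Xy Qys.
have [z [u [zs Qu yE]]] := XQ1 _ Xy.
have [m [k zE]] := cyclic_generated zs.
(* Modulo Q, y = s^(m - k), so that y^q = s reads s^(q m) = s^(q k + 1). *)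
have Qpow n : Q (y ^+ n * (z ^+ n)^-1).
  elim: n => [|n IHn]; first by rewrite !expg0 mulgV; exact: subg1 sQ.
  have Xz : X z.
    have -> : z = y * u^-1 by rewrite yE mulgK.
    by apply: (subgM sX) => //; apply: (subgV sX); exact: normal_sub nQ _ Qu.
  have -> : y ^+ n.+1 * (z ^+ n.+1)^-1 = (u * (y ^+ n * (z ^+ n)^-1)) ^ z^-1.
    by rewrite !expgS {1}yE; grpnorm.
  by apply: (normalJ nQ); [exact: subgM sQ Qu IHn | exact: subgV sX Xz].
have Qz : Q (z ^+ q * s^-1).
  have -> : z ^+ q * s^-1 = (y ^+ q * (z ^+ q)^-1)^-1 * (y ^+ q * s^-1) by grpnorm.
  by apply: (subgM sQ) => //; apply: (subgV sQ).
have Qq : Q (s ^+ (q * m) * (s ^+ (q * k).+1)^-1).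
  have C : commute (s ^+ m) (s ^+ k)^-1 by apply/commuteV/commuteX2/commute_refl.
  move: Qz; rewrite zE expgMn // expVgn -!expgnA ![(_ * q)%N]mulnC expgS invgM.
  by rewrite -!mulgA.
have Qmod i j : Q (s ^+ i * (s ^+ j)^-1) -> (j <= i)%N -> Q (s ^+ (i - j)).
  by move=> Qij ij; rewrite expgnFr.
have [le|lt] := leqP (q * k).+1 (q * m).
  have := Qmod _ _ Qq le.
  have : (0 < q * m - (q * k).+1)%N \/ (q * m = (q * k).+1)%N by lia.
  move=> [d0 /(qdiv _ d0)|E].
    have -> : (q * m - (q * k).+1 = q * (m - k) - 1)%N by rewrite mulnBr; lia.
    move=> qd; have : (q %| 1)%N.
      have -> : (1 = q * (m - k) - (q * (m - k) - 1))%N by rewrite mulnBr; lia.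
      by apply: dvdn_sub => //; exact: dvdn_mulr.
    by rewrite dvdn1 => /eqP q1; move: qp; rewrite q1.
  have : (q %| (q * k).+1)%N by rewrite -E dvdn_mulr.
  rewrite -addn1 dvdn_addr ?dvdn_mulr // dvdn1 => /eqP q1.
  by move: qp; rewrite q1.
have Qq' : Q (s ^+ (q * k).+1 * (s ^+ (q * m))^-1).
  by rewrite -[_ * _]invgK invgM invgK; exact: subgV sQ Qq.
have := Qmod _ _ Qq' (ltnW lt).
have d0 : (0 < (q * k).+1 - q * m)%N by lia.
move=> /(qdiv _ d0) => qd; have : (q %| 1)%N.
  have E : ((q * k).+1 = (q * k).+1 - q * m + q * m)%N by lia.
  have : (q %| (q * k).+1)%N by rewrite E dvdn_add // dvdn_mulr.
  by rewrite -addn1 dvdn_addr // dvdn_mulr.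
by rewrite dvdn1 => /eqP q1; move: qp; rewrite q1.
Qed.

Lemma expgMn_mod X Q x y n : is_subgroup X -> normal_subgroup Q X ->
  (forall x y, X x -> X y -> Q [~ x, y]) -> X x -> X y ->
  Q (x ^+ n * y ^+ n * ((x * y) ^+ n)^-1).
Proof.
move=> sX nQ ab Xx Xy; have sQ := normal_subg nQ.
elim: n => [|n IH]; first by rewrite !expg0 mulg1 mulgV; exact: subg1 sQ.
have -> : x ^+ n.+1 * y ^+ n.+1 * ((x * y) ^+ n.+1)^-1 =
    [~ x, y ^+ n] ^ (x ^+ n * y ^+ n * x)^-1 * (x ^+ n * y ^+ n * ((x * y) ^+ n)^-1).
  by rewrite !expgSr; grpnorm.
have XX z k : X z -> X (z ^+ k) by exact: subgX.
apply: (subgM sQ) => //; apply: (normalJ nQ); first exact: ab Xx (XX _ _ Xy).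
apply: (subgV sX); apply: (subgM sX) => //.
exact: subgM sX (XX _ _ Xx) (XX _ _ Xy).
Qed.

Lemma fin_idx_exponent X Q S n : is_subgroup X -> normal_subgroup Q X ->
  (forall x y, X x -> X y -> Q [~ x, y]) -> (forall s, s \in S -> X s) ->
  X `<=` generated ([set s | s \in S] `|` Q) -> (0 < n)%N ->
  (forall x, X x -> Q (x ^+ n)) -> fin_idx Q X.
Proof.
move=> sX; elim: S Q => [|s S IH] Q nQ ab SX gen n0 Xn; have sQ := normal_subg nQ.
  exists unit, (fun=> tt) => g h Xg Xh _.
  have XQ : X `<=` Q by move=> x /gen; apply: generated_sub => // z [].
  by apply: (subgM sQ); [exact: XQ | apply: (subgV sQ); exact: XQ].
have Xs : X s by apply: SX; rewrite mem_head.
pose Q1 := gprod (generated [set s]) Q.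
have nQ1 : normal_subgroup Q1 X := normal_between sX nQ ab Xs Xs.
have sQ1 := normal_subg nQ1.
have QQ1 : Q `<=` Q1 by apply: gprodr; exact: subg1 (generated_subgroup _).
have Q1s : Q1 s by exists s, 1; split; [exact: mem_generated | exact: subg1 sQ | rewrite mulg1].
apply: (@fin_idx_trans _ Q1) => //; last first.
  apply: IH => //.
  - by move=> k l Xk Xl; apply: QQ1; exact: ab.
  - by move=> k kS; apply: SX; rewrite inE kS orbT.
  - move=> y /gen; apply: generated_sub; first exact: generated_subgroup.
    move=> z [/=|Qz]; last by apply: mem_generated; right; exact: QQ1.
    rewrite inE => /orP[/eqP->|zS]; first by apply: mem_generated; right.
    by apply: mem_generated; left.
  - by move=> x Xx; apply: QQ1; exact: Xn.
have ex g : Q1 g -> exists i : 'I_n, Q ((s ^+ i)^-1 * g).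
  move=> /(cyclic_supplement nQ Xs n0 (Xn _ Xs))[m Qm].
  exists (Ordinal (ltn_pmod m n0)) => /=.
  have -> : (s ^+ (m %% n))^-1 * g = (s ^+ n) ^+ (m %/ n) * ((s ^+ m)^-1 * g).
    have -> : s ^+ m = s ^+ (m %% n) * (s ^+ n) ^+ (m %/ n).
      by rewrite -expgnA -expgnDr addnC [(n * _)%N]mulnC -divn_eq.
    by grpnorm.
  by apply: (subgM sQ) => //; exact: subgX sQ (Xn _ Xs).
pose k g := xget (Ordinal n0) [set i | Q ((s ^+ i)^-1 * g)].
have kP g : Q1 g -> Q ((s ^+ (k g))^-1 * g).
  by move=> /ex[i Qi]; rewrite /k; case: xgetP => // /(_ i).
exists 'I_n, k => g h Qg Qh kE.
have := kP _ Qg; have := kP _ Qh; rewrite -kE; set c := s ^+ _ => Q2 Q3.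
have -> : g * h^-1 = ((c^-1 * g) * (c^-1 * h)^-1) ^ c^-1 by grpnorm.
apply: (normalJ nQ); last by apply: (subgV sX); exact: subgX.
by apply: (subgM sQ) => //; exact: subgV.
Qed.

Lemma maximal_gprod G M X : is_subgroup G -> maximal_subgroup M G -> normal_subgroup X G ->
  ~ X `<=` M -> gprod M X = G.
Proof.
move=> sG [sM [MG _] mM] nX XM.
have sMX := gprod_subgroup sM MG nX.
have [E|//] := mM _ sMX (gprodl (subg1 (normal_subg nX))) (gprod_sub sG MG (normal_sub nX)).
by case: XM; rewrite -E; apply: gprodr; exact: subg1 sM.
Qed.

(** With [Q] the intersection of [M] and [X], the subgroup [Q X^q] is normal in [G = M X]. Outside
    [M] it would supplement [M], and every element of [X] would be a [q]-th power modulo [Q], false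
    for the [q] of [exists_prime_not_divisible]. So [X / Q] has exponent dividing [q] and is finite,
    and [X] meets every coset of [M]. *)
Lemma maximal_fin_idx G M X S : is_subgroup G -> maximal_subgroup M G -> normal_subgroup X G ->
  ~ X `<=` M -> (forall x y, X x -> X y -> M [~ x, y]) -> (forall s, s \in S -> X s) ->
  X `<=` generated ([set s | s \in S] `|` (M `&` X)) -> fin_idx M G.
Proof.
move=> sG mM nX XM ab SX gen; have [sM [MG _] _] := mM; have sX := normal_subg nX.
have XG := normal_sub nX.
have GMX := maximal_gprod sG mM nX XM.
pose Q := M `&` X.
have sQ : is_subgroup Q.
  split; first by split; [exact: subg1 sM | exact: subg1 sX].
    by move=> x y [Mx Xx] [My Xy]; split; [exact: subgM sM Mx My | exact: subgM sX Xx Xy].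
  by move=> x [Mx Xx]; split; [exact: subgV sM Mx | exact: subgV sX Xx].
have abQ x y : X x -> X y -> Q [~ x, y].
  by move=> Xx Xy; split; [exact: ab | exact: subgR sX Xx Xy].
have nQX : normal_subgroup Q X.
  split=> // [x [] //|u x Qu Xx].
  rewrite (_ : u ^ x = u * [~ u, x]); last by grpnorm.
  by apply: (subgM sQ) => //; apply: abQ => //; case: Qu.
have nQ : normal_subgroup Q G.
  split=> // [x [_ /XG] //|u g [Mu Xu]]; rewrite -GMX => -[m [x [Mm Xx ->]]].
  rewrite conjgM; apply: (normalJ nQX) => //; split; first exact: subgJ sM Mu Mm.
  by apply: (normalJ nX) => //; exact: MG.
have ex : exists2 x, X x & ~ Q x.
  by apply: contrapT => h; apply: XM => y Xy; apply: contrapT => My; apply: h; exists y => // -[].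
have [q qp [x Xx xq]] := exists_prime_not_divisible sX nQX abQ SX gen ex.
pose Y := [set z | exists y u, [/\ X y, Q u & z = u * y ^+ q]].
have XX z k : X z -> X (z ^+ k) by exact: subgX.
have YX : Y `<=` X by move=> _ [y [u [Xy [_ Xu] ->]]]; exact: subgM sX Xu (XX _ _ Xy).
have sY : is_subgroup Y.
  split.
  - by exists 1, 1; split; [exact: subg1 sX | exact: subg1 sQ | rewrite expg1n mulg1].
  - move=> _ _ [y [u [Xy Qu ->]]] [z [v [Xz Qv ->]]].
    exists (y * z), (u * v ^ (y ^+ q)^-1 * (y ^+ q * z ^+ q * ((y * z) ^+ q)^-1)).
    split; [exact: subgM sX Xy Xz| |by grpnorm].
    apply: (subgM sQ); last exact: expgMn_mod sX nQX abQ Xy Xz.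
    by apply: (subgM sQ) => //; apply: (normalJ nQX) => //; exact: subgV sX (XX _ _ Xy).
  - move=> _ [y [u [Xy Qu ->]]].
    exists y^-1, ((u^-1) ^ (y ^+ q)); split; first exact: subgV sX Xy.
      by apply: (normalJ nQX (subgV sQ Qu)); exact: XX.
    by rewrite expVgn; grpnorm.
have nY : normal_subgroup Y G.
  split=> // [z /YX/XG //|_ g [y [u [Xy Qu ->]]] Gg].
  exists (y ^ g), (u ^ g); split; [exact: normalJ nX Xy Gg|exact: normalJ nQ Qu Gg|].
  by rewrite conjMg conjXg.
have YM : Y `<=` M.
  apply: contrapT => /(maximal_gprod sG mM nY) E.
  have : G x by exact: XG.
  rewrite -E => -[m [_ [Mm [y [u [Xy Qu ->]]] xE]]].
  have Xm : X m.
    have Xuy : X (u * y ^+ q) by apply: (subgM sX); [case: Qu | exact: XX].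
    by apply: (subgMl sX Xuy); rewrite -xE.
  apply: (xq _ Xy).
  have -> : y ^+ q * x^-1 = u^-1 * m^-1 by rewrite xE; grpnorm.
  by apply: (subgM sQ); exact: (subgV sQ).
have q0 := prime_gt0 qp.
have [I [f fP]] : fin_idx Q X.
  apply: (@fin_idx_exponent X Q S q) => // y Xy; split; last exact: XX.
  by apply: YM; exists y, 1; split; [|exact: subg1 sQ|rewrite mul1g].
pose r g := xget 1 [set x | X x /\ M (g * x^-1)].
have rP g : G g -> X (r g) /\ M (g * (r g)^-1).
  rewrite -{1}GMX => -[m [z [Mm Xz gE]]]; rewrite /r; case: xgetP => [y _ //|/(_ z)[]].
  by split=> //; rewrite gE mulgK.
exists I, (f \o r) => g h /rP[Xg Mg] /rP[Xh Mh] /= fE.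
have [Mr _] := fP _ _ Xg Xh fE.
have -> : g * h^-1 = g * (r g)^-1 * (r g * (r h)^-1) * (h * (r h)^-1)^-1 by grpnorm.
by apply: (subgM sM); [exact: subgM sM Mg Mr | exact: subgV sM Mh].
Qed.

(* Applied with X = [N, N], and if this lies in M with X = N: in both cases X is abelian and
   finitely generated modulo M. *)
Lemma maximal_fin_idx_class2 G M N : is_subgroup G -> maximal_subgroup M G ->
  normal_subgroup N G -> fg N -> fin_idx N G ->
  (forall d h, commutator_subgroup N N d -> N h -> M [~ d, h]) -> fin_idx M G.
Proof.
move=> sG mM nN [S [SN NS]] NG cM; have sM : is_subgroup M by case: mM.
have sN := normal_subg nN; have nNN := normal_refl sN.
pose D := commutator_subgroup N N.
have nD : normal_subgroup D G := commutator_normal sG nN nN.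
have nDN : normal_subgroup D N := commutator_normal sN nNN nNN.
have sD := normal_subg nD; have DN := normal_sub nDN.
have [DM|DM] := pselect (D `<=` M); last first.
  (* As [[D, N] <= M], commutators are bilinear modulo [M], so those of generators of [N] generate
     [D] modulo [M]. *)
  pose C := [seq [~ s, t] | s <- S, t <- S].
  have CD c : c \in C -> D c.
    by move=> /allpairsP[[s t] /= [sS tS ->]]; apply: mem_commutator; exact: SN.
  apply: (maximal_fin_idx (S := C) sG mM nD DM) => //.
    by move=> x y Dx /DN; exact: cM.
  set W := generated _; have sW : is_subgroup W := generated_subgroup _.
  have WD : W `<=` D by apply: (generated_sub sD) => z [/CD|[]].
  have nW : normal_subgroup W N.
    split=> // [z /WD/DN //|w h Ww Nh].
    rewrite (_ : w ^ h = w * [~ w, h]); last by grpnorm.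
    have Dw := WD _ Ww.
    apply: (subgM sW) => //; apply: mem_generated; right; split; first exact: cM.
    exact: normalR nDN Dw Nh.
  have W1 s h : s \in S -> N h -> W [~ s, h].
    move=> sS Nh; suff [] : [set h | N h /\ W [~ s, h]] h by [].
    apply: (generated_sub (centralizer_mod sN nW (SN _ sS)) _ (NS _ Nh)) => t tS.
    split; first exact: SN.
    by apply: mem_generated; left; apply/allpairsP; exists (s, t).
  apply: (commutator_sub sW) => x y Nx Ny.
  suff [] : [set h | N h /\ W [~ x, h]] y by [].
  apply: (generated_sub (centralizer_mod sN nW Nx) _ (NS _ Ny)) => t tS.
  by split; [exact: SN | apply: (commg_sym_mod sW); exact: W1].
have [NM|NM] := pselect (N `<=` M); first exact: fin_idx_sub NG NM.
apply: (maximal_fin_idx (S := S) sG mM nN NM) => //.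
  by move=> x y Nx Ny; apply: DM; exact: mem_commutator.
move=> x /NS; apply: generated_sub; first exact: generated_subgroup.
by move=> s sS; apply: mem_generated; left.
Qed.

End FiniteIndex.

Section ConjugateCentralizer.
Variable gT : groupType.
Implicit Types (G E : set gT).

Lemma conj_centralizer_normal G E s : is_subgroup G -> normal_subgroup E G -> G s ->
  normal_subgroup [set k | G k /\ forall g, G g -> E [~ k, s ^ g]] G.
Proof.
move=> sG nE Gs; have sE := normal_subg nE; split.
- split.
  + by split; [exact: subg1 sG | move=> g _; rewrite comm1g; exact: subg1 sE].
  + move=> k l [Gk kc] [Gl lc]; split; first exact: subgM sG Gk Gl.
    move=> g Gg; rewrite comm_mull.
    by apply: (subgM sE); [exact: normalJ nE (kc _ Gg) Gl | exact: lc].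
  + move=> k [Gk kc]; split; first exact: subgV sG Gk.
    move=> g Gg; rewrite comm_invl.
    by apply: (normalJ nE); [apply: (subgV sE); exact: kc | exact: subgV sG Gk].
- by move=> k [].
- move=> k h [Gk kc] Gh; split; first exact: subgJ sG Gk Gh.
  move=> g Gg; rewrite -(conjgKV h (s ^ g)) -conjRg -conjgM.
  by apply: (normalJ nE) => //; apply: kc; exact: subgM sG Gg (subgV sG Gh).
Qed.

End ConjugateCentralizer.

(** * Constant defining vectors *)

Section Constant.
Variables (p : nat) (e : 'rV['F_p]_p.-1) (p_prime : prime p) (p_odd : odd p) (c : 'F_p).
Local Notation F := 'F_p.
Local Notation wrd := (wrd p).
Local Notation a := (gen_a p).
Local Notation b := (gen_b e).
Local Notation A := (pw a).
Local Notation B := (B e).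
Local Notation G := (GGS e).
Local Notation ee := (ee e).
Local Notation ev := (ev e).
Local Notation la := (la p_prime).
Implicit Types (f g h : tree_aut p) (M N X Y U Z : set (tree_aut p)).
Hypotheses (c0 : c != 0%R) (eec : forall i, i != 0%R -> ee i = c).

Let sG : is_subgroup G := G_subgroup e.
Let nG : normal_subgroup G G := normal_refl sG.

Lemma const_ee_neq0 : exists i, ee i != 0%R.
Proof. by exists 1%R; rewrite eec. Qed.
Let ee_neq0 := const_ee_neq0.

(** Here [sigma = - c], so this is the weight [wt] again. *)
Definition kap (w : wrd) : F := (w.2 + c * tot w)%R.

Lemma kap_mul w w' : kap (wmul w w') = (kap w + kap w')%R.
Proof. by rewrite /kap tot_mul mulrDr /= !addrA; congr (_ + _)%R; rewrite addrAC. Qed.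
Lemma kap_inv w : kap (winv w) = (- kap w)%R.
Proof. by rewrite /kap tot_inv mulrN opprD. Qed.

(** A syllable [B i k] contributes [c k] to every section: through [b^k] at [la i], through
    [a^(c k)] elsewhere. *)
Lemma kap_wsec w j : kap (wsec e w j) = (c * tot w)%R.
Proof.
rewrite /kap wsec_s // tot_wsec // tot_nu (bigD1 j) //= subrr ee0 // mulr0 add0r.
rewrite [in RHS](bigD1 j) //= mulrDr addrC; congr (_ + _)%R.
rewrite big_distrr /=; apply: eq_bigr => i ij.
by rewrite eec ?[(_ * c)%R]mulrC // subr_eq0 eq_sym.
Qed.

(** Defined through some word for [g]: that [kap] depends on the element only is shown later, in
    [kap_thl_ev]. *)
Definition K : set (tree_aut p) := [set g | exists2 w, g = ev w & kap w = 0%R].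

Lemma K_normal : normal_subgroup K G.
Proof.
split.
- split.
  + by exists ([::], 0%R); rewrite ?ev_a // /kap /tot big_nil mulr0 addr0.
  + move=> _ _ [w -> w0] [w' -> w'0]; exists (wmul w w'); first by rewrite (ev_mul e p_prime).
    by rewrite kap_mul w0 w'0 addr0.
  + move=> _ [w -> w0]; exists (winv w); first by rewrite (ev_inv e p_prime).
    by rewrite kap_inv w0 oppr0.
- by move=> _ [w -> _]; exact: G_ev.
- move=> _ g [w -> w0] /(G_word p_prime)[v ->].
  exists (wmul (winv v) (wmul w v)).
    by rewrite !(ev_mul e p_prime) (ev_inv e p_prime).
  by rewrite !kap_mul kap_inv w0 add0r addNr.
Qed.
Let sK : is_subgroup K := normal_subg K_normal.
Let KG : K `<=` G := normal_sub K_normal.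

Lemma K_fin_idx : fin_idx K G.
Proof.
pose r g : wrd := xget ([::], 0%R) [set w | g = ev w].
have rP g : G g -> g = ev (r g).
  by move=> /(G_word p_prime)[w gw]; rewrite /r; case: xgetP => [_ _ -> //|/(_ w)].
exists F, (fun g => kap (r g)) => g h Gg Gh gh.
exists (wmul (r g) (winv (r h))).
  by rewrite (ev_mul e p_prime) (ev_inv e p_prime) -!rP.
by rewrite kap_mul kap_inv gh subrr.
Qed.

Definition t : tree_aut p := b * A (- c)%R.

Lemma act_t i : act t (la i) = la (i - c)%R.
Proof. by rewrite actM act_b act_A. Qed.

Lemma t_ev : t = ev ([:: (0%R, 1%R)], - c)%R.
Proof. by rewrite /ev /= mulg1 B00 (pw1 b). Qed.

Lemma Kt : K t.
Proof. by exists ([:: (0%R, 1%R)], - c)%R; rewrite ?t_ev // /kap /tot big_seq1 mulr1 addNr. Qed.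
Let Gt : G t := KG Kt.

Lemma t_neq1 : t <> 1.
Proof.
move=> t1; have := act_t 0%R; rewrite t1 act1 => /la_inj /eqP.
by rewrite sub0r eq_sym oppr_eq0 (negPf c0).
Qed.

(** Modulo [Z] the generator [b] equals [a^c], so each [B i k] equals [a^(c k)] and each word equals
    [a^(kap w)]. *)
Lemma K_sub Z : normal_subgroup Z G -> Z t -> K `<=` Z.
Proof.
move=> nZ Zt; have sZ := normal_subg nZ.
have Zb n : Z (b ^+ n * A (- c)%R ^+ n).
  elim: n => [|n IH]; first by rewrite !expg0 mulg1; exact: subg1 sZ.
  have -> : b ^+ n.+1 * A (- c)%R ^+ n.+1 = (b ^+ n * A (- c)%R ^+ n) ^ b^-1 * t.
    by rewrite /t expgS expgSr; grpnorm.
  by apply: (subgM sZ) => //; exact: normalJ nZ IH (subgV sG (@Gb p e)).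
have ZB i k : Z (B i k * A (- (c * k))%R).
  have -> : B i k * A (- (c * k))%R = (pw b k * A (- c)%R ^+ val k) ^ A i.
    rewrite conjMg -BE -(pwM p_prime (a_exp p_prime)) mulNr; congr (_ * _).
    by apply/esym/conjg_fixP/commgP; rewrite /commute -!(pwD p_prime (a_exp p_prime)) addrC.
  by apply: (normalJ nZ); [exact: Zb | exact: GA].
move=> _ [[l s] -> ]; rewrite /kap /=.
have Zl : Z (evl e l * A (- (c * tot (l, s)))%R).
  rewrite /tot /=; elim: l => [|[i k] l IH].
    by rewrite big_nil mulr0 oppr0 mulg1; exact: subg1 sZ.
  rewrite big_cons mulrDr opprD addrC (pwD p_prime (a_exp p_prime)) /=.
  set T := A (- (c * _))%R in IH *; set T' := A (- (c * k))%R.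
  have -> : B i k * evl e l * (T * T') = (evl e l * T) ^ (B i k)^-1 * (B i k * T').
    by grpnorm.
  apply: (subgM sZ); last exact: ZB.
  by apply: (normalJ nZ); [exact: IH | exact: (subgV sG (@GB p e i k))].
by move=> /eqP; rewrite addr_eq0 => /eqP sE; rewrite /ev /= sE.
Qed.

Definition yy (i j : F) : tree_aut p := B i 1%R * (B j 1%R)^-1.

Lemma yy_ev i j : yy i j = ev ([:: (i, 1%R); (j, - 1)%R], 0%R).
Proof. by rewrite /yy /ev /= !mulg1 BN. Qed.

Lemma K_yy i j : K (yy i j).
Proof.
exists ([:: (i, 1%R); (j, - 1)%R], 0%R); first exact: yy_ev.
by rewrite /kap /tot big_cons big_seq1 /= subrr mulr0 addr0.
Qed.

Lemma yy_St1 i j : St1 (yy i j).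
Proof.
exact: subgM (St1_subgroup p) (B_St1 e i _) (subgV (St1_subgroup p) (B_St1 e j _)).
Qed.

Lemma sec_yy i j k : i != j -> sec (yy i j) (la k) =
  if k == i then t else if k == j then t^-1 else 1.
Proof.
move=> ij; rewrite /yy (sec_St1M _ _ (B_St1 e i _)) (sec_St1V _ (B_St1 e j _)).
rewrite !(sec_B e p_prime) !mul1r (pw1 b) ![_ == k]eq_sym.
have pwNc : (A c)^-1 = A (- c)%R by rewrite (pwN p_prime (a_exp p_prime)).
case: (eqVneq k i) => [->|ki].
  by rewrite (negPf ij) eec ?pwNc // subr_eq0.
rewrite eec ?subr_eq0 //; case: (eqVneq k j) => [_|kj].
  by rewrite /t invgM (pwN p_prime (a_exp p_prime)) invgK.
by rewrite eec ?subr_eq0 // mulgV.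
Qed.

Definition K2 := commutator_subgroup K K.
Definition K3 := commutator_subgroup K2 K.
Lemma K2_normal : normal_subgroup K2 G.
Proof. exact: commutator_normal sG K_normal K_normal. Qed.
Let nK2 := K2_normal.
Let one2 : (1 : F)%R != (- 1)%R.
Proof.
rewrite -subr_eq0 opprK; exact: two_neq0 p_prime p_odd.
Qed.

(** [yy 0 1 ^ h], with [h] fixing the letters, and [yy (-1) 0] share only the letter [0] of their
    supports, since [1 != - 1]; this puts [[t ^ g, t^-1]] at [la 0] into [K']. As [K] is the normal
    closure of [t], centralising modulo [E] extends from [t] to [K], one entry at a time. *)
Lemma K2_emb x d : K2 d -> K2 (emb x d).
Proof.
pose E := low e p_prime K2.
have nE : normal_subgroup E G := low_normal p_prime ee_neq0 nK2.
have sE := normal_subg nE.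
suff KE : K2 `<=` E by move=> /KE; exact: low_emb.
have E1 g : G g -> E [~ t ^ g, t^-1].
  move=> Gg; split; first exact: subgR sG (subgJ sG Gt Gg) (subgV sG Gt).
  have [h [Gh h1] <-] := sec_surj p_prime ee_neq0 (la 0%R) Gg.
  have y1 := yy_St1 0%R 1%R; have y2 := yy_St1 (- 1)%R 0%R.
  have ne1 : (0 : F)%R != 1%R by rewrite eq_sym oner_eq0.
  have ne2 : (- 1 : F)%R != 0%R by rewrite oppr_eq0 oner_eq0.
  have := @comm_emb p (yy 0%R 1%R ^ h) (yy (- 1)%R 0%R) (la 0%R) (St1J h y1) y2.
  rewrite (sec_St1JS _ y1 h1) !sec_yy // !eqxx eq_sym (negPf ne2) => <-.
    by apply: mem_commutator; [exact: normalJ K_normal (K_yy _ _) Gh | exact: K_yy].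
  move=> y; have [k ->] := la_surj p_prime y => k0.
  rewrite (sec_St1JS _ y1 h1) !sec_yy //.
  have -> : (k == 0%R) = false by apply: contraNF k0 => /eqP->.
  case: (eqVneq k 1%R) => [->|_]; last by rewrite conj1g /commute mul1g mulg1.
  by rewrite (negPf one2) /commute mul1g mulg1.
pose T s := [set k | G k /\ forall g, G g -> E [~ k, s ^ g]].
have KT1 : K `<=` T t^-1.
  apply: K_sub; first exact: conj_centralizer_normal sG nE (subgV sG Gt).
  split=> // g Gg.
  have -> : [~ t, t^-1 ^ g] = [~ t ^ g^-1, t^-1] ^ g by rewrite conjRg conjgKV.
  by apply: (normalJ nE) => //; apply: E1; exact: (subgV sG).
apply: (commutator_sub sE) => k1 k2 Kk1 Kk2.
suff KT2 : K `<=` T k2.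
  by have [_ /(_ 1 (subg1 sG))] := KT2 _ Kk1; rewrite conjg1.
apply: K_sub; first exact: conj_centralizer_normal sG nE (KG Kk2).
split=> // g Gg; have Kk := normalJ K_normal Kk2 Gg.
have [Gk /(_ 1 (subg1 sG))] := KT1 _ Kk; rewrite conjg1 => Ek.
have sC := centralizer_mod sG nE Gk.
have : [set h | G h /\ E [~ k2 ^ g, h]] t^-1 by split=> //; exact: (subgV sG).
by move=> /(subgVr sC)[_]; exact: commg_sym_mod.
Qed.

(** [t] moves [la c] to [la 0], so if [y] has section [t] at [la c] and [1] at [la 0], then [[y, t]]
    has a conjugate of [t] at [la 0]. The section [t^-1] of [y] is put at [c + c], which is not [0]
    as [p] is odd. *)
Lemma K_sub_lev : K `<=` lev p_prime K2.
Proof.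
have nL : normal_subgroup (lev p_prime K2) G := lev_normal p_prime ee_neq0 nK2.
apply: (K_sub nL).
have y1 := yy_St1 c (c + c)%R; set y := yy c (c + c)%R in y1 *.
have cc : c != (c + c)%R by rewrite -subr_eq0 opprD addNKr oppr_eq0.
have cc0 : (0 == c + c)%R = false.
  rewrite eq_sym -mulr2n -mulr_natl; apply/negbTE; rewrite mulf_neq0 //.
  exact: two_neq0 p_prime p_odd.
have Ky : K2 [~ y, t] by apply: mem_commutator; [exact: K_yy | exact: Kt].
have yt1 : St1 [~ y, t] by apply: (subgM (St1_subgroup p)); [exact: (subgV (St1_subgroup p)) | exact: St1J].
have := lev_at p_prime 0%R nK2 Ky yt1.
have -> : sec [~ y, t] (la 0%R) = t ^ sec t (la c).
  rewrite commgEl (sec_St1M _ _ (subgV (St1_subgroup p) y1)) (sec_St1V _ y1).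
  have -> : sec y (la 0%R) = 1 by rewrite sec_yy // eq_sym (negPf c0) cc0.
  rewrite invg1 mul1g -{1}(subrr c) -act_t (sec_St1J _ _ y1); congr (_ ^ _).
  by rewrite sec_yy // eqxx.
move=> Lt; have Gs : G (sec t (la c)) by exact: G_sec.
by rewrite -(conjgK (sec t (la c)) t); exact: normalJ nL Lt (subgV sG Gs).
Qed.

(* This is where the branching over [K''] comes from: [r] is placed at [x], then [k] is realised
   as the section at [x] of an element of [K']. *)
Lemma K2_comm_emb x r k : K2 r -> K k ->
  exists2 h, K2 h & [~ emb x r, h] = emb x [~ r, k].
Proof.
have [j ->] := la_surj p_prime x.
move=> Kr /K_sub_lev /(lev_get j nK2)[h [Kh h1 <-]]; exists h => //.
by rewrite emb_comm_sec.
Qed.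

Lemma K2_nc : exists r1 r2, [/\ K2 r1, K2 r2 & [~ r1, r2] <> 1].
Proof.
have [r [Kr _ rt]] := K_sub_lev Kt.
have r1 : r <> 1 by move=> r1; apply: t_neq1; rewrite -rt r1 sec1.
have Ker := K2_emb (la 0%R) Kr.
have [h Kh E] := K2_comm_emb (la 0%R) Ker Kt.
exists (emb (la 0%R) (emb (la 0%R) r)), h; split=> //; first exact: K2_emb.
rewrite E => E1; apply: r1.
have /conjg_fixP : [~ emb (la 0%R) r, t] == 1.
  by apply/eqP; apply: (@emb_inj p (la 0%R)); rewrite E1 emb1.
rewrite embJ => /(congr1 (fun f : tree_aut p => sec f (la 0%R))); rewrite sec_emb_same sec_emb act_t sub0r.
case: eqP => [/la_inj/eqP|_ -> //].
by rewrite eq_sym oppr_eq0 (negPf c0).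
Qed.

Lemma normal_K3 N g : normal_subgroup N G -> N g -> g <> 1 ->
  exists n, prodU e n K3 `<=` N.
Proof.
move=> nN Ng g1; have sN := normal_subg nN.
have [n Nn] := normal_rist p_prime ee_neq0 nK2 K2_emb nN Ng g1.
have sembw v : is_subgroup [set d | N (embw v d)].
  split=> [|x y /= Nx Ny|x /= Nx] /=.
  - by rewrite embw1; exact: subg1 sN.
  - by rewrite embwM; exact: subgM sN Nx Ny.
  - by rewrite embwV; exact: subgV sN Nx.
exists n.+1; apply: (prodU_sub sN) => u d un.
have [v [x uE]] : exists v x, u = rcons v x.
  by case/lastP: u un => // v x _; exists v, x.
have vn : (n <= size v)%N by move: un; rewrite uE size_rcons => -[->].
rewrite {u un}uE.
move=> Kd; rewrite embw_rcons.
suff : K3 `<=` [set d | N (embw (rcons v x) d)] by move=> /(_ d Kd); rewrite /= embw_rcons.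
apply: (commutator_sub (sembw _)) => r k Kr Kk; rewrite /= embw_rcons.
have [h Kh <-] := K2_comm_emb x Kr Kk.
by apply: Nn => //; exact: K2_emb.
Qed.

(** A finite-index subgroup whose threefold commutators lie in [prodU n K3], by [StK_comm]. *)
Fixpoint StK n : set (tree_aut p) :=
  if n is m.+1 then K `&` prodS (StK m) else K.

Lemma StK_normal n : normal_subgroup (StK n) G.
Proof.
elim: n => [|n IH] /=; first exact: K_normal.
have sS := normal_subg IH; have sP := prodS_subgroup sS; split.
- split.
  + by split; [exact: subg1 sK | exact: subg1 sP].
  + by move=> g h [Kg Pg] [Kh Ph]; split; [exact: subgM sK Kg Kh | exact: subgM sP Pg Ph].
  + by move=> g [Kg Pg]; split; [exact: subgV sK Kg | exact: subgV sP Pg].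
- by move=> g [/KG].
- move=> g h [Kg Pg] Gh; split; first exact: normalJ K_normal Kg Gh.
  by apply: prodSJ => // k x Sk; apply: (normalJ IH) => //; exact: G_sec.
Qed.

Lemma StK_fin_idx n : fin_idx (StK n) G.
Proof.
elim: n => [|n [I [f fP]]]; first exact: K_fin_idx.
apply: fin_idxI; first exact: K_fin_idx.
exists {ffun 'I_p -> 'I_p * I}, (fun g => [ffun x => (act g x, f (sec g x))]).
move=> g h Gg Gh /ffunP gh.
have gha x : act g x = act h x by have := gh x; rewrite !ffunE => -[].
have gh1 : St1 (g * h^-1) by move=> x; rewrite actM gha actK.
split=> // x; rewrite secM secV gha actK; apply: fP; try exact: G_sec.
by have := gh x; rewrite !ffunE => -[].
Qed.

Lemma StK_comm n d h : commutator_subgroup (StK n) (StK n) d -> StK n h ->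
  prodU e n K3 [~ d, h].
Proof.
elim: n d h => [|n IH] d h; first exact: mem_commutator.
move=> Dd [Kh [h1 Sh]].
have sP := prodS_subgroup (commutator_subgroupP (StK n) (StK n)).
have [d1 dS] : prodS (commutator_subgroup (StK n) (StK n)) d.
  apply: (commutator_sub sP _ Dd) => g k [Kg [g1 Sg]] [Kk [k1 Sk]].
  split; first exact: subgR (St1_subgroup p) g1 k1.
  by move=> x; rewrite (sec_St1R _ g1 k1); apply: mem_commutator; [exact: Sg | exact: Sk].
have Gd : G d.
  have nS := StK_normal n.+1.
  exact: normal_sub (commutator_normal sG nS nS) _ Dd.
split; first exact: subgR sG Gd (KG Kh).
split; first exact: subgR (St1_subgroup p) d1 h1.
by move=> x; rewrite (sec_St1R _ d1 h1); apply: IH; [exact: dS | exact: Sh].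
Qed.

Lemma const_finite_index M : maximal_subgroup M G -> finite_index M G.
Proof.
move=> mM; have [sM [MG GM] _] := mM.
apply: contrapT => nfin; apply: GM.
apply: (prodense_full_group p_prime ee_neq0 nK2 K2_emb K2_nc p_odd).
split=> // N g nN Ng g1.
(* A normal subgroup outside [M] supplements it; one inside [M] makes the index finite by the
   class-two argument. *)
have [NM|NM] := pselect (N `<=` M); last by rewrite (maximal_gprod sG mM nN NM).
case: nfin; apply: (fin_idx_finite_index sM sG).
have [n nK] := normal_K3 nN Ng g1; have nS := StK_normal n.
apply: (maximal_fin_idx_class2 sG mM nS) => [||d h Dd Sh].
- exact: (schreier erefl (normal_subg nS) (normal_sub nS) (StK_fin_idx n)).
- exact: StK_fin_idx.
- by apply: NM; apply: nK; exact: StK_comm.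
Qed.

End Constant.

(** * Failure of branching for constant vectors *)

Section NotBranch.
Variables (p : nat) (e : 'rV['F_p]_p.-1) (p_prime : prime p) (c : 'F_p).
Local Notation F := 'F_p.
Local Notation wrd := (wrd p).
Local Notation a := (gen_a p).
Local Notation b := (gen_b e).
Local Notation A := (pw a).
Local Notation B := (B e).
Local Notation G := (GGS e).
Local Notation ee := (ee e).
Local Notation ev := (ev e).
Local Notation la := (la p_prime).
Local Notation t := (t e c).
Implicit Types (f g h : tree_aut p).
Hypotheses (c0 : c != 0%R) (eec : forall i, i != 0%R -> ee i = c).

Let sG : is_subgroup G := G_subgroup e.
Let ee_neq0 := const_ee_neq0 c0 eec.

Variable z : algC.
Hypothesis z_prim : (p.-primitive_root z)%R.

Definition zt (i : F) : algC := (z ^+ val i)%R.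

Lemma ztD i j : zt (i + j)%R = (zt i * zt j)%R.
Proof.
rewrite /zt -exprD (Fp_add p_prime) -[in RHS](prim_expr_mod z_prim).
by [].
Qed.
Lemma zt0 : zt 0%R = 1%R. Proof. exact: expr0. Qed.

Lemma zt_neq1 i : i != 0%R -> zt i != 1%R.
Proof.
move=> i0; rewrite /zt -(prim_order_dvd z_prim) gtnNdvd ?Fp_val // lt0n.
by apply: contra i0 => /eqP i0; apply/eqP/val_inj.
Qed.

(* Sending [a] to [u |-> z u] and [b] to [u |-> z^c u + z^c - 1] defines a homomorphism from the free
   product of two cyclic groups of order p to the affine group of [algC]; [thl l] is the image of [0]
   under the product of the syllables of [l]. *)
Fixpoint thl (l : seq (syl p)) : algC :=
  if l is (i, k) :: l' then (zt (- i) * (zt (c * k) - 1) + zt (c * k) * thl l')%R else 0%R.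

Lemma thl_shift d l : thl (shiftl d l) = (zt (- d) * thl l)%R.
Proof.
elim: l => [|[i k] l IH] /=; first by rewrite mulr0.
by rewrite IH opprD ztD; ring.
Qed.

Lemma thl_secl i k l j : thl (secl e ((i, k) :: l) j).1 =
  (((i == j)%:R * (zt (c * k) - 1)) + zt (c * k) * thl (secl e l j).1)%R.
Proof.
rewrite /=; case: (eqVneq i j) => [_|ij] /=; first by rewrite oppr0 zt0.
rewrite thl_shift opprK eec ?subr_eq0 1?eq_sym // mul0r add0r.
by rewrite [(k * c)%R]mulrC.
Qed.

(** As sections shrink, this recursion makes [thl] vanish on relations. *)
Lemma thl_sections l : thl l = (\sum_j zt (- j) * thl (secl e l j).1)%R.
Proof.
elim: l => [|[i k] l IH]; first by rewrite big1 // => j _; rewrite mulr0.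
under eq_bigr => j _ do rewrite thl_secl mulrDr mulrCA [(zt (- j) * (zt _ * _))%R]mulrCA.
rewrite big_split /= -big_distrr /= -IH (bigD1 i) //= eqxx mul1r big1 ?addr0 // => j ji.
by rewrite eq_sym (negPf ji) mul0r.
Qed.

(** Without the twist by [zt (- j)], the sum over the coordinates sees only the exponent sum of [b];
    this is the obstruction behind [emb_t_notin_G]. *)
Lemma thl_sum_sections l : (\sum_j thl (secl e l j).1 = zt (c * tot (l, 0)) - 1)%R.
Proof.
elim: l => [|[i k] l IH].
  by rewrite big1 // /tot big_nil mulr0 zt0 subrr.
under eq_bigr => j _ do rewrite thl_secl.
rewrite big_split /= -big_distrr /= IH (bigD1 i) //= eqxx mul1r big1 ?addr0 => [|j ji].
  by rewrite /tot big_cons /= [(c * (_ + _))%R]mulrDr ztD; ring.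
by rewrite eq_sym (negPf ji) mul0r.
Qed.

Lemma thl_concentrated l j : (forall ik, ik \in l -> ik.1 = j) ->
  thl l = (zt (- j) * (zt (c * tot (l, 0)) - 1))%R.
Proof.
elim: l => [|[i k] l IH] lj /=; first by rewrite /tot big_nil mulr0 zt0 subrr mulr0.
have -> : i = j by apply: (lj (i, k)); rewrite mem_head.
rewrite IH => [|ik il]; last by apply: lj; rewrite inE il orbT.
by rewrite /tot big_cons /= [(c * (_ + _))%R]mulrDr ztD; ring.
Qed.

(* Every relation of G shrinks under taking sections, unless all its syllables are powers of the
   same [B j 1]. *)
Lemma relation_thl (w : wrd) : ev w = 1 -> tot w = 0%R /\ thl w.1 = 0%R.
Proof.
move En : (len w) => n; elim/ltn_ind: n w En => n IH w En w1.
have w20 : w.2 = 0%R.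
  by have := act_ev e p_prime w 0%R; rewrite w1 act1 => /la_inj; rewrite add0r.
have totE : tot (w.1, 0%R) = tot w by [].
have [[j wj]|small] := pselect (exists j, (len w <= cn w j)%N).
  have tot0 : tot w = 0%R.
    apply: contrapT => /eqP tn0; apply: (pw_b_neq_A p_prime ee_neq0 tn0 (s := 0%R)).
    have /eqP := w1; rewrite /ev w20 mulg1 (concentrated e p_prime wj) BE.
    by rewrite conjg_eq1 => /eqP.
  split=> //; rewrite (@thl_concentrated _ j) => [|ik].
    by rewrite totE tot0 mulr0 zt0 subrr mulr0.
  have : all (fun ik : syl p => ik.1 == j) w.1 by rewrite all_count eqn_leq count_size.
  by move=> /allP/[apply]/eqP.
have IHj j : tot (wsec e w j) = 0%R /\ thl (wsec e w j).1 = 0%R.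
  apply: (IH (len (wsec e w j))) => //; last by rewrite ev_wsec // w1 sec1.
  by rewrite len_wsec -En ltnNge; apply/negP => h; apply: small; exists j.
split.
  by rewrite tot_nu big1 // => j _; rewrite -(tot_wsec e); have [] := IHj j.
by rewrite thl_sections big1 // => j _; have [_] := IHj j; rewrite /wsec => ->; rewrite mulr0.
Qed.

Lemma thl_mul w w' : thl (wmul w w').1 = (thl w.1 + zt (kap c w) * thl w'.1)%R.
Proof.
suff H l s l' : thl (l ++ shiftl (- s)%R l') = (thl l + zt (s + c * tot (l, 0)) * thl l')%R.
  exact: H.
elim: l => [|[i k] l IH] /=.
  by rewrite /tot big_nil mulr0 addr0 add0r thl_shift opprK.
rewrite IH /tot big_cons /= [(c * (k + _))%R]mulrDr addrCA [zt (c * k + _)%R]ztD; ring.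
Qed.

Lemma kap_thl_ev (w w' : wrd) : ev w = ev w' -> kap c w = kap c w' /\ thl w.1 = thl w'.1.
Proof.
have inv (v v' : wrd) : ev v = ev v' ->
    kap c v = kap c v' /\ (thl v.1 + zt (kap c v) * thl (winv v').1 = 0)%R.
  move=> vv; have v1 : ev (wmul v (winv v')) = 1.
    by rewrite (ev_mul e p_prime) (ev_inv e p_prime) vv mulgV.
  have [tot0 thl0] := relation_thl v1; split; last by rewrite -thl_mul.
  have s0 : (v.2 - v'.2 = 0)%R.
    by have := act_ev e p_prime (wmul v (winv v')) 0%R; rewrite v1 act1 => /la_inj; rewrite add0r.
  move: tot0; rewrite tot_mul tot_inv => /eqP; rewrite subr_eq0 => /eqP tE.
  by move/eqP: s0; rewrite subr_eq0 /kap tE => /eqP ->.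
(* Both words are compared with the same inverse word [winv w'], whose contribution cancels. *)
move=> ww; have [kE E] := inv _ _ ww; have [_ E'] := inv w' w' erefl.
by split=> //; move: E; rewrite kE -E' => /addIr.
Qed.

(** For a word [w] of this element the values of [thl] on the sections add up to [d (z^c - 1)] and
    also to [z^(c tot w) - 1]. Here [c tot w] is [kap] of the section [t^d], hence [0], while
    [z^c != 1]. *)
Lemma emb_t_notin_G d : (0 < d)%N -> ~ G (emb (la 0%R) (t ^+ d)).
Proof.
move=> d0 /(G_word p_prime)[w wE].
pose tw : wrd := ([:: (0%R, 1%R)], - c)%R.
have kt : kap c tw = 0%R by rewrite /kap /tot big_seq1 mulr1 addNr.
have kX n : kap c (wexp tw n) = 0%R /\ thl (wexp tw n).1 = (n%:R * (zt c - 1))%R.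
  elim: n => [|n [IH1 IH2]].
    by rewrite /kap /tot big_nil /= mulr0 addr0 mul0r.
  rewrite [wexp _ _]/= kap_mul thl_mul IH1 IH2 kt addr0 zt0 mul1r; split=> //.
  by rewrite /= oppr0 zt0 mulr1 mulr0 addr0 mul1r mulrS mulrDl mul1r.
have secE j : sec (ev w) (la j) = if j == 0%R then t ^+ d else 1.
  by rewrite -wE sec_emb (inj_eq (@la_inj p p_prime)).
have w0 : ev (wsec e w 0%R) = ev (wexp tw d).
  by rewrite ev_wsec // secE eqxx ev_wexp // -t_ev.
have [k0 t0] := kap_thl_ev w0; have [kd td] := kX d.
have := thl_sum_sections w.1; rewrite (bigD1 0%R) //= big1 => [|j j0]; last first.
  have [] // := @relation_thl (wsec e w j).
  by rewrite ev_wsec // secE (negPf j0).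
move: k0; rewrite kap_wsec // kd => tot0.
rewrite addr0 -/(wsec e w 0%R) t0 td.
have -> : (c * tot (w.1, 0) = 0)%R by exact: tot0.
rewrite zt0 subrr => /eqP; rewrite mulf_eq0 pnatr_eq0 subr_eq0 (negPf (zt_neq1 c0)).
by rewrite orbF; case: d d0 {wE kX secE w0 t0 kd td tot0}.
Qed.

(** The factor at [[:: x]] is [emb x] of its own section, and the other factors have trivial section
    at [x]; so this coordinate of the product is one of the factors. *)
Lemma Rist1_emb g x : Rist G 1 g -> G (emb x (sec g x)).
Proof.
move=> [h hR <-].
have hE y z' : z' != y -> h [tuple y] [:: z'] = [:: z'].
  by move=> zy; apply: (proj2 (hR [tuple y])); rewrite /= andbT eq_sym.
have h1 (u : 1.-tuple 'I_p) : St1 (h u).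
  case/tupleP: u => y u; rewrite (tuple0 u) => {u} z'.
  have fixz k : k != y -> act (h [tuple y]) k = k by move=> /hE; rewrite aut_letter => -[].
  have [->|] := eqVneq z' y; last exact: fixz.
  have [//|ky] := eqVneq (act (h [tuple y]) y) y.
  by have /act_inj E := fixz _ ky; rewrite E eqxx in ky.
have hs y z' : z' != y -> sec (h [tuple y]) z' = 1.
  move=> zy; apply: tree_autP => v.
  have : h [tuple y] (z' :: v) = z' :: v.
    by apply: (proj2 (hR [tuple y])); rewrite /= eq_sym (negPf zy).
  by rewrite autE => -[].
have prod_sec (r : seq (1.-tuple 'I_p)) : uniq r -> St1 (\prod_(u <- r) h u) /\
    sec (\prod_(u <- r) h u) x = if [tuple x] \in r then sec (h [tuple x]) x else 1.
  elim: r => [_|u r IH]; first by rewrite big_nil; split; [exact: subg1 (St1_subgroup p) | exact: sec1].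
  rewrite /= => /andP[ur /IH[r1 rE]]; rewrite big_cons; split; first exact: subgM (St1_subgroup p) (h1 u) r1.
  rewrite (sec_St1M _ _ (h1 u)) rE inE; have [xu|xu] := eqVneq [tuple x] u.
    by rewrite xu (negPf ur) mulg1.
  suff -> : sec (h u) x = 1 by rewrite mul1g.
  move: xu; case/tupleP: u {ur} => y u; rewrite (tuple0 u) => xy.
  by apply: hs; apply: contraNneq xy => ->.
have [_ ->] := prod_sec _ (index_enum_uniq _); rewrite mem_index_enum.
have <- : h [tuple x] = emb x (sec (h [tuple x]) x).
  by apply: emb_eq => //; exact: hs.
exact: (proj1 (hR [tuple x])).
Qed.

(** Were the index finite, two powers of [yy 0 1] would share a coset, and a positive power would
    have its coordinate [t^n] separately in [G]. *)
Lemma const_not_branch : ~ is_branch G.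
Proof.
move=> [_ /(_ 1%N)]; rewrite /finite_index.
pose y := yy e 0%R 1%R; have y1 : St1 y := yy_St1 e 0%R 1%R.
have Gy : G y by apply: (normal_sub (K_normal e p_prime c)); exact: K_yy.
have sR1 : Rist G 1 1.
  exists (fun=> 1); first by move=> u; split; first exact: subg1 sG.
  by rewrite big1.
pose f n := [set h * y ^+ n | h in Rist G 1] => fin.
have [m [n [mn E]]] : exists m n, (m < n)%N /\ f m = f n.
  apply: contrapT => inj; apply: infinite_nat.
  have finj : {in [set: nat] &, injective f}.
    move=> m n _ _ E; apply: contrapT => /eqP; rewrite neq_ltn => /orP[mn|mn]; apply: inj.
      by exists m, n.
    by exists n, m.
  rewrite -(eq_finite_set (inj_card_eq finj)); apply: sub_finite_set fin.
  by move=> _ [n _ <-]; exists (y ^+ n) => //; exact: (subgX n sG Gy).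
have Ry : Rist G 1 (y ^+ (n - m)).
  have : f n (y ^+ n) by exists 1; rewrite ?mul1g.
  by rewrite -E => -[h Rh hE]; rewrite expgnFr ?(ltnW mn) // -hE mulgK.
have := Rist1_emb (la 0%R) Ry; rewrite (sec_St1X _ _ y1).
rewrite (sec_yy p_prime eec) ?eqxx; last by rewrite eq_sym oner_eq0.
by apply: emb_t_notin_G; rewrite subn_gt0.
Qed.

End NotBranch.

(** * Maximal subgroups containing the derived subgroup *)

Section MaximalSubgroups.
Variables (p : nat) (e : 'rV['F_p]_p.-1) (p_prime : prime p).
Local Notation F := 'F_p.
Local Notation G := (GGS e).
Local Notation D := (commutator_subgroup G G).
Implicit Types (M : set (tree_aut p)).

Let sG : is_subgroup G := G_subgroup e.

Lemma has_index_finite M n : has_index M G n -> finite_index M G.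
Proof. by exists n. Qed.

Lemma expg_p_derived g : G g -> D (g ^+ p).
Proof.
move=> /(G_word p_prime)[w ->]; rewrite -(ev_wexp e p_prime).
have cp : (p%:R = 0 :> F)%R := pcharf0 (pchar_Fp p_prime).
apply: (word_derived p_prime).
  by rewrite wexp2 -mulr_natr cp mulr0.
by rewrite tot_wexp -mulr_natr cp mulr0.
Qed.

(** [G / M] is abelian of exponent [p] without proper nontrivial subgroups, so the powers
    [g^0, ..., g^(p-1)] of any [g] outside [M] represent the cosets. *)
Lemma maximal_derived M : maximal_subgroup M G -> D `<=` M ->
  normal_subgroup M G /\ has_index M G p.
Proof.
move=> mM DM; have [sM [MG GM] maxM] := mM.
have nM : normal_subgroup M G.
  split=> // x g Mx Gg; rewrite (_ : x ^ g = x * [~ x, g]); last by grpnorm.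
  by apply: (subgM sM Mx); apply: DM; apply: mem_commutator => //; exact: MG.
split=> //; have [g Gg Mg] : exists2 g, G g & ~ M g.
  by apply: contrapT => h; apply: GM => g Gg; apply: contrapT => Mg; apply: h; exists g.
have Mp x : G x -> M (x ^+ p) by move=> /expg_p_derived/DM.
have ex x : G x -> exists m, M ((g ^+ m)^-1 * x).
  move=> Gx; apply: (cyclic_supplement nM Gg (prime_gt0 p_prime) (Mp _ Gg)).
  have sT := generated_subgroup [set g].
  have gG : generated [set g] `<=` G by apply: (generated_sub sG) => _ ->.
  have [E|->//] := maxM _ (gprod_subgroup sT gG nM) (gprodr (subg1 sT)) (gprod_sub sG gG MG).
  by case: Mg; rewrite -E; apply: (gprodl (subg1 sM)); exact: mem_generated.
pose f i := [set h * g ^+ i | h in M].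
have Gx i : G (g ^+ i) := subgX i sG Gg.
have fE x y : G x -> G y -> M (x^-1 * y) -> [set h * x | h in M] = [set h * y | h in M].
  move=> Gx' Gy Mxy.
  have Myx : M (y * x^-1).
    have -> : y * x^-1 = (x^-1 * y) ^ x^-1 by grpnorm.
    exact: normalJ nM Mxy (subgV sG Gx').
  apply/seteqP; split=> _ [h Mh <-].
    by exists (h * (y * x^-1)^-1); [exact: subgM sM Mh (subgV sM Myx) | grpnorm].
  by exists (h * (y * x^-1)); [exact: subgM sM Mh Myx | grpnorm].
have E : right_cosets M G = f @` `I_p.
  apply/seteqP; split=> [_ [x Gxx <-]|_ [i _ <-]]; last by exists (g ^+ i).
  have [m Mm] := ex x Gxx; exists (m %% p)%N; first exact: ltn_pmod (prime_gt0 p_prime).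
  apply: fE => //.
  have -> : (g ^+ (m %% p))^-1 * x = (g ^+ p) ^+ (m %/ p) * ((g ^+ m)^-1 * x).
    have -> : g ^+ m = g ^+ (m %% p) * (g ^+ p) ^+ (m %/ p).
      by rewrite -expgnA -expgnDr addnC [(p * _)%N]mulnC -divn_eq.
    by grpnorm.
  by apply: (subgM sM) => //; exact: (subgX _ sM (Mp _ Gg)).
rewrite /has_index E; apply: inj_card_eq.
have inj i j : (i < j < p)%N -> f i <> f j.
  move=> /andP[ij jp] fij; apply: Mg.
  have Mji : M (g ^+ (j - i)).
    have : f j (g ^+ j) by exists 1; rewrite ?mul1g //; exact: subg1 sM.
    by rewrite -fij => -[h Mh hE]; rewrite expgnFr ?(ltnW ij) // -hE mulgK.
  have cop : coprime (j - i) p.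
    by rewrite coprime_sym prime_coprime // gtnNdvd //; lia.
  have [|k l kE _] := @egcdnP (j - i) p; first lia.
  have : M (g ^+ (k * (j - i))) by rewrite mulnC expgnA; exact: subgX.
  rewrite kE (eqP cop) addn1 expgSr; apply: (subgMr sM).
  by rewrite mulnC expgnA; exact: (subgX _ sM (Mp _ Gg)).
move=> i j; rewrite !inE /= => ip jp fij; apply: contrapT => /eqP.
by rewrite neq_ltn => /orP[ij|ij]; [apply: (inj i j) | apply: (inj j i)]; rewrite ?ij.
Qed.

Lemma ee_neq0_of : e != 0%R -> exists i, ee e i != 0%R.
Proof.
move=> e0; have [i ei] : exists i, e ord0 i != 0%R.
  apply: contrapT => h; move/eqP: e0; apply; apply/rowP => i; rewrite mxE.
  by apply: contrapT => /eqP ei; apply: h; exists i.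
(* [ee] at [i] reads the entry of [e] with index [i - 1], hence the shift. *)
exists ((nat_of_ord i)%:R + 1)%R; rewrite /ee addrK.
have -> : val ((nat_of_ord i)%:R : F)%R = i.
  rewrite (Fp_val_nat p_prime) modn_small //.
  by apply: leq_trans (ltn_ord i) _; exact: leq_pred.
by rewrite valK.
Qed.

Lemma maximal_nonconstant M : odd p -> ~ (exists c, forall i, i != 0%R -> ee e i = c) ->
  maximal_subgroup M G -> normal_subgroup M G /\ has_index M G p.
Proof.
move=> p_odd nconst mM; apply: maximal_derived => //; apply: contrapT => DM.
have [sM [MG GM] _] := mM; apply: GM.
have nD := commutator_normal sG (normal_refl sG) (normal_refl sG).
apply: (nonconstant_frattini p_prime p_odd nconst sM MG).
by rewrite (maximal_gprod sG mM nD DM).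
Qed.

End MaximalSubgroups.

Theorem theorem1p1 (p : nat) (e : 'rV['F_p]_p.-1)
    (p_prime : prime p) (p_odd : odd p) (e_neq0 : e != 0%R) :
  (forall M : set (tree_aut p),
     maximal_subgroup M (GGS e) -> finite_index M (GGS e)) /\
  (is_branch (GGS e) ->
   forall M : set (tree_aut p), maximal_subgroup M (GGS e) ->
     normal_subgroup M (GGS e) /\ has_index M (GGS e) p).
Proof.
have [[c eec]|nconst] := pselect (exists c, forall i, i != 0%R -> ee e i = c); last first.
  have H M := @maximal_nonconstant p e p_prime M p_odd nconst.
  by split=> [M /H[_ /has_index_finite]|_ M /H].
have c0 : c != 0%R.
  have [i ei] := ee_neq0_of p_prime e_neq0.
  have i0 : i != 0%R by apply: contraNneq ei => ->; rewrite (ee0 e p_prime).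
  by rewrite -(eec i i0).
split; first by move=> M; exact: (const_finite_index p_prime p_odd c0 eec).
(* A primitive [p]-th root of unity shows that [G] is not branch, so the second claim is vacuous
   here. *)
by have [z /(const_not_branch p_prime c0 eec)] := C_prim_root_exists (prime_gt0 p_prime).
Qed.
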